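(* Let $f\in \mathbf{L}_2^r(\mathbb{R})$ and assume that $x_\star\in \mathbf{L}_2^r(\mathbb{R})$ is a solution of $\mathcal{L}_h x_\star=f$. Then $x_\star\in \mathbf{V}_t$. Let $\alpha$ be a positive constant, let the initial guess satisfy $x^{(0)}\in \mathbf{V}_t\cap \mathbf{L}_2^r(\mathbb{R})$, and let $x^{(k)}$, $k=0,1,2,\ldots$, be the iterates of the WR-HSS method in time domain started at $x^{(0)}$. Then the WR-HSS method and its frequency domain counterpart are closed in $\mathbf{V}_t\cap \mathbf{L}_2^r(\mathbb{R})$ and $\mathbf{V}_\omega\cap \mathbf{L}_2^r(\mathbb{R})$ respectively; that is, $x^{(k)}\in \mathbf{V}_t\cap \mathbf{L}_2^r(\mathbb{R})$ and $\tilde x^{(k)}\in \mathbf{V}_\omega\cap \mathbf{L}_2^r(\mathbb{R})$ for all $k\ge 0$. In addition, for all $k\ge 0$, $$|||x^{(k+1)}-x_\star|||_t\le \sigma(\alpha)\,|||x^{(k)}-x_\star|||_t,$$ where $$\sigma(\alpha)=\max_{\lambda_j\in\lambda(H)}\left|\frac{\alpha-\lambda_j}{\alpha+\lambda_j}\right|<1$$ and $\lambda(H)$ is the set of eigenvalues of $H$. Therefore the WR-HSS method in time domain is convergent (that is, $|||x^{(k)}-x_\star|||_t\to 0$) for any positive constant $\alpha$. Moreover, if $\gamma_{\min}$ and $\gamma_{\max}$ are the smallest and the largest eigenvalues of $H$, respectively, then $$\alpha^*=\arg\min_{\alpha>0}\left\{\max_{\gamma_{\min}\le\lambda\le\gamma_{\max}}\left|\frac{\alpha-\lambda}{\alpha+\lambda}\right|\right\}=\sqrt{\gamma_{\min}\gamma_{\max}}$$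 and $$\sigma(\alpha^* )=\frac{\sqrt{\gamma_{\max}}-\sqrt{\gamma_{\min}}}{\sqrt{\gamma_{\max}}+\sqrt{\gamma_{\min}}}=\frac{\sqrt{\kappa(H)}-1}{\sqrt{\kappa(H)}+1},$$ where $\kappa(H)$ is the spectral condition number of $H$.
   Context: Let $B\in\mathbb{C}^{r\times r}$ be Hermitian and let $A\in\mathbb{C}^{r\times r}$ be non-Hermitian positive definite, meaning that its Hermitian part $H=\frac12(A+A^* )$ is Hermitian positive definite. Put $S=\frac12(A-A^* )$, the skew-Hermitian part of $A$. $\mathbf{L}_2^r(\mathbb{R})$ is the Hilbert space of Lebesgue square-integrable functions $\mathbb{R}\to\mathbb{C}^r$ with inner product $(f,g)=\int_{-\infty}^{+\infty} g^*(t)f(t)\,dt$ and norm $\|f\|_{\mathbf{L}}=\sqrt{(f,f)}$. The unsteady discrete elliptic problem is considered on the whole real line (functions on $t\ge 0$ being extended by zero, and the initial condition being ignored) as the operator equation $\mathcal{L}_h x=f$ with $\mathcal{L}_h=B\frac{d}{dt}+A$, where derivatives are taken in the sense of distributions. The Hermitian/skew-Hermitian splitting of the operator is $\mathcal{L}_h=\mathcal{H}_h+\mathcal{S}_h$ with $\mathcal{H}_h=H$ and $\mathcal{S}_h=B\frac{d}{dt}+S$. The WR-HSS method (time domain) with parameter $\alpha>0$: given $x^{(0)}$, for $k=0,1,2,\ldots$ compute (in $\mathbf{L}_2^r(\mathbb{R})$) $$(\alpha I+H)\,x^{(k+\frac12)}=\left(\alpha I-B\tfrac{d}{dt}-S\right)x^{(k)}+f,$$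 $$\left(\alpha I+B\tfrac{d}{dt}+S\right)x^{(k+1)}=(\alpha I-H)\,x^{(k+\frac12)}+f.$$ The Fourier transform is $\tilde v(\omega)=\frac{1}{\sqrt{2\pi}}\int_{-\infty}^{+\infty}e^{-\imath\omega t}v(t)\,dt$, a unitary operator on $\mathbf{L}_2^r(\mathbb{R})$. The frequency counterpart of $\mathcal{S}_h$ is $\tilde{\mathcal{S}}_h=\imath\omega B+S$ (multiplication by this matrix function of $\omega$). The frequency domain counterpart of the WR-HSS method is the iteration $$(\alpha I+H)\,\tilde x^{(k+\frac12)}=(\alpha I-\imath\omega B-S)\,\tilde x^{(k)}+\tilde f,\qquad (\alpha I+\imath\omega B+S)\,\tilde x^{(k+1)}=(\alpha I-H)\,\tilde x^{(k+\frac12)}+\tilde f,$$ satisfied by the Fourier transforms of the time-domain iterates. Norms and spaces: $|||v|||_t=\|(\alpha I+\mathcal{S}_h)v\|_{\mathbf{L}}$, and $\mathbf{V}_t$ is the completion, under $|||\cdot|||_t$, of the linear span of $\{v\in \mathbf{L}_2^r(\mathbb{R}) : |||v|||_t<+\infty\}$. Likewise $|||\tilde v|||_\omega=\|(\alpha I+\tilde{\mathcal{S}}_h)\tilde v\|_{\mathbf{L}}$, and $\mathbf{V}_\omega$ is the completion, under $|||\cdot|||_\omega$, of the linear span of $\{\tilde v\in \mathbf{L}_2^r(\mathbb{R}) : |||\tilde v|||_\omega<+\infty\}$. (The norms are $+\infty$ when the argument of $\|\cdot\|_{\mathbf{L}}$ is not square-integrable; $\alpha$ is the same positive constant as in the method.)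 *)

(* Defs.v *)
From HB Require Import structures.
From mathcomp Require Import all_boot all_order all_algebra.
From mathcomp Require Import spectral sesquilinear.
From mathcomp Require Import all_classical all_reals all_analysis.
From mathcomp Require Import complex.

Set Implicit Arguments.
Unset Strict Implicit.
Unset Printing Implicit Defensive.

Import Order.TTheory GRing.Theory Num.Theory.
Import numFieldNormedType.Exports.

Local Open Scope classical_set_scope.
Local Open Scope ring_scope.
Local Open Scope complex_scope.
Local Open Scope sesquilinear_scope.

Section Matrices.
Context {R : realType} {r : nat}.
Local Notation C := R[i].
Implicit Types (M : 'M[C]_r) (v : 'cV[C]_r).

Definition hpart M : 'M[C]_r := 2^-1 *: (M + M^t*).
Definition spart M : 'M[C]_r := 2^-1 *: (M - M^t*).

Definition hermitian_posdef M :=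
  M \is hermsymmx /\ forall v, v != 0 -> 0 < (v^t* *m M *m v) 0 0.

Definition spectrum M : set C := [set l | eigenvalue M l].

Definition vnorm v : R := Num.sqrt (complex.Re ((v^t* *m v) 0 0)).

Definition spectral_norm M : R :=
  sup [set vnorm (M *m v) | v in [set v | vnorm v = 1]].

Definition spectral_cond M : R := spectral_norm M * spectral_norm (invmx M).

(* Greatest element of E, with the junk value 0 if there is none. *)
Definition set_max (E : set R) : R := xget 0 [set m | E m /\ ubound E m].

(* normc is the modulus with values in R; on R[i], `|z| has values in R[i]. *)
Definition sigma M (a : R) : R :=
  set_max [set ComplexField.Normc.normc ((a%:C - l) / (a%:C + l))
          | l in spectrum M].

Definition worst_rate (gmin gmax a : R) : R :=
  set_max [set `|(a - l) / (a + l)| | l in `[gmin, gmax]].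

Definition argmin_pos (g : R -> R) : set R :=
  [set a | 0 < a /\ forall b, 0 < b -> g a <= g b].

End Matrices.

Section L2.
Context {R : realType} {r : nat}.
Local Notation C := R[i].
Local Notation mu := (@lebesgue_measure R).
Local Notation fn := (R -> 'cV[C]_r).
Implicit Types (u v w : fn) (D : set R).

(* Elements of the L2 space are represented by (Borel measurable) functions,
   which are not identified when they agree almost everywhere. *)
Definition L2 : set fn := [set v | forall i,
  (fun t => complex.Re (v t i 0)) \in Lfun mu 2%:E /\
  (fun t => complex.Im (v t i 0)) \in Lfun mu 2%:E].

Definition cintegral D (g : R -> C) : C :=
  (\int[mu]_(t in D) complex.Re (g t)) +i* (\int[mu]_(t in D) complex.Im (g t)).

Definition vintegral D v : 'cV[C]_r := \col_i cintegral D (fun t => v t i 0).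

Definition innerL u v : C :=
  cintegral setT (fun t => ((v t)^t* *m u t) 0 0).

Definition normL v : \bar R :=
  if `[< L2 v >] then (Num.sqrt (complex.Re (innerL v v)))%:E else +oo%E.

Definition cexpi (t : R) : C := cos t +i* sin t.

(* The Fourier integral of an L2 function is the limit in L2 of the integrals
   over [-n, n], since it need not converge absolutely. *)
Definition truncated_fourier (n : nat) v : fn := fun om =>
  ((Num.sqrt (2 * pi))^-1)%:C *:
    vintegral `[- n%:R, n%:R] (fun t => cexpi (- (om * t)) *: v t).

Definition is_fourier v w :=
  L2 w /\ normL (truncated_fourier n v - w) @[n --> \oo] --> 0%E.

Definition lin_span (P : set fn) : set fn :=
  [set v | exists (n : nat) (c : 'I_n -> C) (u : 'I_n -> fn),
    (forall i, P (u i)) /\ v = \sum_(i < n) c i *: u i].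

Definition cauchy_for (N : fn -> \bar R) (u : nat -> fn) :=
  forall e : R, 0 < e -> exists n0 : nat, forall m n : nat,
    (n0 <= m)%N -> (n0 <= n)%N -> (N (u m - u n)%R < e%:E)%E.

(* Completion, under N, of the span of the L2 functions for which N is finite.
   It is used for norms N that dominate a positive multiple of normL: a Cauchy
   sequence for N then converges in L2, and the element of the completion that
   it represents is identified with its limit in L2. *)
Definition completion (N : fn -> \bar R) : set fn :=
  [set v | L2 v /\ exists u : nat -> fn,
    [/\ forall n, lin_span [set w | L2 w /\ (N w < +oo)%E] (u n),
        cauchy_for N u &
        normL (u n - v) @[n --> \oo] --> 0%E]].

Definition test_function (phi : R -> R) :=
  (forall n t, derivable (derive1n n phi) t 1) /\
  exists K : R, forall t, K < `|t| -> phi t = 0.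

(* Vector-valued distributions, as functionals on test functions.  Real test
   functions suffice, complex ones being treated by C-linearity. *)
Definition distr := (R -> R) -> 'cV[C]_r.
Implicit Types (S T : distr).

Definition eq_distr S T := forall phi, test_function phi -> S phi = T phi.

Definition distr_of v : distr :=
  fun phi => vintegral setT (fun t => (phi t)%:C *: v t).

Definition Ddt T : distr := fun phi => - T (derive1 phi).

Definition mulD (M : 'M[C]_r) T : distr := fun phi => M *m T phi.

(* The L2 norm of the L2 function that represents T (unique up to a null set);
   it is +oo, the infimum of the empty set, if there is none. *)
Definition normD T : \bar R :=
  ereal_inf [set normL g | g in [set g | L2 g /\ eq_distr T (distr_of g)]].

End L2.

Section Method.
Context {R : realType} {r : nat}.
Local Notation C := R[i].
Local Notation mu := (@lebesgue_measure R).
Local Notation fn := (R -> 'cV[C]_r).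
Variables (B A : 'M[C]_r).
Implicit Types (v f : fn) (a : R).

Definition Lh v : distr := mulD B (Ddt (distr_of v)) + mulD A (distr_of v).

Definition Hh v : distr := mulD (hpart A) (distr_of v).

Definition Sh v : distr :=
  mulD B (Ddt (distr_of v)) + mulD (spart A) (distr_of v).

Definition alphaI a v : distr := mulD a%:C%:M (distr_of v).

Definition normt a v : \bar R := normD (alphaI a v + Sh v).

Definition Vt a : set fn := completion (normt a).

Definition Shw (om : R) : 'M[C]_r := (0 +i* om) *: B + spart A.

Definition normw a v : \bar R :=
  normL (fun om => (a%:C%:M + Shw om) *m v om).

Definition Vw a : set fn := completion (normw a).

Definition wrhss_step a f (x xh x' : fn) :=
  [/\ L2 xh, L2 x',
      eq_distr (alphaI a xh + Hh xh) (alphaI a x - Sh x + distr_of f) &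
      eq_distr (alphaI a x' + Sh x') (alphaI a xh - Hh xh + distr_of f)].

Definition wrhss_freq_step a f (x xh x' : fn) :=
  [/\ L2 xh, L2 x',
      {ae mu, forall om, (a%:C%:M + hpart A) *m xh om =
                         (a%:C%:M - Shw om) *m x om + f om} &
      {ae mu, forall om, (a%:C%:M + Shw om) *m x' om =
                         (a%:C%:M - hpart A) *m xh om + f om}].

End Method.

Definition closed_under {T : Type} (step : T -> T -> T -> Prop) (V : set T) :=
  forall x, V x ->
    (exists xh x', step x xh x') /\ forall xh x', step x xh x' -> V x'.

(* Main.v *)
Require Import Defs.
From mathcomp Require Import all_boot all_order all_algebra.
From mathcomp Require Import spectral sesquilinear.
From mathcomp Require Import all_classical all_reals all_analysis.
From mathcomp Require Import complex.
From mathcomp Require Import measurable_realfun.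
From mathcomp Require Import ring lra.
Import Order.TTheory GRing.Theory Num.Theory.
Import numFieldNormedType.Exports.
Local Open Scope classical_set_scope.
Local Open Scope ring_scope.
Local Open Scope complex_scope.

(** Applying the Fourier transform, B d/dt + S becomes multiplication by the
    skew-Hermitian matrix i om B + S, so that alpha + S_h and alpha - S_h have
    the same pointwise norm on the frequency side and alpha + S_h is boundedly
    invertible.  Vt is then the domain of the closed operator alpha + S_h with
    its graph norm, and (alpha + S_h) e_(k+1) is the image of
    (alpha - S_h) e_k under (alpha - H) (alpha + H)^-1, whose norm is sigma
    by the spectral theorem.

    The Plancherel theorem is obtained from the inner products of the transforms
    of intervals, which reduce to int (1 - cos (a w)) / w^2 dw = pi |a|, and
    from the density of step functions.  A weak derivative corresponds to
    multiplication by i om: given u' = g, let y be the function with transform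
    (u~ + g~) / (1 + i om); then k = u - y satisfies k' = - k weakly, and
    convolving with test functions turns k into bounded solutions of a linear
    differential equation, which vanish. *)

(** * Complex-valued square-integrable functions *)

(** [B] may be singular, so an element of [Vt] need not have a weak derivative: only [B v] has one,
    and every differential equation is read as a statement about the components of [B v]. Functions
    that agree almost everywhere are not identified, so the Fourier transform and the unbounded
    operators are relations ([fourier], [relt], [relw]) and no representative has to be chosen. As A
    = H + S, the solution satisfies (alpha + S_h) x_* = (alpha - H) x_* + f, which puts it in [Vt].
    Likewise the first half step is solved for (alpha + S_h) x = 2 alpha x - (alpha + H) x_(k+1/2) +
    f. Both half steps then say that a pair lies in the graph of one operator, and the same argument
    gives closedness in both domains. Step functions are the dense class because their transforms
    are explicit and because cutting them to [-n, n] stays in the class, which connects the abstract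
    transform with the limit of truncated integrals. The weak derivative is compared through 1 + i
    om since division by i om may leave L2 near om = 0, while 1 + i om has modulus at least 1; and
    the solutions of k' = - k, multiples of exp (- t), are unbounded unless zero. *)

Section L2real.
Context d (T : measurableType d) (R : realType).
Variable mu : {measure set T -> \bar R}.
Implicit Types f g : T -> R.

Lemma Lfun2P f : f \in Lfun mu 2%:E <->
  measurable_fun setT f /\ (\int[mu]_x (f x ^+ 2)%:E < +oo)%E.
Proof.
split.
  move=> /[dup] /Lfun2_integrable_sqr/integrableP[_ fi].
  rewrite inE => /andP[/[!inE]/= mf _]; split => //.
  by move: fi; under eq_integral => x _ do rewrite /= ger0_norm ?sqr_ge0//.
move=> [mf fi]; rewrite inE; apply/andP; split; rewrite inE/=; first exact: mf.
rewrite /finite_norm unlock poweR_lty//.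
by under eq_integral => x _ do rewrite /= powR_mulrn// -normrX ger0_norm ?sqr_ge0//.
Qed.

Lemma ge0_integral_le_cvg (u : nat -> T -> \bar R) (f : T -> \bar R) (e : \bar R) :
  (forall n, measurable_fun setT (u n)) -> (forall n x, 0 <= u n x)%E ->
  (forall x, u n x @[n --> \oo] --> f x) ->
  (forall n, \int[mu]_x u n x <= e)%E -> (\int[mu]_x f x <= e)%E.
Proof.
move=> mu_ u0 uf ue.
have -> : (\int[mu]_x f x = \int[mu]_x limn_einf (u^~ x))%E.
  by apply: eq_integral => x _; rewrite (cvg_limn_einf_sup (uf x)).
apply: (le_trans (fatou _ _ _ _)) => //.
rewrite limn_einf_lim; apply: lime_le; first exact: is_cvg_einfs.
near=> n; apply: (le_trans _ (ue n)).
by apply: ereal_inf_lbound; exists n => //=.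
Unshelve. all: by end_near. Qed.

(** Riesz-Fischer: a subsequence with summable weighted increments converges almost everywhere, and
    Fatou's lemma turns the Cauchy condition into convergence of the full sequence to the pointwise
    limit. *)
Lemma Lfun2_complete (u : nat -> T -> R) :
  (forall n, u n \in Lfun mu 2%:E) ->
  (forall e : R, 0 < e -> exists N, forall m n, (N <= m)%N -> (N <= n)%N ->
    (\int[mu]_x ((u m x - u n x) ^+ 2)%:E <= e%:E)%E) ->
  exists2 w, w \in Lfun mu 2%:E & forall e : R, 0 < e ->
    exists N, forall n, (N <= n)%N -> (\int[mu]_x ((u n x - w x) ^+ 2)%:E <= e%:E)%E.
Proof.
move=> Lu cu.
have mu_ n : measurable_fun setT (u n) by have [] := (Lfun2P (u n)).1 (Lu n).
(* The increments have squared norm at most 8^-k. Weighted by 4^k they still sum to at most the sum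
   of 2^-k, and a finite weighted sum at a point bounds each increment there by a multiple of
   2^-k. *)
have /choice[N0 HN0] (k : nat) := cu (8 ^- k) ltac:(by rewrite invr_gt0 exprn_gt0).
(* The sum puts [phi k] above [N0 k]; the extra summand [k] gives [N <= phi (k + N)], used in the
   final Fatou argument. *)
pose phi k := (k + \sum_(j < k.+1) N0 j)%N.
have phiS k : (phi k <= phi k.+1)%N by rewrite /phi leq_add// [leqRHS]big_ord_recr/= leq_addr.
have N0phi k : (N0 k <= phi k)%N by rewrite /phi big_ord_recr/= addnA leq_addl.
have N0phi' k j : (k <= j)%N -> (N0 k <= phi j)%N.
  elim: j => [|j IH]; first by rewrite leqn0 => /eqP ->; exact: N0phi.
  rewrite leq_eqVlt => /predU1P[->|/IH]; first exact: N0phi.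
  by move=> /leq_trans; exact.
pose dlt k x := u (phi k.+1) x - u (phi k) x.
have mdlt k : measurable_fun setT (dlt k) by exact: measurable_funB.
have mdlt2 k : measurable_fun setT (fun x => (4 ^+ k * dlt k x ^+ 2)%:E).
  by apply/measurable_EFinP; apply: measurable_funM => //; exact: measurable_funX.
have dlt0 k x : (0 <= (4 ^+ k * dlt k x ^+ 2)%:E)%E.
  by rewrite lee_fin mulr_ge0 ?sqr_ge0// exprn_ge0.
pose S x := (\sum_(0 <= k <oo) (4 ^+ k * dlt k x ^+ 2)%:E)%E.
have mS : measurable_fun setT S by apply: ge0_emeasurable_sum => //.
have iS : (\int[mu]_x S x < +oo)%E.
  rewrite integral_nneseries//.
  apply: (@le_lt_trans _ _ (\sum_(0 <= k <oo) (2^-1 ^+ k)%:E)%E).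
    apply: lee_nneseries => k; first by move=> _ _; exact: integral_ge0.
    move=> _; under eq_integral do rewrite EFinM.
    rewrite ge0_integralZl//; last 2 first.
      by apply/measurable_EFinP; exact: measurable_funX.
      by move=> x _; rewrite lee_fin sqr_ge0.
    apply: (@le_trans _ _ ((4 ^+ k)%:E * (8 ^- k)%:E)%E).
      rewrite lee_pmul// ?lee_fin ?exprn_ge0 ?integral_ge0//.
        by move=> x _; rewrite lee_fin sqr_ge0.
      by apply: HN0; [exact/(leq_trans (N0phi k))|exact: N0phi].
    rewrite -EFinM lee_fin -exprVn -exprMn.
    by rewrite (_ : 4 * 8^-1 = 2^-1)//; field.
  have := @is_cvg_geometric_series R 1 2^-1.
  rewrite ger0_norm ?invr_ge0// => /(_ ltac:(lra)) /cvg_ex[l cl].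
  have -> : (\sum_(0 <= k <oo) ((2:R)^-1 ^+ k)%:E)%E = l%:E.
    apply/cvg_lim => //.
    rewrite (_ : (fun n => _) = EFin \o series (geometric 1 2^-1)); last first.
      by apply/funext => n; rewrite /= /series/= sumEFin; congr EFin; apply: eq_bigr => i _; rewrite mul1r.
    by apply: cvg_EFin => //; exact: nearW.
  exact: ltry.
pose A := [set x | S x < +oo]%E.
have mA : measurable A by rewrite /A -[X in measurable X]setTI; exact: emeasurable_fun_infty_o.
have aeA : {ae mu, forall x, A x}.
  have S0 x : (0 <= S x)%E by exact: nneseries_ge0.
  have : mu.-integrable setT S.
    apply/integrableP; split => //.
    by under eq_integral => x _ do rewrite gee0_abs//.
  move/(integrable_ae measurableT); apply: filterS => x /(_ I).
  by rewrite ge0_fin_numE.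
(* The indicator makes the sequence converge at every point, with limit 0 off [A], so that the limit
   is measurable. *)
pose v k x := u (phi k) x * \1_A x.
have mv k : measurable_fun setT (v k) by exact: measurable_funM.
have cv x : cvgn (v^~ x).
  have [Ax|nAx] := pselect (A x); last first.
    apply/cvg_ex; exists 0; under eq_fun do rewrite /v indicE memNset// mulr0.
    exact: cvg_cst.
  rewrite (_ : v^~ x = (fun k => u (phi k) x)); last first.
    by apply/funext => k; rewrite /v indicE mem_set// mulr1.
  have [M M0 HM] : exists2 M : R, 0 <= M & forall k, 4 ^+ k * dlt k x ^+ 2 <= M.
    have S0 : (0 <= S x)%E by exact: nneseries_ge0.
    exists (fine (S x)); first exact: fine_ge0.
    move=> k; rewrite -lee_fin fineK ?ge0_fin_numE//.
    rewrite /S (nneseries_split _ k.+1)//= big_nat_recr//= -addeA addeCA.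
    rewrite leeDl// adde_ge0//; first by rewrite sume_ge0//.
    exact: nneseries_ge0.
  have Hd k : `|dlt k x| <= Num.sqrt M * 2^-1 ^+ k.
    rewrite -(ler_pXn2r (ltn0Sn 1)) ?nnegrE ?mulr_ge0 ?sqrtr_ge0 ?exprn_ge0//.
    rewrite real_normK ?num_real// exprMn sqr_sqrtr// -exprM mulnC exprM exprVn.
    rewrite exprVn ler_pdivlMr ?exprn_gt0// -natrX [leLHS]mulrC; exact: HM.
  have cs : cvgn (series (telescope (fun k => u (phi k) x))).
    apply: normed_cvg; apply: (@series_le_cvg _ _ (geometric (Num.sqrt M) 2^-1)) => //.
    - by move=> k; exact: normr_ge0.
    - by move=> k; rewrite /geometric/= mulr_ge0 ?sqrtr_ge0 ?exprn_ge0.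
    - by apply: is_cvg_geometric_series; rewrite ger0_norm ?invr_ge0//; lra.
  rewrite (_ : (fun k => _) = (fun k => u (phi 0%N) x + series (telescope (fun k => u (phi k) x)) k)).
    by apply: is_cvgD => //; exact: is_cvg_cst.
  by apply/funext => k; rewrite -(eq_sum_telescope (fun k => u (phi k) x)).
pose w x := limn (v^~ x).
have mw : measurable_fun setT w.
  by apply: (measurable_fun_cvg mv) => x _; exact: cv.
have Hw e : 0 < e -> exists N, forall n, (N <= n)%N ->
    (\int[mu]_x ((u n x - w x) ^+ 2)%:E <= e%:E)%E.
  move=> e0; have [N HN] := cu e e0; exists N => n Nn.
  apply: (@ge0_integral_le_cvg (fun k x => ((u n x - v (k + N)%N x) ^+ 2)%:E)).
  - move=> k; apply/measurable_EFinP; apply: measurable_funX.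
    by apply: measurable_funB; [exact: mu_|exact: mv].
  - by move=> k x; rewrite lee_fin sqr_ge0.
  - move=> x; apply: cvg_EFin; first exact: nearW.
    have cvk : u n x - v (k + N)%N x @[k --> \oo] --> u n x - w x.
      apply: cvgB; first exact: cvg_cst.
      have cl : (v^~ x) k @[k --> \oo] --> w x by exact: cv.
      by move: cl; rewrite -(cvg_shiftn N).
    exact: (cvgM cvk cvk).
  - move=> k; apply: le_trans (HN n (phi (k + N)%N) Nn _); last first.
      by rewrite /phi -addnA addnCA leq_addr.
    rewrite le_eqVlt; apply/orP; left; apply/eqP; apply: ae_eq_integral => //.
    + apply/measurable_EFinP; apply: measurable_funX.
      by apply: measurable_funB; [exact: mu_|exact: mv].
    + by apply/measurable_EFinP; apply: measurable_funX; exact: measurable_funB.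
    + by apply: filterS aeA => x Ax _; rewrite /v indicE mem_set// mulr1.
have [N HN] := Hw 1 ltr01.
exists w => //.
have L1 : (u N \- w) \in Lfun mu 2%:E.
  apply/Lfun2P; split; first exact: measurable_funB.
  by apply: (le_lt_trans (HN N (leqnn N))); exact: ltry.
rewrite (_ : w = (-1) *: (u N \- w) + u N).
  by apply: (Lfun_submod_closed mu (lee1n 2)).2 => //; exact: Lu.
by apply/funext => x; rewrite scaleN1r !fctE/= opprB subrK.
Qed.

End L2real.

(** * Real and imaginary parts, squared modulus *)

Section ComplexParts.
Context {R : realType}.
Local Notation C := R[i].
Implicit Types x y : C.
Local Notation Re := (@complex.Re R).
Local Notation Im := (@complex.Im R).

Lemma cReD x y : Re (x + y) = Re x + Re y. Proof. by case: x; case: y. Qed.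
Lemma cImD x y : Im (x + y) = Im x + Im y. Proof. by case: x; case: y. Qed.
Lemma cReN x : Re (- x) = - Re x. Proof. by case: x. Qed.
Lemma cImN x : Im (- x) = - Im x. Proof. by case: x. Qed.
Lemma cReM x y : Re (x * y) = Re x * Re y - Im x * Im y.
Proof. by case: x; case: y. Qed.
Lemma cImM x y : Im (x * y) = Re x * Im y + Im x * Re y.
Proof. by case: x; case: y. Qed.
Lemma cReJ x : Re (x^*)%C = Re x. Proof. by case: x. Qed.
Lemma cImJ x : Im (x^*)%C = - Im x. Proof. by case: x. Qed.
Lemma cReC (a : R) : Re a%:C = a. Proof. by []. Qed.
Lemma cImC (a : R) : Im a%:C = 0. Proof. by []. Qed.
Lemma cRei : Re 'i = 0 :> R. Proof. by []. Qed.
Lemma cImi : Im 'i = 1 :> R. Proof. by []. Qed.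
Definition cpartE := (cRei, cImi, cReD, cImD, cReN, cImN, cReM, cImM, cReJ, cImJ,
  cReC, cImC).

Lemma ceqP x y : Re x = Re y -> Im x = Im y -> x = y.
Proof. by case: x => a b; case: y => c d /= -> ->. Qed.

(** The squared modulus with values in [R], hence an integrand; being polynomial in the two parts it
    is handled by [ring]. *)
Definition nsq x : R := Re x ^+ 2 + Im x ^+ 2.

Lemma nsq_ge0 x : 0 <= nsq x. Proof. by rewrite addr_ge0 ?sqr_ge0. Qed.
Lemma nsqM x y : nsq (x * y) = nsq x * nsq y.
Proof. by rewrite /nsq !cpartE; ring. Qed.
Lemma nsqN x : nsq (- x) = nsq x. Proof. by rewrite /nsq !cpartE !sqrrN. Qed.
Lemma nsqJ x : nsq (x^*)%C = nsq x. Proof. by rewrite /nsq !cpartE !sqrrN. Qed.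
Lemma nsqC (a : R) : nsq a%:C = a ^+ 2. Proof. by rewrite /nsq/= expr0n addr0. Qed.
Lemma nsq0 : nsq 0 = 0. Proof. by rewrite nsqC expr0n. Qed.
Lemma nsqD x y : nsq (x + y) <= 2 * nsq x + 2 * nsq y.
Proof.
rewrite -subr_ge0.
have -> : 2 * nsq x + 2 * nsq y - nsq (x + y) = nsq (x - y).
  by rewrite /nsq !cpartE; ring.
exact: nsq_ge0.
Qed.
Lemma nsq_eq0 x : nsq x = 0 -> x = 0.
Proof.
move/eqP; rewrite paddr_eq0 ?sqr_ge0// !sqrf_eq0 => /andP[/eqP ? /eqP ?].
exact: ceqP.
Qed.
Lemma mulJ_nsq x : x * (x^*)%C = (nsq x)%:C.
Proof. by apply: ceqP; rewrite ?cpartE /nsq; ring. Qed.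

End ComplexParts.

(** * Measurability and square-integrability of complex functions *)

Section ComplexL2.
Context {R : realType}.
Local Notation C := R[i].
Local Notation mu := (@lebesgue_measure R).
Local Notation Re := (@complex.Re R).
Local Notation Im := (@complex.Im R).
Implicit Types (f g h : R -> C).

Definition cmeas f :=
  measurable_fun setT (Re \o f) /\ measurable_fun setT (Im \o f).

Definition cL2 f := (Re \o f) \in Lfun mu 2%:E /\ (Im \o f) \in Lfun mu 2%:E.

Lemma cmeas_cst c : cmeas (cst c).
Proof. by split; exact: measurable_cst. Qed.
Lemma cmeas_real (f : R -> R) : measurable_fun setT f -> cmeas (fun t => (f t)%:C).
Proof. by split => //; exact: measurable_cst. Qed.
Lemma cmeasD f g : cmeas f -> cmeas g -> cmeas (fun t => f t + g t).
Proof.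
move=> [f1 f2] [g1 g2]; split.
  by under [X in measurable_fun _ X]eq_fun do rewrite /= cReD; exact: measurable_funD.
by under [X in measurable_fun _ X]eq_fun do rewrite /= cImD; exact: measurable_funD.
Qed.
Lemma cmeasM f g : cmeas f -> cmeas g -> cmeas (fun t => f t * g t).
Proof.
move=> [f1 f2] [g1 g2]; split.
  under [X in measurable_fun _ X]eq_fun do rewrite /= cReM.
  by apply: measurable_funB; exact: measurable_funM.
under [X in measurable_fun _ X]eq_fun do rewrite /= cImM.
by apply: measurable_funD; exact: measurable_funM.
Qed.
Lemma cmeasN f : cmeas f -> cmeas (fun t => - f t).
Proof.
move=> mf; have := cmeasM _ _ (cmeas_cst (-1)) mf.
by under eq_fun do rewrite mulN1r.
Qed.
Lemma cmeasB f g : cmeas f -> cmeas g -> cmeas (fun t => f t - g t).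
Proof. by move=> mf mg; apply: cmeasD => //; exact: cmeasN. Qed.
Lemma cmeasJ f : cmeas f -> cmeas (fun t => (f t)^*%C).
Proof.
move=> [f1 f2]; split.
  by under [X in measurable_fun _ X]eq_fun do rewrite /= cReJ.
by under [X in measurable_fun _ X]eq_fun do rewrite /= cImJ; exact: measurable_funN.
Qed.
Lemma measurable_nsq f : cmeas f -> measurable_fun setT (fun t => nsq (f t)).
Proof. by move=> [f1 f2]; apply: measurable_funD; exact: measurable_funX. Qed.
Lemma cmeas_sum I (s : seq I) (P : pred I) (F : I -> R -> C) :
  (forall i, cmeas (F i)) -> cmeas (fun t => \sum_(i <- s | P i) F i t).
Proof.
move=> mF; elim: s => [|i s IH].
  by under eq_fun do rewrite big_nil; exact: cmeas_cst.
under eq_fun do rewrite big_cons; case: (P i) => //; exact: cmeasD.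
Qed.
Lemma cmeas_prod I (s : seq I) (P : pred I) (F : I -> R -> C) :
  (forall i, cmeas (F i)) -> cmeas (fun t => \prod_(i <- s | P i) F i t).
Proof.
move=> mF; elim: s => [|i s IH].
  by under eq_fun do rewrite big_nil; exact: cmeas_cst.
under eq_fun do rewrite big_cons; case: (P i) => //; exact: cmeasM.
Qed.
(** Inversion is continuous only off [0], so the singleton of [0] is split off. *)
Lemma measurable_invr : measurable_fun [set: R] (fun x : R => x^-1).
Proof.
have m0 : measurable [set (0:R)] by [].
rewrite -(setvU [set (0:R)]) measurable_funU//; last exact: measurableC.
split; last by apply/measurable_fun_set1.
apply: open_continuous_measurable_fun; first by rewrite openC; exact: closed_eq.
by move=> x; rewrite inE => /eqP x0; exact: inv_continuous.
Qed.

Lemma cmeasV f : cmeas f -> cmeas (fun t => (f t)^-1).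
Proof.
(* The quotient of the conjugate by the squared modulus; at a zero of [f] both sides are 0 because
   the inverse of 0 is 0. *)
move=> mf; rewrite (_ : (fun t => _) = (fun t => ((nsq (f t))^-1)%:C * (f t)^*%C)).
  apply: cmeasM; last exact: cmeasJ.
  apply: cmeas_real; apply: (measurableT_comp measurable_invr); exact: measurable_nsq.
apply/funext => t; case: (eqVneq (f t) 0) => [->|f0].
  by rewrite invr0 conjc0 mulr0.
apply: (mulIf f0); rewrite mulVf// -mulrA [_ * f t]mulrC mulJ_nsq -rmorphM/= mulVf//.
by apply: contra_neq f0; exact: nsq_eq0.
Qed.

Lemma cL2P f : cL2 f <-> cmeas f /\ (\int[mu]_t (nsq (f t))%:E < +oo)%E.
Proof.
have E : cmeas f -> (\int[mu]_t (nsq (f t))%:E =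
    \int[mu]_t ((Re \o f) t ^+ 2)%:E + \int[mu]_t ((Im \o f) t ^+ 2)%:E)%E.
  move=> [f1 f2]; rewrite -ge0_integralD//.
  - by move=> x _; rewrite lee_fin sqr_ge0.
  - by apply/measurable_EFinP; exact: measurable_funX.
  - by move=> x _; rewrite lee_fin sqr_ge0.
  - by apply/measurable_EFinP; exact: measurable_funX.
split=> [[/Lfun2P[f1 i1] /Lfun2P[f2 i2]]|[mf]].
  by split; [|rewrite E// lte_add_pinfty].
have := mf => -[f1 f2]; rewrite E//.
have H (h : R -> R) : (0 <= \int[mu]_t (h t ^+ 2)%:E)%E.
  by apply: integral_ge0 => x _; rewrite lee_fin sqr_ge0.
move=> fin; split; apply/Lfun2P; split => //; apply: le_lt_trans fin.
  by rewrite leeDl.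
by rewrite leeDr.
Qed.

Lemma cL2_meas f : cL2 f -> cmeas f. Proof. by move/cL2P => []. Qed.

Lemma cL2_dom f (g : R -> C) (K : R) : cL2 g -> cmeas f ->
  (forall t, nsq (f t) <= K * nsq (g t)) -> cL2 f.
Proof.
move=> /cL2P[mg ig] mf fg; apply/cL2P; split => //.
apply: (@le_lt_trans _ _ (\int[mu]_t (`|K|%:E * (nsq (g t))%:E)))%E.
  apply: ge0_le_integral => //.
  - by move=> t _; rewrite lee_fin nsq_ge0.
  - by apply/measurable_EFinP; exact: measurable_nsq.
  - by apply/measurable_EFinP/measurable_funM => //; exact: measurable_nsq.
  - move=> t _; rewrite lee_fin (le_trans (fg t))// ler_wpM2r ?nsq_ge0// ler_norm//.
rewrite ge0_integralZl//; last 2 first.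
  by apply/measurable_EFinP; exact: measurable_nsq.
  by move=> t _; rewrite lee_fin nsq_ge0.
by rewrite lte_mul_pinfty// integral_ge0// => t _; rewrite lee_fin nsq_ge0.
Qed.

Lemma cL2D f g : cL2 f -> cL2 g -> cL2 (fun t => f t + g t).
Proof.
move=> Lf Lg; apply/cL2P; split; first by apply: cmeasD; exact: cL2_meas.
move: Lf Lg => /cL2P[mf fi] /cL2P[mg gi].
apply: (@le_lt_trans _ _ (\int[mu]_t (2%:E * (nsq (f t))%:E + 2%:E * (nsq (g t))%:E)))%E.
  apply: ge0_le_integral => //.
  - by move=> t _; rewrite lee_fin nsq_ge0.
  - by apply/measurable_EFinP; apply: measurable_nsq; exact: cmeasD.
  - apply/measurable_EFinP/measurable_funD; apply: measurable_funM => //; exact: measurable_nsq.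
  - by move=> t _; rewrite lee_fin nsqD.
have mn k : cmeas k -> measurable_fun setT (fun t => (nsq (k t))%:E).
  by move=> mk; apply/measurable_EFinP; exact: measurable_nsq.
have n0 k (t : R) : (0 <= (nsq (k t : C))%:E)%E by rewrite lee_fin nsq_ge0.
rewrite ge0_integralD//; last 4 first.
- by move=> t _; rewrite mule_ge0.
- by apply: emeasurable_funM => //; exact: mn.
- by move=> t _; rewrite mule_ge0.
- by apply: emeasurable_funM => //; exact: mn.
rewrite !ge0_integralZl//; do ?exact: mn.
by rewrite lte_add_pinfty// lte_mul_pinfty// integral_ge0.
Qed.

Lemma cL2Z (c : C) f : cL2 f -> cL2 (fun t => c * f t).
Proof.
move=> Lf; apply: (cL2_dom _ f (nsq c)) => //.
  by apply: cmeasM; [exact: cmeas_cst|exact: cL2_meas].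
by move=> t; rewrite nsqM.
Qed.
Lemma cL2N f : cL2 f -> cL2 (fun t => - f t).
Proof. by move/(cL2Z (-1)); under eq_fun do rewrite mulN1r. Qed.
Lemma cL2B f g : cL2 f -> cL2 g -> cL2 (fun t => f t - g t).
Proof. by move=> ? ?; apply: cL2D => //; exact: cL2N. Qed.
Lemma cL2J f : cL2 f -> cL2 (fun t => (f t)^*%C).
Proof.
move=> Lf; apply: (cL2_dom _ f 1) => //; first by apply: cmeasJ; exact: cL2_meas.
by move=> t; rewrite mul1r nsqJ.
Qed.
Lemma cL2_0 : cL2 (fun=> 0).
Proof.
apply/cL2P; split; first exact: cmeas_cst.
by under eq_integral do rewrite nsq0; rewrite integral0.
Qed.
Lemma cL2_sum I (s : seq I) (P : pred I) (F : I -> R -> C) :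
  (forall i, cL2 (F i)) -> cL2 (fun t => \sum_(i <- s | P i) F i t).
Proof.
move=> mF; elim: s => [|i s IH].
  by under eq_fun do rewrite big_nil; exact: cL2_0.
under eq_fun do rewrite big_cons; case: (P i) => //; exact: cL2D.
Qed.

End ComplexL2.

Section AlmostEverywhere.
Context d (T : measurableType d) (R : realType).
Variable mu : {measure set T -> \bar R}.
Implicit Types P Q : T -> Prop.

Lemma ae_sub P Q : (forall x, P x -> Q x) ->
  {ae mu, forall x, P x} -> {ae mu, forall x, Q x}.
Proof. by move=> PQ; apply: filterS. Qed.

Lemma ae_sub2 P P' Q : (forall x, P x -> P' x -> Q x) ->
  {ae mu, forall x, P x} -> {ae mu, forall x, P' x} -> {ae mu, forall x, Q x}.
Proof. by move=> PQ; apply: filterS2. Qed.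

Lemma ae_forall (I : finType) (P : I -> T -> Prop) :
  (forall i, {ae mu, forall x, P i x}) -> {ae mu, forall x, forall i, P i x}.
Proof. by move=> aeP; apply: filter_forall. Qed.

End AlmostEverywhere.

(** * The Hilbert space of complex L2 functions *)

Section ComplexHilbert.
Context {R : realType}.
Local Notation C := R[i].
Local Notation mu := (@lebesgue_measure R).
Local Notation Re := (@complex.Re R).
Local Notation Im := (@complex.Im R).
Implicit Types (f g h : R -> C).

Lemma cL2_Re f : cL2 f -> (fun t => Re (f t)) \in Lfun mu 2%:E.
Proof. by case. Qed.
Lemma cL2_Im f : cL2 f -> (fun t => Im (f t)) \in Lfun mu 2%:E.
Proof. by case. Qed.

Lemma Lfun2_integrableM (u v : R -> R) : u \in Lfun mu 2%:E -> v \in Lfun mu 2%:E ->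
  mu.-integrable setT (fun t => (u t * v t)%:E).
Proof. by move=> Lu Lv; have /Lfun1_integrable := Lfun2_mul_Lfun1 Lu Lv. Qed.

(** The real part of the inner product suffices for Cauchy-Schwarz and for limits; the imaginary
    part is recovered later by pairing with ['i] times the second function. *)
Definition rip f g : R := \int[mu]_t (Re (f t) * Re (g t) + Im (f t) * Im (g t)).
Definition n2 f : R := \int[mu]_t nsq (f t).

Lemma rip_integrable f g : cL2 f -> cL2 g ->
  mu.-integrable setT (fun t => (Re (f t) * Re (g t) + Im (f t) * Im (g t))%:E).
Proof.
move=> [f1 f2] [g1 g2].
under eq_fun do rewrite EFinD; apply: integrableD => //; exact: Lfun2_integrableM.
Qed.

Lemma rippE f : rip f f = n2 f.
Proof. by apply: eq_Rintegral => t _; rewrite /nsq !expr2. Qed.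

Lemma nsq_integrable f : cL2 f -> mu.-integrable setT (fun t => (nsq (f t))%:E).
Proof.
by move=> Lf; have := rip_integrable _ _ Lf Lf; under eq_fun do rewrite -!expr2.
Qed.

Lemma n2_EFin f : cL2 f -> (n2 f)%:E = (\int[mu]_t (nsq (f t))%:E)%E.
Proof.
move=> Lf; rewrite /n2 /Rintegral fineK//.
by apply: integrable_fin_num => //; exact: nsq_integrable.
Qed.

Lemma n2_ge0 f : 0 <= n2 f.
Proof. by apply: Rintegral_ge0 => t _; exact: nsq_ge0. Qed.

Lemma ripC f g : rip f g = rip g f.
Proof. by apply: eq_Rintegral => t _; rewrite mulrC [X in _ + X]mulrC. Qed.

Lemma ripDl f g h : cL2 f -> cL2 g -> cL2 h ->
  rip (fun t => f t + g t) h = rip f h + rip g h.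
Proof.
move=> Lf Lg Lh; rewrite -RintegralD//; do ?exact: rip_integrable.
by apply: eq_Rintegral => t _; rewrite !cpartE; ring.
Qed.

Lemma ripZl (a : R) f h : cL2 f -> cL2 h ->
  rip (fun t => a%:C * f t) h = a * rip f h.
Proof.
move=> Lf Lh; rewrite -RintegralZl//; do ?exact: rip_integrable.
by apply: eq_Rintegral => t _; rewrite !cpartE; ring.
Qed.

Lemma ripNl f h : cL2 f -> cL2 h -> rip (fun t => - f t) h = - rip f h.
Proof.
move=> Lf Lh; rewrite -[RHS]mulN1r -ripZl//.
by apply: eq_Rintegral => t _; rewrite !cpartE; ring.
Qed.

Lemma ripBl f g h : cL2 f -> cL2 g -> cL2 h ->
  rip (fun t => f t - g t) h = rip f h - rip g h.
Proof.
by move=> Lf Lg Lh; rewrite ripDl//; [rewrite ripNl|exact: cL2N].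
Qed.

Lemma n2D f g : cL2 f -> cL2 g ->
  n2 (fun t => f t + g t) = n2 f + 2 * rip f g + n2 g.
Proof.
move=> Lf Lg; have LD := cL2D _ _ Lf Lg.
rewrite -!rippE ripDl// [rip f _]ripC [rip g _]ripC !ripDl// (ripC g f); ring.
Qed.

Lemma n2B f g : cL2 f -> cL2 g ->
  n2 (fun t => f t - g t) = n2 f - 2 * rip f g + n2 g.
Proof.
move=> Lf Lg; have LN := cL2N _ Lg.
rewrite n2D// ripC ripNl// ripC mulrN; congr (_ + _).
by apply: eq_Rintegral => t _; rewrite nsqN.
Qed.

Lemma n2Z (c : C) f : cL2 f -> n2 (fun t => c * f t) = nsq c * n2 f.
Proof.
move=> Lf; rewrite -RintegralZl//; last exact: nsq_integrable.
by apply: eq_Rintegral => t _; rewrite nsqM.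
Qed.

Lemma rip_CS f g : cL2 f -> cL2 g -> rip f g ^+ 2 <= n2 f * n2 g.
Proof.
move=> Lf Lg.
have H (s : R) : 0 <= n2 f + 2 * s * rip f g + s ^+ 2 * n2 g.
  have Ls : cL2 (fun t => s%:C * g t) by exact: cL2Z.
  have := n2_ge0 (fun t => f t + s%:C * g t).
  by rewrite n2D// n2Z// nsqC ripC ripZl// (ripC g) mulrA.
have [g0|g0] := eqVneq (n2 g) 0.
  have [->|r0] := eqVneq (rip f g) 0; first by rewrite g0 mulr0 expr0n.
  (* Here the expression in [s] is affine with nonzero slope; this [s] gives it the value -1. *)
  have := H (- (n2 f + 1) / (2 * rip f g)); rewrite g0 mulr0 addr0.
  rewrite (_ : 2 * _ * _ = - (n2 f + 1)); last by field.
  by rewrite opprD addrA subrr sub0r oppr_ge0 ler10.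
have gp : 0 < n2 g by rewrite lt_def g0 n2_ge0.
(* The minimiser of the quadratic polynomial in [s]. *)
have := H (- rip f g / n2 g).
rewrite (_ : _ + _ + _ = (n2 f * n2 g - rip f g ^+ 2) / n2 g); last by field.
by rewrite pmulr_lge0 ?invr_gt0// subr_ge0.
Qed.

Lemma rip_le f g : cL2 f -> cL2 g -> `|rip f g| <= Num.sqrt (n2 f) * Num.sqrt (n2 g).
Proof.
move=> Lf Lg; rewrite -sqrtrM ?n2_ge0// -sqrtr_sqr ler_wsqrtr//.
exact: rip_CS.
Qed.

Lemma n2D_le2 f g : cL2 f -> cL2 g ->
  n2 (fun t => f t + g t) <= 2 * n2 f + 2 * n2 g.
Proof.
move=> Lf Lg; have := n2_ge0 (fun t => f t - g t); rewrite n2B// n2D//; lra.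
Qed.

Lemma n2_eq0 f : cL2 f -> n2 f = 0 -> {ae mu, forall t, f t = 0}.
Proof.
move=> Lf f0.
have mn : measurable_fun setT (fun t => (nsq (f t))%:E).
  by apply/measurable_EFinP; apply: measurable_nsq; exact: cL2_meas.
have := (ae_eq_integral_abs mu measurableT mn).1.
under eq_integral do rewrite /= ger0_norm ?nsq_ge0//.
rewrite -n2_EFin// f0 => /(_ erefl).
by apply: ae_sub => t /(_ I)[] /nsq_eq0.
Qed.

Lemma eq_n2 f g : cL2 f -> cL2 g -> {ae mu, forall t, f t = g t} -> n2 f = n2 g.
Proof.
move=> Lf Lg fg; rewrite /n2 /Rintegral; congr fine; apply: ae_eq_integral => //.
- by apply/measurable_EFinP; apply: measurable_nsq; exact: cL2_meas.
- by apply/measurable_EFinP; apply: measurable_nsq; exact: cL2_meas.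
- by apply: ae_sub fg => t -> _.
Qed.

Definition cvgL2 (u : nat -> R -> C) f :=
  n2 (fun t => u n t - f t) @[n --> \oo] --> (0 : R).

Lemma rip_cvg (u v : nat -> R -> C) f g :
  (forall n, cL2 (u n)) -> (forall n, cL2 (v n)) -> cL2 f -> cL2 g ->
  cvgL2 u f -> cvgL2 v g -> rip (u n) (v n) @[n --> \oo] --> rip f g.
Proof.
move=> Lu Lv Lf Lg uf vg; apply/subr_cvg0.
pose a n := Num.sqrt (n2 (fun t => u n t - f t)).
pose b n := Num.sqrt (n2 (fun t => v n t - g t)).
have a0 : a n @[n --> \oo] --> (0 : R).
  by rewrite -(@sqrtr0 R); apply: continuous_cvg => //; exact: sqrt_continuous.
have b0 : b n @[n --> \oo] --> (0 : R).
  by rewrite -(@sqrtr0 R); apply: continuous_cvg => //; exact: sqrt_continuous.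
have L1 n : cL2 (fun t => u n t - f t) by exact: cL2B.
have L2 n : cL2 (fun t => v n t - g t) by exact: cL2B.
have E n : `|rip (u n) (v n) - rip f g| <=
    a n * b n + a n * Num.sqrt (n2 g) + b n * Num.sqrt (n2 f).
  have -> : rip (u n) (v n) - rip f g = rip (fun t => u n t - f t) (fun t => v n t - g t)
     + rip (fun t => u n t - f t) g + rip (fun t => v n t - g t) f.
    rewrite [X in X + _ + _]ripC !ripBl// (ripC (v n)) (ripC g) (ripC (v n)) (ripC g) !ripBl//.
    ring.
  apply: (le_trans (ler_normD _ _)); rewrite lerD//; last exact: rip_le.
  by apply: (le_trans (ler_normD _ _)); rewrite lerD//; exact: rip_le.
apply: norm_cvg0.
have c0 : (a n * b n + a n * Num.sqrt (n2 g) + b n * Num.sqrt (n2 f)) @[n --> \oo] --> (0 : R).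
  rewrite (_ : 0 = 0 * 0 + 0 * Num.sqrt (n2 g) + 0 * Num.sqrt (n2 f)); last by rewrite !mul0r !addr0.
  by apply: cvgD; [apply: cvgD|]; apply: cvgM => //; exact: cvg_cst.
apply: squeeze_cvgr (cvg_cst 0) c0.
by near=> n; rewrite normr_ge0 E.
Unshelve. all: by end_near. Qed.

Lemma n2_cvg (u : nat -> R -> C) f :
  (forall n, cL2 (u n)) -> cL2 f -> cvgL2 u f -> n2 (u n) @[n --> \oo] --> n2 f.
Proof.
move=> Lu Lf uf; rewrite -rippE; under eq_fun do rewrite -rippE.
exact: rip_cvg.
Qed.

Lemma cL2_complete (u : nat -> R -> C) : (forall n, cL2 (u n)) ->
  (forall e : R, 0 < e -> exists N, forall m n, (N <= m)%N -> (N <= n)%N ->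
    n2 (fun t => u m t - u n t) <= e) ->
  exists2 w, cL2 w & cvgL2 u w.
Proof.
move=> Lu cu.
have nE f : cL2 f -> n2 f = \int[mu]_t (Re (f t) ^+ 2) + \int[mu]_t (Im (f t) ^+ 2).
  move=> [f1 f2]; rewrite -RintegralD//.
    exact: (Lfun2_integrable_sqr f1).
  exact: (Lfun2_integrable_sqr f2).
have IE (f : R -> R) : f \in Lfun mu 2%:E -> ((\int[mu]_t (f t ^+ 2))%R%:E = \int[mu]_t (f t ^+ 2)%:E)%E.
  move=> Lf; rewrite /Rintegral fineK//; apply: integrable_fin_num => //.
  exact: (Lfun2_integrable_sqr Lf).
have I0 (f : R -> R) : 0 <= \int[mu]_t (f t ^+ 2) by apply: Rintegral_ge0 => t _; exact: sqr_ge0.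
have [w1 Lw1 w1P] : exists2 w, w \in Lfun mu 2%:E & forall e : R, 0 < e ->
    exists N, forall n, (N <= n)%N -> (\int[mu]_x ((Re (u n x) - w x) ^+ 2)%:E <= e%:E)%E.
  apply: Lfun2_complete => [n|e e0]; first exact: cL2_Re.
  have [N HN] := cu e e0; exists N => m n Nm Nn.
  have Lmn : cL2 (fun t => u m t - u n t) by exact: cL2B.
  under eq_integral do rewrite -cReN -cReD.
  rewrite -IE; last exact: cL2_Re.
  by rewrite lee_fin (le_trans _ (HN m n Nm Nn))// nE// lerDl.
have [w2 Lw2 w2P] : exists2 w, w \in Lfun mu 2%:E & forall e : R, 0 < e ->
    exists N, forall n, (N <= n)%N -> (\int[mu]_x ((Im (u n x) - w x) ^+ 2)%:E <= e%:E)%E.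
  apply: Lfun2_complete => [n|e e0]; first exact: cL2_Im.
  have [N HN] := cu e e0; exists N => m n Nm Nn.
  have Lmn : cL2 (fun t => u m t - u n t) by exact: cL2B.
  under eq_integral do rewrite -cImN -cImD.
  rewrite -IE; last exact: cL2_Im.
  by rewrite lee_fin (le_trans _ (HN m n Nm Nn))// nE// lerDr.
pose w t := w1 t +i* w2 t.
have Lw : cL2 w by [].
exists w => //; apply/cvgrPdist_le => e e0.
have e20 : 0 < e / 2 by rewrite divr_gt0.
have [N1 HN1] := w1P _ e20; have [N2 HN2] := w2P _ e20.
near=> n; rewrite sub0r normrN ger0_norm ?n2_ge0//.
have Ln : cL2 (fun t => u n t - w t) by exact: cL2B.
rewrite nE// [leRHS]splitr lerD// -lee_fin IE; [|exact: cL2_Re| |exact: cL2_Im].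
  under eq_integral do rewrite !cpartE.
  by apply: HN1; near: n; exact: nbhs_infty_ge.
under eq_integral do rewrite !cpartE.
by apply: HN2; near: n; exact: nbhs_infty_ge.
Unshelve. all: by end_near. Qed.

End ComplexHilbert.

(** * Density of step functions, as an induction principle *)

Section L2Density.
Context {R : realType}.
Local Notation mu := (@lebesgue_measure R).

Lemma Lfun2_dom (f h : R -> R) : measurable_fun setT f -> h \in Lfun mu 2%:E ->
  (forall t, `|f t| <= `|h t|) -> f \in Lfun mu 2%:E.
Proof.
move=> mf /Lfun2P[mh ih] fh; apply/Lfun2P; split => //.
apply: le_lt_trans ih; apply: ge0_le_integral => //.
- by move=> t _; rewrite lee_fin sqr_ge0.
- by apply/measurable_EFinP; exact: measurable_funX.
- by apply/measurable_EFinP; exact: measurable_funX.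
- by move=> t _; rewrite lee_fin -(real_normK (num_real (f t))) -(real_normK (num_real (h t))) lerXn2r ?nnegrE.
Qed.

Lemma Lfun2_dominated_cvg (f h : R -> R) (g : nat -> R -> R) :
  h \in Lfun mu 2%:E -> (forall n, measurable_fun setT (g n)) ->
  (forall n t, `|g n t| <= `|h t|) -> (forall t, g n t @[n --> \oo] --> f t) ->
  [/\ f \in Lfun mu 2%:E, forall n, g n \in Lfun mu 2%:E &
   (\int[mu]_t ((f t - g n t) ^+ 2)%:E)%E @[n --> \oo] --> 0%E].
Proof.
move=> Lh mg gh gf.
have Lg n : g n \in Lfun mu 2%:E by apply: Lfun2_dom Lh _.
have mf : measurable_fun setT f.
  by apply: (measurable_fun_cvg mg) => t _; exact: gf.
have fh t : `|f t| <= `|h t|.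
  have cn : `|g n t| @[n --> \oo] --> `|f t| by apply: cvg_norm; exact: gf.
  rewrite -(cvg_lim (@norm_hausdorff _ _) cn).
  by apply: limr_le; [exact: cvgP cn|near=> n; exact: gh].
split => //; first exact: Lfun2_dom Lh _.
have hi := Lfun2_integrable_sqr Lh.
have := @dominated_convergence _ _ _ mu _ measurableT
  (fun n t => ((f t - g n t) ^+ 2)%:E) (fun=> 0%E) (fun t => (4 * h t ^+ 2)%:E).
case=> //.
- by move=> n; apply/measurable_EFinP; apply: measurable_funX; apply: measurable_funB => //; exact: mg.
- apply: aeW => t _; apply: cvg_EFin; first exact: nearW.
  have c0 : f t - g x t @[x --> \oo] --> (0 : R).
    by rewrite -(subrr (f t)); apply: cvgB; [exact: cvg_cst|exact: gf].
  have := cvgM c0 c0; rewrite mulr0; exact.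
- by under eq_fun do rewrite EFinM; exact: integrableZl.
- apply: aeW => t n _; rewrite lee_fin ger0_norm ?sqr_ge0//.
  rewrite -(real_normK (num_real (f t - _))) -(real_normK (num_real (h t))).
  have le2 : `|f t - g n t| <= 2 * `|h t|.
    by apply: (le_trans (ler_normB _ _)); rewrite mulr_natl mulr2n lerD.
  have := lerXn2r 2 _ _ le2; rewrite !nnegrE mulr_ge0// normr_ge0 => /(_ isT isT).
  by rewrite exprMn (_ : 2 ^+ 2 = 4 :> R)// -natrX.
by move=> _ _; rewrite integral0.
Unshelve. all: by end_near. Qed.

Lemma Lfun2_indic (A : set R) : measurable A -> (mu A < +oo)%E ->
  (\1_A : R -> R) \in Lfun mu 2%:E.
Proof.
move=> mA Afin; apply/Lfun2P; split; first exact: measurable_indic.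
rewrite (_ : (fun x => _) = (fun x => (\1_A x)%:E)); last first.
  by apply/funext => x; rewrite indicE; case: (_ \in _); rewrite ?expr0n ?expr1n.
by rewrite integral_indic// setIT.
Qed.

Section Induction.
Variable P : (R -> R) -> Prop.
Hypothesis P_itv : forall a b : R, a <= b -> P (\1_`[a, b]).
Hypothesis P_lin : forall (c : R) f g, P f -> P g -> P (fun t => c * f t + g t).
Hypothesis P_closed : forall f, f \in Lfun mu 2%:E ->
  (forall e : R, 0 < e -> exists g, [/\ P g, g \in Lfun mu 2%:E &
     (\int[mu]_t ((f t - g t) ^+ 2)%:E <= e%:E)%E]) -> P f.

Let P_dom (f h : R -> R) (g : nat -> R -> R) :
  h \in Lfun mu 2%:E -> (forall n, measurable_fun setT (g n)) ->
  (forall n t, `|g n t| <= `|h t|) -> (forall t, g n t @[n --> \oo] --> f t) ->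
  (forall n, P (g n)) -> P f.
Proof.
move=> Lh mg gh gf Pg; have [Lf Lg c0] := Lfun2_dominated_cvg _ _ _ Lh mg gh gf.
apply: P_closed => // e e0.
have /fine_cvgP[_ /cvgrPdist_le/(_ e e0)[N _ HN]] := c0.
exists (g N); split => //; have := HN N (leqnn N).
rewrite /= sub0r normrN.
have fin : (\int[mu]_t ((f t - g N t) ^+ 2)%:E \is a fin_num)%E.
  have L : (fun t => f t - g N t) \in Lfun mu 2%:E.
    rewrite (_ : (fun t => _) = (-1) *: g N + f).
      exact: (Lfun_submod_closed mu (lee1n 2)).2.
    by apply/funext => t; rewrite !fctE/= scaleN1r addrC.
  have /Lfun2P[_] := L; rewrite ge0_fin_numE// integral_ge0// => t _.
  by rewrite lee_fin sqr_ge0.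
rewrite ger0_norm; last by rewrite fine_ge0// integral_ge0// => t _; rewrite lee_fin sqr_ge0.
by move=> le; rewrite -(fineK fin) lee_fin.
Qed.

Let P_0 : P (fun=> 0).
Proof.
have := P_lin (-1) _ _ (P_itv 0 0 (lexx _)) (P_itv 0 0 (lexx _)).
by under eq_fun do rewrite mulN1r addNr.
Qed.

Let P_sum (I : Type) (s : seq I) (c : I -> R) (F : I -> R -> R) :
  (forall i, P (F i)) -> P (fun t => \sum_(i <- s) c i * F i t).
Proof.
move=> PF; elim: s => [|i s IH]; first by under eq_fun do rewrite big_nil.
by under eq_fun do rewrite big_cons; exact: P_lin.
Qed.

(** Half-open intervals form the semiring that generates the Borel sets; they differ from closed
    ones by the null set of the left endpoint. *)
Let P_oc (a b : R) : P (\1_`]a, b]).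
Proof.
have [ba|ab] := ltP b a.
  rewrite set_itv_ge; last by rewrite bnd_simp -leNgt ltW.
  by rewrite (_ : \1_set0 = fun=> 0)//; apply/funext => t; rewrite indic0.
have finab : (mu `[a, b] < +oo)%E by rewrite lebesgue_measure_itv/=; case: ifP => _; rewrite ltry.
apply: P_closed.
  apply: Lfun2_indic => //; rewrite lebesgue_measure_itv/=; case: ifP => _; rewrite ltry//.
move=> e e0; exists (\1_`[a, b]); split => //; first exact: P_itv.
  exact: Lfun2_indic.
rewrite (_ : (fun t => _) = (fun t => (\1_[set a] t)%:E)); last first.
  apply/funext => t; congr EFin; rewrite !indicE !mem_setE !in_itv/= in_set1.
  have [->|ta] := eqVneq t a; first by rewrite ltxx lexx ab/= sub0r sqrrN expr1n.
  by rewrite [a <= t]le_eqVlt eq_sym (negPf ta)/= subrr expr0n.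
rewrite integral_indic// setIT. 
apply: (@le_trans _ _ 0%E); last by rewrite lee_fin ltW.
by rewrite -(lebesgue_measure_set1 a).
Qed.

Let J (n : nat) : set R := `]- n%:R, n%:R].

Let mJ n : measurable (J n). Proof. exact: measurable_itv. Qed.

Let LJ n : (\1_(J n) : R -> R) \in Lfun mu 2%:E.
Proof.
by apply: Lfun2_indic => //; rewrite lebesgue_measure_itv/=; case: ifP => _; rewrite ltry.
Qed.

Let J_cvg t : (\1_(J n) t : R) @[n --> \oo] --> (1 : R).
Proof.
apply: cvg_near_cst.
have [N _ HN] := (nbhs_infty_ger (`|t| + 1)).
exists N => // n /= /HN/= tn; rewrite indicE mem_set// /J/= in_itv/=.
have : `|t| < n%:R by rewrite (lt_le_trans _ tn)// ltrDl.
by rewrite ltr_norml => /andP[-> /ltW].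
Qed.

(** The pi-lambda theorem. Intersecting with the bounded interval [J n] keeps all indicators in L2,
    so that differences and increasing unions stay within reach of [P_lin] and dominated
    convergence. *)
Let P_set n (A : set R) : measurable A -> P (\1_(A `&` J n)).
Proof.
pose H := [set A : set R | measurable A /\ P (\1_(A `&` J n))].
suff sub : (@ocitv R).-sigma.-measurable `<=` H by move=> mA; have [] := sub A mA.
move: A => _.
apply: lambda_system_subset => //.
- exact: ocitvI.
- split => //.
  + by split => //; rewrite setTI; exact: P_oc.
  + move=> A B BA [mA PA] [mB PB]; split; first exact: measurableD.
    rewrite (_ : \1_(_) = (fun t => (-1) * \1_(B `&` J n) t + \1_(A `&` J n) t)).
      exact: P_lin.
    apply/funext => t; rewrite !indicI/= !indicE.
    have [Bt|nBt] := pselect (B t).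
      rewrite (mem_set Bt) (mem_set (BA t Bt)) memNset; last exact.
      by rewrite mulr0 mul0r mulN1r !mul1r addNr.
    by rewrite (memNset nBt) mul0r mulr0 add0r (mem_set (nBt : (~` B) t)) mulr1.
  + move=> F ndF HF; split; first by apply: bigcup_measurable => k _; have [] := HF k.
    apply: (P_dom _ (\1_(J n)) (fun k => \1_(F k `&` J n))) => //.
    * by move=> k; apply: measurable_indic; apply: measurableI => //; have [] := HF k.
    * move=> k t; rewrite indicI/= !indicE.
      by case: (_ \in _); case: (_ \in _); rewrite ?(mulr0, mulr1, mul0r, mul1r, normr0, normr1).
    * move=> t; rewrite indicI; under eq_fun do rewrite indicI.
      apply: cvgMl; apply: cvg_near_cst.
      have [[k _ Fkt]|nF] := pselect ((\bigcup_i F i) t).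
        exists k => // m km; rewrite /= !indicE !mem_set//; first by exists k.
        by have /subsetPset := ndF _ _ km; exact.
      apply: nearW => k; rewrite !indicE !memNset// => Ft; apply: nF; by exists k.
    * by move=> k; have [] := HF k.
- move=> _ [[a b] _ <-]; split; first exact: measurable_itv.
  have : ocitv (`]a, b]%classic `&` J n) by apply: ocitvI; [exists (a, b)|exists (- n%:R, n%:R)].
  by move=> [[x y] _ <-]; exact: P_oc.
Qed.

Import HBSimple HBNNSimple.

Let P_ge0 f : f \in Lfun mu 2%:E -> (forall t, 0 <= f t) -> P f.
Proof.
move=> Lf f0; have /Lfun2P[mf _] := Lf.
have mf' : measurable_fun setT (EFin \o f) by exact/measurable_EFinP.
have f0' (x : R) : [set: R] x -> (0 <= (EFin \o f) x)%E by rewrite lee_fin.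
pose s n := nnsfun_approx measurableT mf' n.
apply: (P_dom f f (fun (n : nat) (t : R) => s n t * \1_(J n) t)) => //.
- move=> n; apply: measurable_funM; last exact: measurable_indic.
  exact: (@measurable_funPT _ _ _ _ (s n)).
- move=> n t; have s0 : 0 <= s n t by [].
  have sf : s n t <= f t by rewrite -lee_fin /s nnsfun_approxE; exact: (le_approx n f0' I).
  rewrite ger0_norm ?mulr_ge0// ger0_norm//; apply: le_trans sf.
  by rewrite indicE; case: (_ \in _); rewrite ?mulr1 ?mulr0.
- move=> t; rewrite -[f t]mulr1; apply: cvgM; last exact: J_cvg.
  by have /(fine_cvgP _ (f t)).1[_] := cvg_nnsfun_approx measurableT mf' f0' (I : [set: R] t).
(* A simple function is the finite sum of its values times the indicators of its level sets. *)
- move=> n; rewrite (_ : (fun t => _) = (fun t => \sum_(i < size (finmap.enum_fset (fset_set (range (s n)))))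
     (finmap.enum_fset (fset_set (range (s n))))`_i * \1_((s n) @^-1` [set (finmap.enum_fset (fset_set (range (s n))))`_i] `&` J n) t)).
    apply: P_sum => i; apply: P_set; rewrite -[X in measurable X]setTI.
    exact: (@measurable_funPT _ _ _ _ (s n)).
  apply/funext => t; rewrite (fimfunEord (s n)) mulr_suml; apply: eq_bigr => i _.
  by rewrite indicI/= mulrA.
Qed.

Lemma Lfun2_ind f : f \in Lfun mu 2%:E -> P f.
Proof.
move=> Lf; have /Lfun2P[mf _] := Lf.
have mm (g : R -> R) : measurable_fun setT g -> measurable_fun setT (fun t : R => Num.max (g t) (0 : R)).
  by move=> mg; apply: measurable_maxr.
have -> : f = (fun t => (-1) * Num.max (- f t) 0 + Num.max (f t) 0).
  apply/funext => t; rewrite maxEle maxEle oppr_le0 mulN1r.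
  case: (lerP 0 (f t)) => [f0|/ltW f0]; case: ifP => ?; try lra.
apply: P_lin; apply: P_ge0.
- apply: Lfun2_dom Lf _; first by apply: mm; exact: measurable_funN.
  by move=> t; rewrite maxEle; case: ifP; rewrite ?normr0 ?normrN.
- by move=> t; rewrite le_max lexx orbT.
- apply: Lfun2_dom Lf _; first exact: mm.
  by move=> t; rewrite maxEle; case: ifP; rewrite ?normr0 ?normrN.
- by move=> t; rewrite le_max lexx orbT.
Qed.

End Induction.
End L2Density.

(** * Plancherel's theorem *)

Section FejerIntegral.
Context {R : realType}.
Local Notation mu := (@lebesgue_measure R).

Lemma derivable_continuous (f : R -> R) :
  (forall x, derivable f x 1) -> continuous f.
Proof.
by move=> df x; apply: differentiable_continuous; apply/derivable1_diffP; exact: df.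
Qed.

Lemma integral_mul_indic (D : set R) (f : R -> R) :
  (\int[mu]_x (f x * \1_D x)%:E = \int[mu]_(x in D) (f x)%:E)%E.
Proof.
rewrite [RHS]integral_mkcond; apply: eq_integral => x _.
by rewrite /patch indicE; case: ifP => _; rewrite ?mulr1 ?mulr0.
Qed.

Lemma cvg_expRNM (c : R) : 0 < c -> expR (- (c * x)) @[x --> +oo] --> (0 : R).
Proof.
move=> c0; apply: (@cvg_comp _ _ _ (fun x => c * x) (fun x => expR (- x)) +oo +oo); last exact: cvgr_expR.
by apply: gt0_cvgMry => //; exact: cvg_cst.
Qed.

Lemma mul_expRN_le1 (x : R) : 0 <= x -> x * expR (- x) <= 1.
Proof.
move=> x0; rewrite expRN ler_pdivrMr ?expR_gt0// mul1r.
by apply: le_trans (expR_ge1Dx x); rewrite lerDr.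
Qed.

Lemma cvg_mul_expRNM (c : R) : 0 < c -> x * expR (- (c * x)) @[x --> +oo] --> (0 : R).
Proof.
move=> c0; have c20 : 0 < c / 2 by rewrite divr_gt0.
have cu : (c / 2)^-1 * expR (- (c / 2 * x)) @[x --> +oo] --> (0 : R).
  rewrite -(mulr0 (c / 2)^-1); apply: cvgM; [exact: cvg_cst|exact: cvg_expRNM].
apply: squeeze_cvgr (cvg_cst 0) cu.
near=> x.
have x0 : 0 <= x by near: x; exact: nbhs_pinfty_ge.
rewrite mulr_ge0 ?expR_ge0//=.
have -> : expR (- (c * x)) = expR (- (c / 2 * x)) * expR (- (c / 2 * x)).
  by rewrite -expRD; congr expR; field.
rewrite mulrA ler_wpM2r ?expR_ge0// -(ler_pM2l c20) mulfV ?gt_eqF// mulrA.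
by rewrite mul_expRN_le1// mulr_ge0 ?ltW.
Unshelve. all: by end_near. Qed.

Let inner_y (w : R) : w != 0 ->
  (\int[mu]_(y in `[0%R, +oo[) (y * expR (- (`|w| * y)))%:E = (w ^- 2)%:E)%E.
Proof.
move=> w0; have aw0 : 0 < `|w| by rewrite normr_gt0.
pose F y := - ((y / `|w| + w ^- 2) * expR (- (`|w| * y))).
have dF (y : R) : is_derive y 1 F (y * expR (- (`|w| * y))).
  rewrite /F; apply: is_derive_eq.
  rewrite /GRing.scale/= -(real_normK (num_real w)).
  by field; rewrite gt_eqF.
have cf : continuous (fun y : R => y * expR (- (`|w| * y))).
  by apply: derivable_continuous => x; exact: ex_derive.
rewrite (@ge0_continuous_FTC2y _ _ F _ 0).
- by rewrite -EFinB; congr EFin; rewrite /F mul0r add0r mulr0 oppr0 expR0 mulr1 opprK add0r.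
- by move=> x x0; rewrite mulr_ge0// expR_ge0.
- exact: continuous_subspaceT.
- have -> : (0 : R) = - (`|w|^-1 * 0 + w ^- 2 * 0) by rewrite !mulr0 addr0 oppr0.
  rewrite (_ : F = fun x => - (`|w|^-1 * (x * expR (- (`|w| * x))) + w ^- 2 * expR (- (`|w| * x)))); last first.
    by apply/funext => y; rewrite /F; ring.
  apply: cvgN; apply: cvgD; apply: cvgM; [exact: cvg_cst| |exact: cvg_cst|].
    exact: cvg_mul_expRNM.
  exact: cvg_expRNM.
- by move=> x _; exact: ex_derive.
- apply: cvg_at_right_filter.
  by apply: derivable_continuous => x; exact: ex_derive.
- by move=> x _; rewrite derive1E derive_val.
Qed.

(** By parity this is twice the integral over [w >= 0], where y exp (- y w) has integral 1 and y cos
    (a w) exp (- y w) has integral y^2 / (y^2 + a^2). *)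
Let inner_w (a y : R) : 0 < y ->
  (\int[mu]_w ((1 - cos (a * w)) * (y * expR (- (`|w| * y))))%:E =
   (2 * (a ^+ 2 / (y ^+ 2 + a ^+ 2)))%:E)%E.
Proof.
move=> y0.
have y2a2 : y ^+ 2 + a ^+ 2 != 0 by rewrite gt_eqF// ltr_pwDl ?exprn_gt0// sqr_ge0.
have cos1 (x : R) : 0 <= 1 - cos x by rewrite subr_ge0 cos_le1.
rewrite ge0_symfun_integralT; last 3 first.
- by move=> w; rewrite !mulr_ge0 ?cos1 ?expR_ge0 ?ltW.
- move=> w; apply: cvgM.
    apply: (derivable_continuous (fun w => 1 - cos (a * w))) => x.
    exact: ex_derive.
  apply: cvgM; first exact: cvg_cst.
  apply: continuous_comp; last exact: continuous_expR.
  by apply: cvgN; apply: cvgM; [exact: norm_continuous|exact: cvg_cst].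
- by move=> w /=; rewrite mulrN cosN normrN.
rewrite -set_itvcy EFinM; congr (_ * _)%E.
transitivity (\int[mu]_(w in `[0%R, +oo[) ((1 - cos (a * w)) * (y * expR (- (y * w))))%:E)%E.
  apply: eq_integral => w; rewrite inE/= in_itv/= andbT => w0.
  by rewrite ger0_norm// (mulrC w).
(* The second term comes from two integrations by parts: exp (- y w) (a sin (a w) - y cos (a w)) has
   derivative (y^2 + a^2) exp (- y w) cos (a w). *)
pose F w := - expR (- (y * w)) - y / (y ^+ 2 + a ^+ 2) * (expR (- (y * w)) * (a * sin (a * w) - y * cos (a * w))).
rewrite (@ge0_continuous_FTC2y _ _ F _ 0).
- rewrite -EFinB; congr EFin; rewrite /F !mulr0 oppr0 expR0 sin0 cos0; field.
  by rewrite y2a2.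
- by move=> w w0; rewrite !mulr_ge0 ?cos1 ?expR_ge0 ?ltW.
- by apply: continuous_subspaceT; apply: derivable_continuous => x; exact: ex_derive.
- have -> : (0 : R) = - 0 - y / (y ^+ 2 + a ^+ 2) * 0 by rewrite mulr0 subr0 oppr0.
  apply: cvgB; first by apply: cvgN; exact: cvg_expRNM.
  apply: cvgM; first exact: cvg_cst.
  have cu : expR (- (y * w)) * (`|a| + `|y|) @[w --> +oo] --> (0 : R).
    by rewrite -(mul0r (`|a| + `|y|)); apply: cvgM; [exact: cvg_expRNM|exact: cvg_cst].
  apply: norm_cvg0; apply: squeeze_cvgr (cvg_cst 0) cu.
  near=> w; rewrite normr_ge0/= normrM ger0_norm ?expR_ge0// ler_wpM2l ?expR_ge0//.
  apply: (le_trans (ler_normB _ _)); rewrite !normrM lerD// ler_piMr//.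
    by rewrite ler_norml sin_geN1 sin_le1.
  by rewrite ler_norml cos_geN1 cos_le1.
- by move=> w _; exact: ex_derive.
- apply: cvg_at_right_filter.
  by apply: derivable_continuous => x; exact: ex_derive.
- move=> w _; rewrite derive1E derive_val/= /GRing.scale/=; field.
  by rewrite y2a2.
Unshelve. all: by end_near. Qed.

Let outer (a : R) : a != 0 ->
  (\int[mu]_(y in `[0%R, +oo[) (2 * (a ^+ 2 / (y ^+ 2 + a ^+ 2)))%:E = (pi * `|a|)%:E)%E.
Proof.
move=> a0; have aa0 : 0 < `|a| by rewrite normr_gt0.
have a20 : 0 < a ^+ 2 by rewrite -(real_normK (num_real a)) exprn_gt0.
have y2a2 (y : R) : y ^+ 2 + a ^+ 2 != 0 by rewrite gt_eqF// ltr_wpDl// sqr_ge0.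
pose F (y : R) := 2 * `|a| * atan (y / `|a|).
have dF (y : R) : is_derive y 1 F (2 * (a ^+ 2 / (y ^+ 2 + a ^+ 2))).
  rewrite /F; apply: is_derive_eq; rewrite /GRing.scale/=.
  rewrite -(real_normK (num_real a)); field.
  by rewrite (real_normK (num_real a)) y2a2 gt_eqF.
have cf : continuous (fun y : R => 2 * (a ^+ 2 / (y ^+ 2 + a ^+ 2))).
  move=> y; apply: cvgM; first exact: cvg_cst.
  apply: cvgM; first exact: cvg_cst.
  apply: cvgV; first exact: y2a2.
  by apply: cvgD; [exact: exprn_continuous|exact: cvg_cst].
rewrite (@ge0_continuous_FTC2y _ _ F _ (2 * `|a| * (pi / 2))).
- by rewrite -EFinB; congr EFin; rewrite /F mul0r atan0 mulr0 subr0; field.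
- by move=> y y0; rewrite mulr_ge0// divr_ge0 ?addr_ge0 ?sqr_ge0.
- exact: continuous_subspaceT.
- apply: cvgM; first exact: cvg_cst.
  apply: (@cvg_comp _ _ _ (fun y => y / `|a|) atan +oo +oo); last exact: cvgy_atan.
  by apply: gt0_cvgMly; [rewrite invr_gt0|exact: cvg_id].
- by move=> y _; exact: ex_derive.
- apply: cvg_at_right_filter.
  by apply: derivable_continuous => x; exact: ex_derive.
- by move=> y _; rewrite derive1E derive_val.
Qed.

(* Tonelli's theorem, with 1 / w^2 the integral of y exp (- |w| y) over y >= 0. *)
Lemma integral_one_sub_cos (a : R) :
  (\int[mu]_w ((1 - cos (a * w)) / w ^+ 2)%:E = (pi * `|a|)%:E)%E.
Proof.
have [->|a0] := eqVneq a 0.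
  rewrite normr0 mulr0; under eq_integral do rewrite mul0r cos0 subrr mul0r.
  by rewrite integral0.
have cos1 (x : R) : 0 <= 1 - cos x by rewrite subr_ge0 cos_le1.
(* The half-line is open because [inner_w] needs [y > 0]; the endpoint is a null set. *)
pose f (z : R * R) := ((1 - cos (a * z.1)) * (z.2 * expR (- (`|z.1| * z.2))) * \1_(`]0%R, +oo[%classic : set R) z.2)%:E.
have f0 z : (0 <= f z)%E.
  rewrite lee_fin /f indicE; case: (boolP (_ \in _)); last by rewrite mulr0.
  rewrite mem_setE in_itv/= andbT => z0.
  by rewrite !mulr_ge0 ?cos1 ?expR_ge0 ?(ltW z0).
have mexp : measurable_fun setT (fun z : R * R => expR (- (`|z.1| * z.2))).
  apply: (measurableT_comp (@measurable_expR R)); apply: measurable_funN.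
  by apply: measurable_funM; [exact: measurableT_comp|].
have mf : measurable_fun setT f.
  apply/measurable_EFinP; apply: measurable_funM.
    apply: measurable_funM; last exact: measurable_funM.
    apply: measurable_funB => //; apply: (measurableT_comp (continuous_measurable_fun (@continuous_cos R))).
    by apply: measurable_funM.
  by apply: measurableT_comp => //; exact: measurable_indic.
have := @fubini_tonelli _ _ _ _ _ mu mu f mf f0.
rewrite /f/=.
rewrite [X in X = _ -> _](_ : _ = (\int[mu]_w ((1 - cos (a * w)) / w ^+ 2)%:E)%E); last first.
  apply: eq_integral => w _.
  have [->|w0] := eqVneq w 0.
    rewrite mulr0 cos0 subrr mul0r; under eq_integral do rewrite !mul0r.
    by rewrite integral0.
  under eq_integral do rewrite -mulrA EFinM.
  rewrite ge0_integralZl ?lee_fin ?cos1//; last 2 first.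
  - apply/measurable_EFinP; apply: measurable_funM; last exact: measurable_indic.
    by apply: measurable_funM => //; apply: (measurableT_comp (@measurable_expR R));
      apply: measurable_funN; exact: measurable_funM.
  - move=> y _; rewrite lee_fin indicE; case: (boolP (_ \in _)); last by rewrite mulr0.
    rewrite mem_setE in_itv/= andbT => z0.
    by rewrite !mulr_ge0 ?expR_ge0 ?ltW.
  rewrite integral_mul_indic integral_itv_obnd_cbnd.
    by rewrite inner_y// -EFinM.
  by apply/measurable_EFinP; apply: measurable_funM => //; apply: (measurableT_comp (@measurable_expR R));
      apply: measurable_funN; exact: measurable_funM.
move=> ->.
transitivity (\int[mu]_y (2 * (a ^+ 2 / (y ^+ 2 + a ^+ 2)) * \1_(`]0%R, +oo[%classic : set R) y)%:E)%E.
  apply: eq_integral => y _; rewrite indicE; case: (boolP (_ \in _)) => /=.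
    rewrite mem_setE in_itv/= andbT => y0; under eq_integral do rewrite mulr1.
    by rewrite inner_w// mulr1.
  by move=> _; under eq_integral do rewrite mulr0; rewrite integral0 mulr0.
rewrite integral_mul_indic integral_itv_obnd_cbnd; first exact: outer.
apply/measurable_EFinP; apply: measurable_funM => //; apply: measurable_funM => //.
apply: (measurableT_comp measurable_invr).
by apply: measurable_funD => //; exact: measurable_funX.
Qed.
End FejerIntegral.

(** * Fourier transforms of intervals *)

Section IntervalFourier.
Context {R : realType}.
Local Notation C := R[i].
Local Notation mu := (@lebesgue_measure R).
Local Notation Re := (@complex.Re R).
Local Notation Im := (@complex.Im R).

Lemma Rintegral_odd (h : R -> R) : mu.-integrable setT (EFin \o h) ->
  (forall x, h (- x) = - h x) -> \int[mu]_x h x = 0.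
Proof.
move=> ih oddh.
have mh : measurable_fun setT (EFin \o h) by exact: measurable_int ih.
have mopp : measurable_fun [set: measurableTypeR R] (-%R : measurableTypeR R -> measurableTypeR R).
  exact: (@measurable_funN _ (measurableTypeR R) R setT id).
have ihN : mu.-integrable setT ((EFin \o h) \o (-%R : R -> measurableTypeR R)).
  by rewrite (_ : _ \o _ = fun x => (- (EFin \o h) x)%E);
    [exact: integrableN|apply/funext => x; rewrite /= oddh].
have E1 := @integral_pushforward _ _ _ _ R _ mopp mu setT (EFin \o h) mh ihN measurableT.
have E2 : (\int[pushforward mu (-%R : R -> measurableTypeR R)]_x (EFin \o h) x = \int[mu]_x (EFin \o h) x)%E.
  by apply: eq_measure_integral => A mA _; exact: lebesgue_measureN.
have E3 : \int[mu]_x h (- x) = \int[mu]_x h x.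
  by rewrite /Rintegral; congr fine; rewrite -E2 E1.
have E4 : \int[mu]_x h (- x) = - \int[mu]_x h x.
  under eq_Rintegral do rewrite oddh -mulN1r.
  by rewrite RintegralZl// mulN1r.
move: E4; rewrite E3 => /eqP; rewrite -addr_eq0 -mulr2n mulrn_eq0 => /eqP.
exact.
Qed.

Lemma continuous_itv_integrable (f : R -> R) (a b : R) : continuous f ->
  mu.-integrable `[a, b] (EFin \o f).
Proof.
move=> cf; apply: continuous_compact_integrable; first exact: segment_compact.
exact: continuous_subspaceT.
Qed.

Definition fconst : R := (Num.sqrt (2 * pi))^-1.

Lemma fconst2 : fconst ^+ 2 = (2 * pi)^-1.
Proof. by rewrite exprVn sqr_sqrtr// mulr_ge0// pi_ge0. Qed.

Definition fint (D : set R) (g : R -> C) : R -> C := fun om =>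
  fconst%:C * cintegral D (fun t => cexpi (- (om * t)) * g t).

Definition eitv (a b : R) : R -> C := fint setT (fun t => (\1_`[a, b] t)%:C).

Lemma continuous_cosM (w : R) : continuous (fun t => cos (w * t)).
Proof. by apply: derivable_continuous => x; exact: ex_derive. Qed.
Lemma continuous_sinM (w : R) : continuous (fun t => sin (w * t)).
Proof. by apply: derivable_continuous => x; exact: ex_derive. Qed.

Lemma Rintegral_mul_indic (D : set R) (f : R -> R) :
  \int[mu]_x (f x * \1_D x) = \int[mu]_(x in D) f x.
Proof. by rewrite /Rintegral integral_mul_indic. Qed.

Lemma eitvE (a b w : R) : eitv a b w =
  (fconst * \int[mu]_(t in `[a, b]) cos (w * t)) +i*
  (- (fconst * \int[mu]_(t in `[a, b]) sin (w * t))).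
Proof.
apply: ceqP; rewrite /eitv /fint !cpartE /cintegral/= ?mul0r ?subr0 ?addr0.
  congr (_ * _); rewrite -Rintegral_mul_indic; apply: eq_Rintegral => t _.
  by rewrite cosN mulr0 subr0.
rewrite -mulrN; congr (_ * _).
transitivity (\int[mu]_(t in `[a, b]) (-1 * sin (w * t))).
  rewrite -[RHS]Rintegral_mul_indic; apply: eq_Rintegral => t _.
  by rewrite sinN mulr0 add0r mulN1r.
by rewrite RintegralZl ?mulN1r//; exact/continuous_itv_integrable/continuous_sinM.
Qed.

Lemma derivable_oo_LRcontinuousT (F : R -> R) (a b : R) :
  (forall x : R, derivable F x 1) -> derivable_oo_LRcontinuous F a b.
Proof.
move=> dF; have cF := derivable_continuous _ dF.
by split; [move=> x _|apply: cvg_at_right_filter; exact: cF|apply: cvg_at_left_filter; exact: cF].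
Qed.

Lemma RintegralFTC (F f : R -> R) (a b : R) : a <= b -> continuous f ->
  (forall x : R, is_derive x 1 F (f x)) -> \int[mu]_(t in `[a, b]) f t = F b - F a.
Proof.
rewrite le_eqVlt => /predU1P[<-|ab] cf dF.
  by rewrite set_itv1 Rintegral_set1 subrr.
rewrite /Rintegral (@continuous_FTC2 _ _ F)//.
- exact: continuous_subspaceT.
- by apply: derivable_oo_LRcontinuousT => x; exact: ex_derive.
- by move=> x _; rewrite derive1E derive_val.
Qed.

Lemma Rintegral_cosM (a b w : R) : a <= b -> w != 0 ->
  \int[mu]_(t in `[a, b]) cos (w * t) = (sin (w * b) - sin (w * a)) / w.
Proof.
move=> ab w0.
have dF (x : R) : is_derive x 1 (fun t => sin (w * t) / w) (cos (w * x)).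
  by apply: is_derive_eq; rewrite /GRing.scale/=; field.
by rewrite (RintegralFTC _ _ _ _ ab (continuous_cosM w) dF) -mulrBl.
Qed.

Lemma Rintegral_sinM (a b w : R) : a <= b -> w != 0 ->
  \int[mu]_(t in `[a, b]) sin (w * t) = (cos (w * a) - cos (w * b)) / w.
Proof.
move=> ab w0.
have dF (x : R) : is_derive x 1 (fun t => - cos (w * t) / w) (sin (w * x)).
  by apply: is_derive_eq; rewrite /GRing.scale/=; field.
by rewrite (RintegralFTC _ _ _ _ ab (continuous_sinM w) dF); field.
Qed.

Lemma eitv_ge (a b w : R) : b < a -> eitv a b w = 0.
Proof.
by move=> ab; rewrite eitvE set_itv_ge ?bnd_simp -?ltNge// !Rintegral_set0 mulr0 oppr0.
Qed.

Lemma eitv_neq0 (a b w : R) : a <= b -> w != 0 -> eitv a b w =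
  (fconst * (sin (w * b) - sin (w * a)) / w) +i*
  (fconst * (cos (w * b) - cos (w * a)) / w).
Proof.
move=> ab w0; rewrite eitvE Rintegral_cosM// Rintegral_sinM// !mulrA.
by apply: ceqP => //=; ring.
Qed.

Lemma eitvN (a b w : R) : eitv a b (- w) = ((eitv a b w)^*)%C.
Proof.
rewrite !eitvE; apply: ceqP => /=.
  by congr (_ * _); apply: eq_Rintegral => t _; rewrite mulNr cosN.
rewrite -[in RHS]mulrN; congr (- (_ * _)).
rewrite -mulN1r -RintegralZl//; last exact/continuous_itv_integrable/continuous_sinM.
by apply: eq_Rintegral => t _; rewrite mulNr sinN mulN1r.
Qed.

Lemma ae_neq (a : R) : {ae mu, forall t, t != a}.
Proof.
exists [set a]; split; [exact: measurable_set1|exact: lebesgue_measure_set1|].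
by move=> t /= /negP; rewrite negbK => /eqP.
Qed.

(** The Fejer kernel up to a constant. Its value at [w = 0] is 0 instead of the limit a^2 / 2, which
    changes no integral. *)
Definition fejer (a w : R) : R := (1 - cos (a * w)) / w ^+ 2.

Lemma measurable_fejer (a : R) : measurable_fun setT (fejer a).
Proof.
apply: measurable_funM.
  apply: measurable_funB => //; apply: continuous_measurable_fun; exact: continuous_cosM.
by apply: (measurableT_comp measurable_invr); exact: measurable_funX.
Qed.

Lemma fejer_ge0 (a w : R) : 0 <= fejer a w.
Proof. by rewrite /fejer divr_ge0 ?sqr_ge0// subr_ge0 cos_le1. Qed.

Lemma fejer_integrable (a : R) : mu.-integrable setT (EFin \o fejer a).
Proof.
apply/integrableP; split; first by apply/measurable_EFinP; exact: measurable_fejer.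
under eq_integral do rewrite /= ger0_norm ?fejer_ge0//.
by rewrite integral_one_sub_cos ltry.
Qed.

Lemma Rintegral_fejer (a : R) : \int[mu]_w fejer a w = pi * `|a|.
Proof. by rewrite /Rintegral integral_one_sub_cos. Qed.

Lemma cmeas_eitv (a b : R) : cmeas (eitv a b).
Proof.
have [ab|ba] := leP a b; last first.
  by rewrite (_ : eitv a b = cst 0); [exact: cmeas_cst|apply/funext => w; rewrite eitv_ge].
(* The closed form holds for [w != 0] and takes the value 0 at [w = 0], where the true value is
   added by an indicator. *)
rewrite (_ : eitv a b = fun w =>
  ((fconst * (sin (b * w) - sin (a * w)) / w) +i*
  (fconst * (cos (b * w) - cos (a * w)) / w)) + (\1_[set 0%R] w)%:C * eitv a b 0).
  apply: cmeasD; last first.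
    by apply: cmeasM; [apply: cmeas_real; exact: measurable_indic|exact: cmeas_cst].
  split=> /=; apply: measurable_funM; try exact: measurable_invr;
    apply: measurable_funM => //; apply: measurable_funB;
    apply: continuous_measurable_fun;
    by [exact: continuous_sinM|exact: continuous_cosM].
apply/funext => w; have [->|w0] := eqVneq w 0.
  rewrite indicE mem_set// mul1r (_ : _ +i* _ = 0) ?add0r//.
  by rewrite !invr0 !mulr0.
rewrite indicE memNset; last by move=> /= w1; rewrite w1 eqxx in w0.
by rewrite mul0r addr0 eitv_neq0// ![w * _]mulrC.
Qed.

(* The product-to-sum formula turns the inner product of the transforms of two
   intervals into a combination of Fejer integrals. *)
Lemma rip_eitv_fejer (a b c d w : R) : a <= b -> c <= d -> w != 0 ->
  Re (eitv a b w) * Re (eitv c d w) + Im (eitv a b w) * Im (eitv c d w) =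
  (2 * pi)^-1 * (fejer (b - c) w + fejer (a - d) w - fejer (b - d) w - fejer (a - c) w).
Proof.
move=> ab cd w0; rewrite !eitv_neq0//= -fconst2 /fejer.
rewrite !mulrBl !cosB ![_ * w]mulrC; field.
by rewrite w0.
Qed.

Lemma cL2_eitv (a b : R) : cL2 (eitv a b).
Proof.
have [ab|ba] := leP a b; last first.
  by rewrite (_ : eitv a b = fun=> 0); [exact: cL2_0|apply/funext => w; rewrite eitv_ge].
apply/cL2P; split; first exact: cmeas_eitv.
have -> : (\int[mu]_t (nsq (eitv a b t))%:E =
    \int[mu]_w ((2 * pi)^-1 * (2 * fejer (b - a) w))%:E)%E.
  apply: ae_eq_integral => //.
  - by apply/measurable_EFinP; apply: measurable_nsq; exact: cmeas_eitv.
  - apply/measurable_EFinP; apply: measurable_funM => //; apply: measurable_funM => //.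
    exact: measurable_fejer.
  - apply: ae_sub (ae_neq 0) => w w0 _; congr EFin.
    rewrite /nsq !expr2 rip_eitv_fejer// !subrr.
    have -> : fejer 0 w = 0 by rewrite /fejer mul0r cos0 subrr mul0r.
    rewrite !subr0 (_ : fejer (a - b) w = fejer (b - a) w); first by ring.
    by rewrite /fejer -cosN -mulNr opprB.
under eq_integral do rewrite EFinM EFinM.
have pi0 : 0 <= (2 * pi)^-1 :> R by rewrite invr_ge0 mulr_ge0// pi_ge0.
have mf : measurable_fun setT (fun w => (fejer (b - a) w)%:E).
  by apply/measurable_EFinP; exact: measurable_fejer.
rewrite ge0_integralZl ?lee_fin//; last 2 first.
- exact: emeasurable_funM.
- by move=> x _; rewrite -EFinM lee_fin mulr_ge0// fejer_ge0.
rewrite ge0_integralZl//; last by move=> x _; rewrite lee_fin fejer_ge0.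
by rewrite integral_one_sub_cos -!EFinM ltry.
Qed.
Definition citv (a b : R) : R -> C := fun t => (\1_`[a, b] t)%:C.

Lemma indic_itvM (a b c d t : R) : (\1_`[a, b] t * \1_`[c, d] t : R) =
  \1_`[Num.max a c, Num.min b d] t.
Proof.
rewrite !indicE -natrM mulnb; congr (nat_of_bool _)%:R.
by rewrite !mem_setE !in_itv/= ge_max le_min; case: (a <= t); case: (c <= t); rewrite ?andbF ?andbT //=.
Qed.

Lemma itv_fin (a b : R) : (mu `[a, b] < +oo)%E.
Proof. by rewrite lebesgue_measure_itv/=; case: ifP => _; rewrite ltry. Qed.

Lemma Rintegral_indic_itv (a b : R) :
  \int[mu]_t (\1_`[a, b] t) = Num.max 0 (b - a).
Proof.
rewrite /Rintegral integral_indic// setIT.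
rewrite (_ : (lebesgue_measure_lebesgue_measure__canonical__measure_function_Measure _ _) = lebesgue_measure (`[a, b]%classic : set R))//.
rewrite lebesgue_measure_itv/= lte_fin.
case: ltP => ab; first by rewrite -EFinB/= max_r// subr_ge0 ltW.
by rewrite max_l// subr_le0.
Qed.

Lemma cL2_citv (a b : R) : cL2 (citv a b).
Proof.
have L : (\1_`[a, b] : R -> R) \in Lfun mu 2%:E by apply: Lfun2_indic => //; exact: itv_fin.
by split; [exact: L|exact: (Lfun_submod_closed mu (lee1n 2)).1].
Qed.

Lemma rip_citv (a b c d : R) :
  rip (citv a b) (citv c d) = Num.max 0 (Num.min b d - Num.max a c).
Proof.
rewrite -Rintegral_indic_itv; apply: eq_Rintegral => t _.
by rewrite /citv !cpartE mulr0 addr0 indic_itvM.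
Qed.

Lemma citv_ge (a b : R) : b < a -> citv a b = fun=> 0.
Proof.
move=> ba; apply/funext => t; rewrite /citv set_itv_ge ?indic0//.
by rewrite bnd_simp -ltNge.
Qed.

Lemma rip0l (g : R -> C) : rip (fun=> 0) g = 0.
Proof.
rewrite /rip; under eq_Rintegral do rewrite /= !mul0r addr0.
by rewrite Rintegral_cst// mul0r.
Qed.

(** The Fejer integrals give (|b - c| + |a - d| - |b - d| - |a - c|) / 2, which is the length of the
    intersection of the two intervals. *)
Lemma rip_eitv (a b c d : R) : rip (eitv a b) (eitv c d) = rip (citv a b) (citv c d).
Proof.
have [ab|ba] := leP a b; last first.
  rewrite citv_ge// (_ : eitv a b = fun=> 0) ?rip0l//.
  by apply/funext => w; rewrite eitv_ge.
have [cd|dc] := leP c d; last first.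
  rewrite ripC [RHS]ripC citv_ge// (_ : eitv c d = fun=> 0) ?rip0l//.
  by apply/funext => w; rewrite eitv_ge.
rewrite rip_citv.
pose h w := (2 * pi)^-1 * (fejer (b - c) w + fejer (a - d) w - fejer (b - d) w - fejer (a - c) w).
have fi := fejer_integrable.
have i1 : mu.-integrable setT (EFin \o (fun w => fejer (b - c) w + fejer (a - d) w)).
  by rewrite (_ : _ \o _ = fun w => ((fejer (b - c) w)%:E + (fejer (a - d) w)%:E)%E)//; apply: integrableD => //; exact: fi.
have i2 : mu.-integrable setT (EFin \o (fun w => fejer (b - c) w + fejer (a - d) w - fejer (b - d) w)).
  rewrite (_ : _ \o _ = fun w => ((fejer (b - c) w + fejer (a - d) w)%:E - (fejer (b - d) w)%:E)%E)//; by apply: integrableB => //; exact: fi.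
have i3 : mu.-integrable setT (EFin \o (fun w => fejer (b - c) w + fejer (a - d) w - fejer (b - d) w - fejer (a - c) w)).
  rewrite (_ : _ \o _ = fun w => ((fejer (b - c) w + fejer (a - d) w - fejer (b - d) w)%:E - (fejer (a - c) w)%:E)%E)//; by apply: integrableB => //; exact: fi.
have -> : rip (eitv a b) (eitv c d) = \int[mu]_w h w.
  rewrite /rip /Rintegral; congr fine; apply: ae_eq_integral => //.
  - exact: measurable_int (rip_integrable _ _ (cL2_eitv a b) (cL2_eitv c d)).
  - apply/measurable_EFinP; apply: measurable_funM => //.
    by apply/measurable_EFinP; exact: measurable_int i3.
  - by apply: ae_sub (ae_neq 0) => w w0 _; rewrite rip_eitv_fejer.
rewrite RintegralZl// RintegralB// RintegralB// RintegralD// !Rintegral_fejer.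
rewrite -!mulrDr -!mulrBr mulrA (_ : (2 * pi)^-1 * pi = 2^-1); last first.
  have pi0 : pi != 0 :> R by rewrite gt_eqF ?pi_gt0.
  by rewrite invfM -mulrA mulVf ?mulr1.
have [cb|bc] := leP c b; have [ad|da] := leP a d.
- rewrite (ger0_norm (_ : 0 <= b - c)) ?subr_ge0// (ler0_norm (_ : a - d <= 0)) ?subr_le0//.
  rewrite max_r; last by rewrite subr_ge0 ge_max !le_min ab ad cb cd.
  by rewrite minr_absE maxr_absE; field.
- have ca := le_trans cd (ltW da); have db := le_trans (ltW da) ab.
  rewrite (min_idPr db) (max_idPl ca) max_l ?subr_le0 ?(ltW da)//.
  by rewrite !ger0_norm ?subr_ge0 ?(ltW da)//; ring.
- have bd := le_trans (ltW bc) cd; have ac := le_trans ab (ltW bc).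
  rewrite (min_idPl bd) (max_idPr ac) max_l ?subr_le0 ?(ltW bc)//.
  by rewrite !ler0_norm ?subr_le0 ?(ltW bc)//; ring.
- by have := lt_trans (le_lt_trans ab bc) (le_lt_trans cd da); rewrite ltxx.
Qed.

(** The transform of a real function takes conjugate values at [w] and [- w], so the integrand is
    odd. *)
Lemma rip_eitv_i (a b c d : R) : rip (eitv a b) (fun w => 'i * eitv c d w) = 0.
Proof.
apply: Rintegral_odd; first exact: rip_integrable (cL2_eitv a b) (cL2Z _ _ (cL2_eitv c d)).
by move=> w; rewrite !eitvN; move: (eitv a b w) (eitv c d w) => x y; rewrite !cpartE; ring.
Qed.

Lemma rip_citv_i (a b c d : R) : rip (citv a b) (fun w => 'i * citv c d w) = 0.
Proof.
transitivity (\int[mu]_t (0 : R)); last by rewrite Rintegral_cst// mul0r.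
by apply: eq_Rintegral => t _; rewrite /citv !cpartE; ring.
Qed.

End IntervalFourier.

(** * The Fourier transform as a closed isometric relation *)

Section FourierRelation.
Context {R : realType}.
Local Notation C := R[i].
Local Notation mu := (@lebesgue_measure R).
Local Notation Re := (@complex.Re R).
Local Notation Im := (@complex.Im R).
Implicit Types (f g h w z : R -> C).

Definition cip f g : C := cintegral setT (fun t => f t * ((g t)^*)%C).

Lemma Re_cip f g : Re (cip f g) = rip f g.
Proof. by apply: eq_Rintegral => t _; rewrite !cpartE; ring. Qed.

Lemma Im_cip f g : Im (cip f g) = rip f (fun t => 'i * g t).
Proof. by apply: eq_Rintegral => t _; rewrite !cpartE; ring. Qed.

Lemma cipC f g : cL2 f -> cL2 g -> cip g f = ((cip f g)^*)%C.
Proof.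
move=> Lf Lg; apply: ceqP; rewrite cpartE; first by rewrite !Re_cip ripC.
rewrite !Im_cip -ripNl; [|exact: Lf|exact: cL2Z].
by apply: eq_Rintegral => t _; rewrite !cpartE; ring.
Qed.

Lemma cipDl f g h : cL2 f -> cL2 g -> cL2 h ->
  cip (fun t => f t + g t) h = cip f h + cip g h.
Proof.
move=> Lf Lg Lh; have Lih := cL2Z 'i _ Lh.
by apply: ceqP; rewrite cpartE ?Re_cip ?Im_cip ripDl.
Qed.

Lemma cipZl (c : C) f h : cL2 f -> cL2 h -> cip (fun t => c * f t) h = c * cip f h.
Proof.
move=> Lf Lh; have Lih := cL2Z 'i _ Lh; have Lif := cL2Z 'i _ Lf.
have E k : cL2 k -> rip (fun t => c * f t) k = Re c * rip f k + Im c * rip (fun t => 'i * f t) k.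
  move=> Lk; rewrite -!ripZl// -ripDl//; try exact: cL2Z.
  by apply: eq_Rintegral => t _; rewrite !cpartE; ring.
have E1 k : rip (fun t => 'i * f t) (fun t => 'i * k t) = rip f k.
  by apply: eq_Rintegral => t _; rewrite !cpartE; ring.
have E2 k : cL2 k -> rip (fun t => 'i * f t) k = - rip f (fun t => 'i * k t).
  move=> Lk; rewrite -ripNl//; last exact: cL2Z.
  by apply: eq_Rintegral => t _; rewrite !cpartE; ring.
apply: ceqP; rewrite cpartE !Re_cip !Im_cip E//.
  by rewrite E2// mulrN.
by rewrite E1.
Qed.

Lemma cip_lin (c : C) f g h : cL2 f -> cL2 g -> cL2 h ->
  cip (fun t => c * f t + g t) h = c * cip f h + cip g h.
Proof. by move=> Lf Lg Lh; rewrite cipDl//; [rewrite cipZl|exact: cL2Z]. Qed.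

Lemma cip_n2 f : cip f f = (n2 f)%:C.
Proof.
apply: ceqP; first by rewrite Re_cip rippE.
rewrite Im_cip cImC.
transitivity (\int[mu]_t (0 : R)); last by rewrite Rintegral_cst// mul0r.
by apply: eq_Rintegral => t _; rewrite !cpartE; ring.
Qed.

Lemma cvgL2_lin (c : C) (u v : nat -> R -> C) f g :
  (forall n, cL2 (u n)) -> (forall n, cL2 (v n)) -> cL2 f -> cL2 g ->
  cvgL2 u f -> cvgL2 v g ->
  cvgL2 (fun n t => c * u n t + v n t) (fun t => c * f t + g t).
Proof.
move=> Lu Lv Lf Lg uf vg.
have c0 : 2 * (nsq c * n2 (fun t => u n t - f t)) + 2 * n2 (fun t => v n t - g t) @[n --> \oo] --> (0 : R).
  rewrite (_ : 0 = 2 * (nsq c * 0) + 2 * 0); last by rewrite !mulr0 addr0.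
  by apply: cvgD; apply: cvgM; try exact: cvg_cst; last exact: vg;
    apply: cvgM; [exact: cvg_cst|exact: uf].
apply: squeeze_cvgr (cvg_cst 0) c0.
apply: nearW => n; rewrite n2_ge0/=.
rewrite (_ : (fun t => _) = fun t => c * (u n t - f t) + (v n t - g t)); last first.
  by apply/funext => t; ring.
apply: le_trans (n2D_le2 _ _ _ _) _; [|exact: cL2B|].
  by apply: cL2Z; exact: cL2B.
by rewrite n2Z//; exact: cL2B.
Qed.

Lemma cvgL2_unique (u : nat -> R -> C) f g :
  (forall n, cL2 (u n)) -> cL2 f -> cL2 g -> cvgL2 u f -> cvgL2 u g ->
  n2 (fun t => f t - g t) = 0.
Proof.
move=> Lu Lf Lg uf ug.
have := cvgL2_lin (-1) _ _ _ _ Lu Lu Lf Lg uf ug.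
have L0 n : cL2 (fun t => -1 * u n t + u n t) by apply: cL2D => //; exact: cL2Z.
have L1 : cL2 (fun t => -1 * f t + g t) by apply: cL2D => //; exact: cL2Z.
move=> /(n2_cvg _ _ L0 L1).
under eq_fun do under eq_fun do rewrite mulN1r addNr.
have -> : n2 (fun=> (0 : C)) = 0.
  by rewrite -rippE rip0l.
move=> c0; have := cvg_unique (@norm_hausdorff _ R^o) c0 (cvg_cst 0).
move=> H; rewrite -[RHS]H.
by apply: eq_Rintegral => t _; rewrite -nsqN; congr nsq; ring.
Qed.

(** Carries an equality of inner products from approximants to limits. The two pairs of sequences
    are independent, which covers the Plancherel identity, the multiplication formula and the
    definition of weak derivatives alike. *)
Lemma cip_cvg (u v : nat -> R -> C) f g :
  (forall n, cL2 (u n)) -> (forall n, cL2 (v n)) -> cL2 f -> cL2 g ->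
  cvgL2 u f -> cvgL2 v g ->
  forall u' v' f' g' , (forall n, cL2 (u' n)) -> (forall n, cL2 (v' n)) -> cL2 f' -> cL2 g' ->
  cvgL2 u' f' -> cvgL2 v' g' ->
  (forall n, cip (u n) (v n) = cip (u' n) (v' n)) -> cip f g = cip f' g'.
Proof.
move=> Lu Lv Lf Lg uf vg u' v' f' g' Lu' Lv' Lf' Lg' uf' vg' E.
have ci (x : nat -> R -> C) y : (forall n, cL2 (x n)) -> cL2 y -> cvgL2 x y ->
    cvgL2 (fun n t => 'i * x n t) (fun t => 'i * y t).
  move=> Lx Ly xy; rewrite /cvgL2 (_ : (fun n => _) = (fun n => n2 (fun t => x n t - y t)))//.
  apply/funext => n; rewrite (_ : (fun t => _) = fun t => 'i * (x n t - y t)).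
    by rewrite n2Z; [rewrite /nsq cpartE expr0n expr1n add0r mul1r|exact: cL2B].
  by apply/funext => t; rewrite mulrBr.
apply: ceqP; rewrite ?Re_cip ?Im_cip.
  apply: (@cvg_unique _ (@norm_hausdorff _ R^o) _ _ _ _ (rip_cvg _ _ _ _ Lu Lv Lf Lg uf vg)).
  rewrite (_ : (fun n => _) = fun n => rip (u' n) (v' n)); first exact: rip_cvg.
  by apply/funext => n; rewrite -Re_cip E Re_cip.
have Liv n : cL2 (fun t => 'i * v n t) by exact: cL2Z.
have Liv' n : cL2 (fun t => 'i * v' n t) by exact: cL2Z.
apply: (@cvg_unique _ (@norm_hausdorff _ R^o) _ _ _ _ (rip_cvg _ _ _ _ Lu Liv Lf (cL2Z _ _ Lg) uf (ci _ _ Lv Lg vg))).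
rewrite (_ : (fun n => _) = fun n => rip (u' n) (fun t => 'i * v' n t)).
  by apply: rip_cvg => //; [exact: cL2Z|exact: ci].
by apply/funext => n; rewrite -Im_cip E Im_cip.
Qed.

(** The transform on step functions, as a relation: a step function has many representations by
    intervals and none has to be preferred. That the result does not depend on them, up to null
    sets, follows from the isometry. *)
Inductive FT : (R -> C) -> (R -> C) -> Prop :=
| FT_itv a b : FT (citv a b) (eitv a b)
| FT_lin c f w g z : FT f w -> FT g z ->
    FT (fun t => c * f t + g t) (fun t => c * w t + z t).

Lemma FT_cL2 f w : FT f w -> cL2 f /\ cL2 w.
Proof.
elim=> {f w} [a b|c f w g z _ [Lf Lw] _ [Lg Lz]].
  by split; [exact: cL2_citv|exact: cL2_eitv].
by split; apply: cL2D => //; exact: cL2Z.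
Qed.

Lemma FT_cip f w : FT f w -> forall g z, FT g z -> cip w z = cip f g.
Proof.
elim=> {f w} [a b g z|c f w g z FTf IHf FTg IHg f' w' FTf'].
  elim=> {g z} [c d|c f w g z FTf IHf FTg IHg].
    apply: ceqP; rewrite ?Re_cip ?Im_cip; first exact: rip_eitv.
    by rewrite rip_eitv_i rip_citv_i.
  have [Lf Lw] := FT_cL2 _ _ FTf; have [Lg Lz] := FT_cL2 _ _ FTg.
  have Li := cL2_citv a b; have Le := cL2_eitv a b.
  (* The induction on the second pair needs linearity in the second argument, obtained by conjugate
     symmetry. *)
  rewrite cipC//; last by apply: cL2D => //; exact: cL2Z.
  rewrite [RHS]cipC//; last by apply: cL2D => //; exact: cL2Z.
  by rewrite !cip_lin// (cipC (eitv a b) w)// (cipC (eitv a b) z)// (cipC (citv a b) f)// (cipC (citv a b) g)// IHf IHg.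
have [Lf Lw] := FT_cL2 _ _ FTf; have [Lg Lz] := FT_cL2 _ _ FTg.
have [Lf' Lw'] := FT_cL2 _ _ FTf'.
by rewrite !cip_lin// (IHf _ _ FTf') (IHg _ _ FTf').
Qed.

Lemma FT_n2 f w : FT f w -> n2 w = n2 f.
Proof.
by move=> FTf; apply: complexI; rewrite -!cip_n2; exact: FT_cip.
Qed.

(* The Fourier transform on L2, as the closure of its graph on step functions. *)
Definition fourier f w := [/\ cL2 f, cL2 w & exists g z : nat -> R -> C,
  [/\ forall n, FT (g n) (z n), cvgL2 g f & cvgL2 z w]].

Lemma FT_fourier f w : FT f w -> fourier f w.
Proof.
move=> FTf; have [Lf Lw] := FT_cL2 _ _ FTf; split => //.
have c0 h : cvgL2 (fun=> h) h.
  rewrite /cvgL2; under eq_fun do under eq_fun do rewrite subrr.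
  by rewrite -rippE rip0l; exact: cvg_cst.
by exists (fun=> f), (fun=> w).
Qed.

Lemma fourier_lin c f w g z : fourier f w -> fourier g z ->
  fourier (fun t => c * f t + g t) (fun t => c * w t + z t).
Proof.
move=> [Lf Lw [f' [w' [FT1 cf cw]]]] [Lg Lz [g' [z' [FT2 cg cz]]]]; split.
- by apply: cL2D => //; exact: cL2Z.
- by apply: cL2D => //; exact: cL2Z.
have L1 n := FT_cL2 _ _ (FT1 n); have L2 n := FT_cL2 _ _ (FT2 n).
exists (fun n t => c * f' n t + g' n t), (fun n t => c * w' n t + z' n t); split.
- by move=> n; exact: FT_lin.
- by apply: cvgL2_lin => // n; [exact: (L1 n).1|exact: (L2 n).1].
- by apply: cvgL2_lin => // n; [exact: (L1 n).2|exact: (L2 n).2].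
Qed.

Lemma fourier_cip f w g z : fourier f w -> fourier g z -> cip w z = cip f g.
Proof.
move=> [Lf Lw [f' [w' [FT1 cf cw]]]] [Lg Lz [g' [z' [FT2 cg cz]]]].
have L1 n := FT_cL2 _ _ (FT1 n); have L2 n := FT_cL2 _ _ (FT2 n).
apply: (cip_cvg w' z' w z _ _ Lw Lz cw cz f' g' f g) => // n.
- exact: (L1 n).2.
- exact: (L2 n).2.
- exact: (L1 n).1.
- exact: (L2 n).1.
- exact: FT_cip.
Qed.

Lemma fourier_n2 f w : fourier f w -> n2 w = n2 f.
Proof.
by move=> Ff; apply: complexI; rewrite -!cip_n2; exact: fourier_cip.
Qed.

Lemma fourierZ c f w : fourier f w -> fourier (fun t => c * f t) (fun t => c * w t).
Proof.
move=> Ff; have F0 := fourier_lin (-1) _ _ _ _ Ff Ff.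
have := fourier_lin c _ _ _ _ Ff F0.
by under eq_fun do rewrite mulN1r addNr addr0;
  under [X in fourier _ X -> _]eq_fun do rewrite mulN1r addNr addr0.
Qed.

Lemma fourierD f w g z : fourier f w -> fourier g z ->
  fourier (fun t => f t + g t) (fun t => w t + z t).
Proof.
move=> Ff Fg; have := fourier_lin 1 _ _ _ _ Ff Fg.
by under eq_fun do rewrite mul1r; under [X in fourier _ X -> _]eq_fun do rewrite mul1r.
Qed.

Lemma fourierB f w g z : fourier f w -> fourier g z ->
  fourier (fun t => f t - g t) (fun t => w t - z t).
Proof.
move=> Ff Fg; have := fourier_lin (-1) _ _ _ _ Fg Ff.
by under eq_fun do rewrite mulN1r addrC; under [X in fourier _ X -> _]eq_fun do rewrite mulN1r addrC.
Qed.

Lemma fourier_closed f w : cL2 f -> cL2 w ->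
  (forall e : R, 0 < e -> exists g z, [/\ fourier g z,
     n2 (fun t => g t - f t) <= e & n2 (fun t => z t - w t) <= e]) ->
  fourier f w.
Proof.
move=> Lf Lw H; split => //.
have H' (n : nat) : exists gz : (R -> C) * (R -> C), [/\ FT gz.1 gz.2,
    n2 (fun t => gz.1 t - f t) <= n.+1%:R^-1 & n2 (fun t => gz.2 t - w t) <= n.+1%:R^-1].
  (* Two errors of a quarter are combined by [n2D_le2], which doubles each of them. *)
  have e0 : 0 < n.+1%:R^-1 / 4 :> R by rewrite divr_gt0// invr_gt0.
  have [g [z [[Lg Lz [g' [z' [FT1 cg cz]]]] gf zw]]] := H _ e0.
  have /cvgrPdist_le/(_ _ e0)[N1 _ HN1] := cg.
  have /cvgrPdist_le/(_ _ e0)[N2 _ HN2] := cz.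
  pose N := maxn N1 N2; have [Lg' Lz'] := FT_cL2 _ _ (FT1 N).
  have A (h k l : R -> C) : cL2 h -> cL2 k -> cL2 l -> n2 (fun t => k t - l t) <= n.+1%:R^-1 / 4 ->
      `|0 - n2 (fun t => h t - k t)| <= n.+1%:R^-1 / 4 -> n2 (fun t => h t - l t) <= n.+1%:R^-1.
    move=> Lh Lk Ll; rewrite sub0r normrN (ger0_norm (n2_ge0 _)) => kl hk.
    rewrite (_ : (fun t => _) = fun t => (h t - k t) + (k t - l t)); last first.
      by apply/funext => t; rewrite addrA subrK.
    apply: le_trans (n2D_le2 _ _ (cL2B _ _ Lh Lk) (cL2B _ _ Lk Ll)) _.
    move: hk kl; move: (n2 _) (n2 _) (n.+1%:R^-1) => x y q; lra.
  exists (g' N, z' N); split => /=; first exact: FT1.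
    by apply: A Lg' Lg Lf gf _; apply: HN1; exact: leq_maxl.
  by apply: A Lz' Lz Lw zw _; apply: HN2; exact: leq_maxr.
have [gz Hgz] := choice H'.
exists (fun n => (gz n).1), (fun n => (gz n).2); split.
- by move=> n; have [] := Hgz n.
- apply: squeeze_cvgr (cvg_cst 0) (@cvg_harmonic R).
  by apply: nearW => n; rewrite n2_ge0; have [] := Hgz n.
- apply: squeeze_cvgr (cvg_cst 0) (@cvg_harmonic R).
  by apply: nearW => n; rewrite n2_ge0; have [] := Hgz n.
Qed.
End FourierRelation.

(** * Existence of the transform and truncated Fourier integrals *)

Section FourierTransform.
Context {R : realType}.
Local Notation C := R[i].
Local Notation mu := (@lebesgue_measure R).
Local Notation Re := (@complex.Re R).
Local Notation Im := (@complex.Im R).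
Implicit Types (f g h w z : R -> C).

Lemma cL2_real (f : R -> R) : f \in Lfun mu 2%:E -> cL2 (fun t => (f t)%:C).
Proof. by move=> Lf; split; [exact: Lf|exact: (Lfun_submod_closed mu (lee1n 2)).1]. Qed.

Lemma cL2_ind (P : (R -> C) -> Prop) : (forall a b, P (citv a b)) ->
  (forall c f g, P f -> P g -> P (fun t => c * f t + g t)) ->
  (forall f, cL2 f -> (forall e : R, 0 < e -> exists g,
     [/\ P g, cL2 g & n2 (fun t => g t - f t) <= e]) -> P f) ->
  forall f, cL2 f -> P f.
Proof.
move=> Pi Pl Pc f [f1 f2].
pose Q (f : R -> R) := P (fun t => (f t)%:C).
have Qall : forall f : R -> R, f \in Lfun mu 2%:E -> Q f.
  apply: Lfun2_ind.
  - by move=> a b _; exact: Pi.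
  - move=> c g h Qg Qh; rewrite /Q.
    by under eq_fun do rewrite rmorphD rmorphM; exact: Pl.
  - move=> g Lg H; apply: Pc; first exact: cL2_real.
    move=> e e0; have [h [Qh Lh gh]] := H e e0.
    exists (fun t => (h t)%:C); split => //; first exact: cL2_real.
    rewrite -lee_fin n2_EFin; last by apply: cL2B; exact: cL2_real.
    apply: le_trans gh; rewrite le_eqVlt; apply/orP; left; apply/eqP.
    by apply: eq_integral => t _; rewrite -rmorphB nsqC -sqrrN opprB.
have := Pl 'i _ _ (Qall _ f2) (Qall _ f1).
congr P; apply/funext => t; apply: ceqP; rewrite !cpartE /=; ring.
Qed.

(** Images of a convergent sequence under an isometry form a Cauchy sequence. The isometry is a
    relation [Q] so that the lemma applies both to [fourier] and to its converse. *)
Lemma isometry_extends (Q : (R -> C) -> (R -> C) -> Prop) f :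
  (forall g z, Q g z -> [/\ cL2 g, cL2 z & n2 z = n2 g]) ->
  (forall g z g' z', Q g z -> Q g' z' -> Q (fun t => g t - g' t) (fun t => z t - z' t)) ->
  cL2 f -> (forall e : R, 0 < e -> exists g z, Q g z /\ n2 (fun t => g t - f t) <= e) ->
  exists2 w, cL2 w & forall e : R, 0 < e -> exists g z,
    [/\ Q g z, n2 (fun t => g t - f t) <= e & n2 (fun t => z t - w t) <= e].
Proof.
move=> QL QB Lf H.
have H' (n : nat) : exists gz : (R -> C) * (R -> C), Q gz.1 gz.2 /\
    n2 (fun t => gz.1 t - f t) <= n.+1%:R^-1.
  have [g [z Qgz]] := H n.+1%:R^-1 ltac:(by rewrite invr_gt0).
  by exists (g, z).
have {H'}[gz Hgz] := choice H'.
have L1 n : cL2 (gz n).1 by have [] := QL _ _ (Hgz n).1.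
have L2 n : cL2 (gz n).2 by have [] := QL _ _ (Hgz n).1.
have small e : 0 < e -> exists N, forall n, (N <= n)%N -> n.+1%:R^-1 <= e :> R.
  move=> e0; have /cvgrPdist_le/(_ _ e0)[N _ HN] := @cvg_harmonic R.
  by exists N => n /HN; rewrite /= sub0r normrN ger0_norm.
have [|w Lw cw] := cL2_complete (fun n => (gz n).2) L2.
  move=> e e0; have [N HN] := small (e / 4) ltac:(by rewrite divr_gt0).
  exists N => m n Nm Nn; have [_ _ ->] := QL _ _ (QB _ _ _ _ (Hgz m).1 (Hgz n).1).
  rewrite (_ : (fun t => _) = fun t => ((gz m).1 t - f t) - ((gz n).1 t - f t)); last first.
    by apply/funext => t; rewrite opprB addrA subrK.
  have La := cL2B _ _ (L1 m) Lf; have Lb := cL2B _ _ (L1 n) Lf.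
  apply: le_trans (n2D_le2 _ _ La (cL2N _ Lb)) _.
  have -> : n2 (fun t => - ((gz n).1 t - f t)) = n2 (fun t => (gz n).1 t - f t).
    by apply: eq_Rintegral => t _; rewrite nsqN.
  have := le_trans (Hgz m).2 (HN _ Nm); have := le_trans (Hgz n).2 (HN _ Nn).
  move: (n2 _) (n2 _) => x y; lra.
exists w => // e e0; have [N HN] := small e e0.
have /cvgrPdist_le/(_ _ e0)[M _ HM] := cw.
pose n := maxn N M; exists (gz n).1, (gz n).2; split; first exact: (Hgz n).1.
  by apply: le_trans (Hgz n).2 (HN _ _); exact: leq_maxl.
by have := HM n (leq_maxr _ _); rewrite /= sub0r normrN ger0_norm// n2_ge0.
Qed.

Lemma fourier_exists f : cL2 f -> exists w, fourier f w.
Proof.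
move: f; apply: cL2_ind.
- by move=> a b; exists (eitv a b); apply: FT_fourier; exact: FT_itv.
- by move=> c f g [w Fw] [z Fz]; exists (fun t => c * w t + z t); exact: fourier_lin.
- move=> f Lf H; have [] := isometry_extends fourier f _ _ Lf _.
  + by move=> g z Fgz; have [Lg Lz _] := Fgz; split => //; exact: fourier_n2.
  + by move=> g z g' z'; exact: fourierB.
  + by move=> e e0; have [g [[z Fgz] _ gf]] := H e e0; exists g, z.
  + by move=> w Lw Hw; exists w; exact: fourier_closed.
Qed.

Lemma fourier_unique f w w' : fourier f w -> fourier f w' -> {ae mu, forall t, w t = w' t}.
Proof.
move=> F1 F2; have F := fourierB _ _ _ _ F1 F2.
have [_ Lw _] := F.
have := fourier_n2 _ _ F; under [fun t => f t - f t]eq_fun do rewrite subrr.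
rewrite -[n2 (fun=> 0)]rippE rip0l => /(n2_eq0 _ Lw).
by apply: ae_sub => t /eqP; rewrite subr_eq0 => /eqP.
Qed.

Lemma fourier_ae f w f' w' : fourier f w -> cL2 f' -> cL2 w' ->
  {ae mu, forall t, f t = f' t} -> {ae mu, forall t, w t = w' t} -> fourier f' w'.
Proof.
move=> Ff Lf' Lw' ff' ww'; have [Lf Lw _] := Ff.
apply: fourier_closed => // e e0; exists f, w.
have A h h' : cL2 h -> cL2 h' -> {ae mu, forall t, h t = h' t} -> n2 (fun t => h t - h' t) <= e.
  move=> Lh Lh' hh'; rewrite (eq_n2 _ (fun=> 0)).
  - by rewrite -rippE rip0l ltW.
  - exact: cL2B.
  - exact: cL2_0.
  - by apply: ae_sub hh' => t ->; rewrite subrr.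
by split => //; exact: A.
Qed.

(** [cip] conjugates its second argument, hence the positive exponent. Over a bounded interval this
    kernel is in L2, so the Fourier integral at a fixed frequency is continuous for L2
    convergence. *)
Definition ekern (D : set R) (w : R) : R -> C := fun t => cexpi (w * t) * (\1_D t)%:C.

Lemma nsq_cexpi (x : R) : nsq (cexpi x) = 1.
Proof. by rewrite /nsq /cexpi/= cos2Dsin2. Qed.

Lemma cmeas_cexpi (w : R) : cmeas (fun t => cexpi (w * t)).
Proof.
by split; apply: continuous_measurable_fun; [exact: continuous_cosM|exact: continuous_sinM].
Qed.

Lemma cL2_ekern (a b w : R) : cL2 (ekern `[a, b] w).
Proof.
apply: (cL2_dom _ (citv a b) 1); first exact: cL2_citv.
  by apply: cmeasM; [exact: cmeas_cexpi|apply: cmeas_real; exact: measurable_indic].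
by move=> t; rewrite nsqM nsq_cexpi.
Qed.

Lemma cintegral_mul_indic (D : set R) (g : R -> C) :
  cintegral setT (fun t => g t * (\1_D t)%:C) = cintegral D g.
Proof.
rewrite /cintegral; congr (_ +i* _); rewrite -[RHS]Rintegral_mul_indic;
  by apply: eq_Rintegral => t _; rewrite !cpartE; ring.
Qed.

Lemma fintE (D : set R) (g : R -> C) (w : R) :
  fint D g w = fconst%:C * cip g (ekern D w).
Proof.
rewrite /fint -cintegral_mul_indic /cip; congr (_ * cintegral _ _).
apply/funext => t; rewrite /ekern /cexpi cosN sinN.
by apply: ceqP; rewrite !cpartE /=; ring.
Qed.

Lemma Re_fint (a b : R) f (w : R) :
  Re (fint `[a, b] f w) = fconst * rip f (ekern `[a, b] w).
Proof. by rewrite fintE cReM Re_cip cReC cImC mul0r subr0. Qed.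

Lemma Im_fint (a b : R) f (w : R) :
  Im (fint `[a, b] f w) = fconst * rip f (fun t => 'i * ekern `[a, b] w t).
Proof. by rewrite fintE cImM Im_cip cReC cImC mul0r addr0. Qed.

Lemma fint_lin (a b : R) c f g (w : R) : cL2 f -> cL2 g ->
  fint `[a, b] (fun t => c * f t + g t) w = c * fint `[a, b] f w + fint `[a, b] g w.
Proof.
move=> Lf Lg; rewrite !fintE cip_lin//; last exact: cL2_ekern.
by rewrite mulrDr mulrCA.
Qed.

Definition ccut (a b : R) f : R -> C := fun t => f t * citv a b t.

Lemma cL2_ccut (a b : R) f : cL2 f -> cL2 (ccut a b f).
Proof.
move=> Lf; apply: (cL2_dom _ f 1) => //.
  by apply: cmeasM; [exact: cL2_meas|apply: cmeas_real; exact: measurable_indic].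
move=> t; rewrite mul1r nsqM ler_piMr ?nsq_ge0// nsqC indicE.
by case: (_ \in _); rewrite ?expr1n ?expr0n.
Qed.

Lemma n2_ccut (a b : R) f : cL2 f -> n2 (ccut a b f) <= n2 f.
Proof.
move=> Lf; apply: le_Rintegral => //; try by apply: nsq_integrable; rewrite //; exact: cL2_ccut.
move=> t _; rewrite nsqM ler_piMr ?nsq_ge0// nsqC indicE.
by case: (_ \in _); rewrite ?expr1n ?expr0n.
Qed.

(** Cutting the indicator of an interval intersects two intervals, so step functions stay step
    functions. *)
Lemma FT_ccut (a b : R) f w : FT f w -> FT (ccut a b f) (fint `[a, b] f).
Proof.
elim=> {f w} [c d|c f w g z FTf IHf FTg IHg].
  have -> : ccut a b (citv c d) = citv (Num.max c a) (Num.min d b).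
    by apply/funext => t; rewrite /ccut /citv -rmorphM indic_itvM.
  have -> : fint `[a, b] (citv c d) = eitv (Num.max c a) (Num.min d b); last exact: FT_itv.
  apply/funext => t; rewrite /eitv /fint -cintegral_mul_indic; congr (_ * cintegral _ _).
  by apply/funext => s; rewrite -mulrA -rmorphM indic_itvM.
have [Lf _] := FT_cL2 _ _ FTf; have [Lg _] := FT_cL2 _ _ FTg.
have -> : ccut a b (fun t => c * f t + g t) = fun t => c * ccut a b f t + ccut a b g t.
  by apply/funext => t; rewrite /ccut mulrDl mulrA.
have -> : fint `[a, b] (fun t => c * f t + g t) = fun t => c * fint `[a, b] f t + fint `[a, b] g t.
  by apply/funext => t; exact: fint_lin.
exact: FT_lin.
Qed.

Lemma cvgL2_ccut (a b : R) (u : nat -> R -> C) f : (forall n, cL2 (u n)) -> cL2 f ->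
  cvgL2 u f -> cvgL2 (fun n => ccut a b (u n)) (ccut a b f).
Proof.
move=> Lu Lf uf; apply: squeeze_cvgr (cvg_cst 0) uf; apply: nearW => n.
rewrite n2_ge0/= (_ : (fun t => _) = ccut a b (fun t => u n t - f t)); last first.
  by apply/funext => t; rewrite /ccut mulrBl.
by apply: n2_ccut; exact: cL2B.
Qed.

Lemma cvg_fint (a b : R) (u : nat -> R -> C) f (w : R) : (forall n, cL2 (u n)) -> cL2 f ->
  cvgL2 u f ->
  Re (fint `[a, b] (u n) w) @[n --> \oo] --> Re (fint `[a, b] f w) /\
  Im (fint `[a, b] (u n) w) @[n --> \oo] --> Im (fint `[a, b] f w).
Proof.
move=> Lu Lf uf; have c0 h : cvgL2 (fun=> h) h.
  rewrite /cvgL2; under eq_fun do under eq_fun do rewrite subrr.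
  by rewrite -rippE rip0l; exact: cvg_cst.
have Le := cL2_ekern a b w; have Lie := cL2Z 'i _ Le.
split; under eq_fun do rewrite ?Re_fint ?Im_fint; rewrite ?Re_fint ?Im_fint;
  by apply: cvgM; [exact: cvg_cst|apply: rip_cvg].
Qed.

(* The pointwise limit of the transforms of step functions is also their limit
   in L2, by Fatou's lemma. *)
Lemma fourier_ccut (a b : R) f : cL2 f -> fourier (ccut a b f) (fint `[a, b] f).
Proof.
move=> Lf; have [w [_ _ [g [z [FTg cg _]]]]] := fourier_exists _ Lf.
have Lg n : cL2 (g n) by have [] := FT_cL2 _ _ (FTg n).
have Fc n : fourier (ccut a b (g n)) (fint `[a, b] (g n)).
  by apply: FT_fourier; apply: FT_ccut; exact: FTg.
have [w1 Fw1] := fourier_exists _ (cL2_ccut a b _ Lf).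
have [_ Lw1 _] := Fw1.
have Lc n : cL2 (fint `[a, b] (g n)) by have [] := Fc n.
have cz : n2 (fun t => fint `[a, b] (g n) t - w1 t) @[n --> \oo] --> (0 : R).
  rewrite (_ : (fun n => _) = fun n => n2 (fun t => ccut a b (g n) t - ccut a b f t)).
    exact: cvgL2_ccut.
  by apply/funext => n; apply: fourier_n2; exact: fourierB.
have mf : cmeas (fint `[a, b] f).
  have mL n := cL2_meas _ (Lc n).
  by split; [apply: (@measurable_fun_cvg _ _ _ _ (fun n => Re \o fint `[a, b] (g n)))
            |apply: (@measurable_fun_cvg _ _ _ _ (fun n => Im \o fint `[a, b] (g n)))];
    try (by move=> n; have [] := mL n); move=> t _; have [] := cvg_fint a b g f t Lg Lf cg.
have md : cmeas (fun t => fint `[a, b] f t - w1 t) by apply: cmeasB => //; exact: cL2_meas.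
have E2 e : 0 < e -> (\int[mu]_t (nsq (fint `[a, b] f t - w1 t))%:E <= e%:E)%E.
  move=> e0; have /cvgrPdist_le/(_ _ e0)[N _ HN] := cz.
  apply: (@ge0_integral_le_cvg _ _ _ mu (fun n t => (nsq (fint `[a, b] (g (n + N)%N) t - w1 t))%:E)).
  - move=> n; apply/measurable_EFinP; apply: measurable_nsq; apply: cmeasB; exact: cL2_meas.
  - by move=> n t; rewrite lee_fin nsq_ge0.
  - move=> t; apply: cvg_EFin; first exact: nearW.
    have [c1 c2] := cvg_fint a b g f t Lg Lf cg.
    rewrite -(cvg_shiftn N) in c1; rewrite -(cvg_shiftn N) in c2.
    have d1 : Re (fint `[a, b] (g (n + N)%N) t) - Re (w1 t) @[n --> \oo] -->
       Re (fint `[a, b] f t) - Re (w1 t) by apply: cvgB => //; exact: cvg_cst.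
    have d2 : Im (fint `[a, b] (g (n + N)%N) t) - Im (w1 t) @[n --> \oo] -->
       Im (fint `[a, b] f t) - Im (w1 t) by apply: cvgB => //; exact: cvg_cst.
    have nE (x y : C) : nsq (x - y) = (Re x - Re y) * (Re x - Re y) + (Im x - Im y) * (Im x - Im y).
      by rewrite /nsq !cpartE !expr2.
    rewrite nE; under eq_fun do rewrite /= nE.
    by apply: cvgD; apply: cvgM.
  - move=> n; rewrite -n2_EFin; last exact: cL2B.
    rewrite lee_fin; have := HN (n + N)%N (leq_addl _ _).
    by rewrite /= sub0r normrN ger0_norm// n2_ge0.
have Ld : cL2 (fun t => fint `[a, b] f t - w1 t).
  by apply/cL2P; split => //; apply: (le_lt_trans (E2 1 ltr01)); exact: ltry.
have LF : cL2 (fint `[a, b] f).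
  by have := cL2D _ _ Ld Lw1; under eq_fun do rewrite subrK.
apply: fourier_ae Fw1 _ LF _ _; [exact: cL2_ccut|exact: aeW|].
have d0 : n2 (fun t => fint `[a, b] f t - w1 t) = 0.
  apply/eqP; rewrite eq_le n2_ge0 andbT; apply/ler_addgt0Pl => e e0.
  by rewrite addr0 -lee_fin n2_EFin// E2.
by apply: ae_sub (n2_eq0 _ Ld d0) => t /eqP; rewrite subr_eq0 => /eqP.
Qed.
End FourierTransform.

(** * Surjectivity and agreement with truncated integrals *)

Section FourierInversion.
Context {R : realType}.
Local Notation C := R[i].
Local Notation mu := (@lebesgue_measure R).
Local Notation Re := (@complex.Re R).
Local Notation Im := (@complex.Im R).
Implicit Types (f g h w z : R -> C).

Lemma Rintegral_swap_itv (k : R -> R) (a b c d : R) : continuous k -> (forall x, `|k x| <= 1) ->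
  \int[mu]_(w in `[c, d]) (\int[mu]_(t in `[a, b]) k (w * t)) =
  \int[mu]_(t in `[a, b]) (\int[mu]_(w in `[c, d]) k (t * w)).
Proof.
move=> ck k1.
pose f (z : R * R) := (k (z.1 * z.2) * \1_`[a, b] z.2 * \1_`[c, d] z.1)%:E.
have mf : measurable_fun setT f.
  apply/measurable_EFinP; apply: measurable_funM; last first.
    by apply: measurableT_comp => //; exact: measurable_indic.
  apply: measurable_funM; last by apply: measurableT_comp => //; exact: measurable_indic.
  by apply: (measurableT_comp (continuous_measurable_fun ck)); exact: measurable_funM.
have ki (w a' b' : R) : mu.-integrable `[a', b'] (EFin \o (fun t => k (w * t))).
  apply: continuous_itv_integrable => x; apply: (@continuous_comp _ _ _ (fun t => w * t) k); last exact: ck.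
  by apply: cvgM; [exact: cvg_cst|exact: cvg_id].
have int_E (D : set R) (g : R -> R) : measurable D -> mu.-integrable D (EFin \o g) ->
    (\int[mu]_x (g x * \1_D x)%:E = (\int[mu]_(x in D) g x)%:E)%E.
  by move=> mD ig; rewrite integral_mul_indic /Rintegral fineK//; exact: integrable_fin_num.
have fi : (mu \x mu)%E.-integrable setT f.
  have mAB : measurable (`[c, d]%classic `*` `[a, b]%classic : set (R * R)).
    by apply: measurableX; exact: measurable_itv.
  apply/integrableP; split => //.
  apply: (@le_lt_trans _ _ (\int[(mu \x mu)%E]_z (\1_(`[c, d]%classic `*` `[a, b]%classic : set (R * R)) z)%:E)%E).
    apply: ge0_le_integral => //; try exact: measurableT_comp.
    move=> [x y] _; rewrite /f/= lee_fin !normrM !indicE.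
    rewrite (_ : ((x, y) \in _) = (y \in `[a, b]%classic) && (x \in `[c, d]%classic)); last first.
      by rewrite in_setX/= andbC.
    by case: (_ \in _); case: (_ \in _); rewrite ?normr1 ?normr0 ?mulr1 ?mulr0 ?mul0r.
  rewrite integral_indic// setIT.
  rewrite [ltLHS](_ : _ = (mu \x mu)%E (`[c, d]%classic `*` `[a, b]%classic : set (R * R)))//.
  by rewrite product_measure1E//; apply: lte_mul_pinfty => //; rewrite ?ge0_fin_numE//; exact: itv_fin.
have := Fubini fi; rewrite /f/=.
rewrite [X in X = _ -> _](_ : _ = (\int[mu]_w ((\int[mu]_(t in `[a, b]) k (w * t)) * \1_`[c, d] w)%:E)%E); last first.
  apply: eq_integral => w _; rewrite EFinM -int_E//.
  rewrite indicE; case: (_ \in _); rewrite ?mule1 ?mule0.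
    by under eq_integral do rewrite mulr1.
  by under eq_integral do rewrite mulr0; rewrite integral0.
rewrite [X in _ = X -> _](_ : _ = (\int[mu]_t ((\int[mu]_(w in `[c, d]) k (t * w)) * \1_`[a, b] t)%:E)%E); last first.
  apply: eq_integral => w _; rewrite EFinM -int_E//.
  rewrite indicE; case: (_ \in _); rewrite ?mule1 ?mule0.
    by apply: eq_integral => x _; rewrite mulr1 [x * w]mulrC.
  by under eq_integral do rewrite mulr0 mul0r; rewrite integral0.
by rewrite !integral_mul_indic /Rintegral => ->.
Qed.

(** The multiplication formula for intervals: the kernel depends on the product of time and
    frequency only, so Fubini exchanges their roles. The conjugate on the right undoes the one in
    [cip]. *)
Lemma fourier_eitv_cip (a b c d : R) :
  cip (eitv a b) (citv c d) = cip (citv a b) (fun t => ((eitv c d t)^*)%C).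
Proof.
have E (x y : R) (h : R -> C) : cintegral setT (fun t => h t * (citv x y t)) = cintegral `[x, y] h.
  exact: cintegral_mul_indic.
have -> : cip (eitv a b) (citv c d) = cintegral `[c, d] (eitv a b).
  rewrite -E /cip; congr cintegral; apply/funext => t; congr (_ * _).
  by rewrite /citv conjc_real.
have -> : cip (citv a b) (fun t => ((eitv c d t)^*)%C) = cintegral `[a, b] (eitv c d).
  rewrite -E /cip; congr cintegral; apply/funext => t.
  by rewrite conjcK mulrC.
have ii (h : R -> R) x y : h \in Lfun mu 2%:E -> mu.-integrable `[x, y] (EFin \o h).
  move=> Lh; have mI : measurable (`[x, y]%classic : set (measurableTypeR R)) by exact: measurable_itv.
  apply: (@integrable_mkcond _ _ _ mu _ (EFin \o h) mI).2.
  have := Lfun2_integrableM _ _ Lh (Lfun2_indic _ (measurable_itv `[x, y]) (itv_fin x y)).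
  congr (_.-integrable _ _); apply/funext => t; rewrite /patch indicE.
  by case: ifP => _; rewrite ?mulr1 ?mulr0.
have f0 : fconst^-1 != 0 :> R.
  by rewrite invr_eq0 invr_eq0 gt_eqF// sqrtr_gt0 mulr_gt0// pi_gt0.
have fV (x : R) : fconst^-1 * (fconst * x) = x.
  by rewrite mulKf//; rewrite invr_eq0 in f0.
have iR := ii _ _ _ (cL2_Re _ (cL2_eitv _ _)); have iI := ii _ _ _ (cL2_Im _ (cL2_eitv _ _)).
have key (x y : R) : fconst^-1 * x = fconst^-1 * y -> x = y by move/(mulfI f0).
have P1 : \int[mu]_(w in `[c, d]) Re (eitv a b w) = \int[mu]_(w in `[a, b]) Re (eitv c d w).
  apply: key; transitivity (\int[mu]_(w in `[c, d]) (fconst^-1 * Re (eitv a b w))).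
    by symmetry; apply: RintegralZl.
  transitivity (\int[mu]_(w in `[a, b]) (fconst^-1 * Re (eitv c d w))); last exact: RintegralZl.
  transitivity (\int[mu]_(w in `[c, d]) \int[mu]_(t in `[a, b]) cos (w * t)).
    by apply: eq_Rintegral => w _; rewrite eitvE/= fV.
  rewrite Rintegral_swap_itv; [|exact: continuous_cos|].
    by apply: eq_Rintegral => w _; rewrite eitvE/= fV.
  by move=> x; rewrite ler_norml cos_geN1 cos_le1.
have P2 : \int[mu]_(w in `[c, d]) Im (eitv a b w) = \int[mu]_(w in `[a, b]) Im (eitv c d w).
  apply: key; transitivity (\int[mu]_(w in `[c, d]) (fconst^-1 * Im (eitv a b w))).
    by symmetry; apply: RintegralZl.
  transitivity (\int[mu]_(w in `[a, b]) (fconst^-1 * Im (eitv c d w))); last exact: RintegralZl.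
  have sN (x y s : R) : \int[mu]_(t in `[x, y]) (- sin (s * t)) = - \int[mu]_(t in `[x, y]) sin (s * t).
    transitivity (\int[mu]_(t in `[x, y]) (-1 * sin (s * t))).
      by apply: eq_Rintegral => t _; rewrite mulN1r.
    rewrite -[RHS]mulN1r; apply: RintegralZl; first exact: measurable_itv.
    exact/continuous_itv_integrable/continuous_sinM.
  transitivity (\int[mu]_(w in `[c, d]) \int[mu]_(t in `[a, b]) (- sin (w * t))).
    by apply: eq_Rintegral => w _; rewrite eitvE/= -mulrN fV sN.
  rewrite (@Rintegral_swap_itv (fun x => - sin x)).
  + by apply: eq_Rintegral => w _; rewrite eitvE/= -mulrN fV sN.
  + by move=> x; apply: cvgN; exact: continuous_sin.
  + by move=> x; rewrite normrN ler_norml sin_geN1 sin_le1.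
by rewrite /cintegral P1 P2.
Qed.

Lemma fourier_cip_citv f w (c d : R) : fourier f w ->
  cip w (citv c d) = cip f (fun t => ((eitv c d t)^*)%C).
Proof.
have Li := cL2_citv c d; have Le := cL2J _ (cL2_eitv c d).
have c0 h : cvgL2 (fun=> h) h.
  rewrite /cvgL2; under eq_fun do under eq_fun do rewrite subrr.
  by rewrite -rippE rip0l; exact: cvg_cst.
have H g z : FT g z -> cip z (citv c d) = cip g (fun t => ((eitv c d t)^*)%C).
  elim=> {g z} [a b|k g z g' z' FTg IH FTg' IH']; first exact: fourier_eitv_cip.
  have [Lg Lz] := FT_cL2 _ _ FTg; have [Lg' Lz'] := FT_cL2 _ _ FTg'.
  by rewrite !cip_lin// IH IH'.
move=> [Lf Lw [g [z [FTg cg cz]]]]; have L n := FT_cL2 _ _ (FTg n).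
apply: (cip_cvg z (fun=> citv c d) w (citv c d) _ _ Lw Li cz (c0 _)
  g (fun n t => ((eitv c d t)^*)%C) f (fun t => ((eitv c d t)^*)%C)) => // n.
- exact: (L n).2.
- exact: (L n).1.
- exact: H.
Qed.

Lemma fourier_surj w : cL2 w -> exists f, fourier f w.
Proof.
move: w; apply: cL2_ind.
(* [h] is the expected inverse transform of the interval. For its transform [z] the multiplication
   formula gives the inner product of [z] with the interval as the squared norm of [h], and [z], [h]
   and the interval have equal norms; hence [z] minus the interval has norm 0. *)
- move=> c d; pose h t := ((eitv c d t)^*)%C.
  have Li := cL2_citv c d; have Le := cL2_eitv c d; have Lh : cL2 h by exact: cL2J.
  have [z Fz] := fourier_exists _ Lh; have [_ Lz _] := Fz.
  have nh : n2 h = n2 (citv c d).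
    rewrite -(FT_n2 _ _ (FT_itv c d)); by apply: eq_Rintegral => t _; rewrite nsqJ.
  exists h; apply: fourier_closed => // e e0; exists h, z; split => //.
    by under eq_fun do rewrite subrr; rewrite -rippE rip0l ltW.
  rewrite n2B// (fourier_n2 _ _ Fz) -Re_cip (fourier_cip_citv _ _ _ _ Fz) Re_cip rippE nh.
  by rewrite (_ : _ + _ = 0) ?ltW//; ring.
- by move=> c w z [f Ff] [g Fg]; exists (fun t => c * f t + g t); exact: fourier_lin.
- move=> w Lw H; have [] := isometry_extends (fun w f => fourier f w) w _ _ Lw _.
  + by move=> g z Fgz; have [Lg Lz _] := Fgz; split => //; rewrite (fourier_n2 _ _ Fgz).
  + by move=> g z g' z'; exact: fourierB.
  + by move=> e e0; have [g [[z Fgz] _ gf]] := H e e0; exists g, z.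
  + move=> f Lf Hf; exists f; apply: fourier_closed => // e e0.
    by have [g [z [Fzg gw zf]]] := Hf e e0; exists z, g.
Qed.

Lemma cvgL2_ccutT f : cL2 f -> cvgL2 (fun n => ccut (- n%:R) n%:R f) f.
Proof.
move=> Lf; have [f1 f2] := Lf.
have H (g : R -> R) : g \in Lfun mu 2%:E ->
   (\int[mu]_t ((g t - g t * \1_`[- n%:R, n%:R] t) ^+ 2)%:E)%E @[n --> \oo] --> 0%E.
  move=> /[dup] Lg /Lfun2P[mg _].
  have [||| _ _] := Lfun2_dominated_cvg g g (fun n t => g t * \1_`[- n%:R, n%:R] t) Lg => //.
  - by move=> n; apply: measurable_funM => //; exact: measurable_indic.
  - by move=> n t; rewrite normrM ler_piMr// indicE; case: (_ \in _); rewrite ?normr1 ?normr0.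
  - move=> t; apply: cvg_near_cst.
    have [N _ HN] := nbhs_infty_ger `|t|.
    exists N => // n /= /HN/= tn; rewrite indicE mem_set ?mulr1//= in_itv/=.
    by move: tn; rewrite ler_norml.
have := (fun d => cvgeD d (H _ f1) (H _ f2)); rewrite adde0 => /(_ _ isT) c0.
suff : (n2 (fun t => ccut (- n%:R) n%:R f t - f t))%:E @[n --> \oo] --> (0%R%:E : \bar R).
  by move/fine_cvgP => [_].
rewrite (_ : (fun n => _) = fun n : nat =>
  (\int[mu]_t (((Re \o f) t - (Re \o f) t * \1_`[- n%:R, n%:R] t) ^+ 2)%:E +
   \int[mu]_t (((Im \o f) t - (Im \o f) t * \1_`[- n%:R, n%:R] t) ^+ 2)%:E)%E)//.
apply/funext => n.
have Lc := cL2_ccut (- n%:R) n%:R _ Lf.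
rewrite n2_EFin; last exact: cL2B.
have [mf1 mf2] := cL2_meas _ Lf.
have mi (g : R -> R) : measurable_fun setT g ->
    measurable_fun setT (fun t => ((g t - g t * \1_`[- n%:R, n%:R] t) ^+ 2)%:E).
  move=> mg; apply/measurable_EFinP; apply: measurable_funX; apply: measurable_funB => //.
  by apply: measurable_funM => //; exact: measurable_indic.
rewrite -ge0_integralD//; do ?[exact: mi | by move=> t _; rewrite lee_fin sqr_ge0].
apply: eq_integral => t _; rewrite -EFinD; congr EFin.
by rewrite /nsq /ccut /citv !cpartE /=; ring.
Qed.

(** The integral over [-n, n] is the transform of the truncated function, and truncations converge
    in L2; the isometry transfers this convergence. *)
Lemma fourierP f w : cL2 f ->
  fourier f w <-> cL2 w /\ cvgL2 (fun n => fint `[- n%:R, n%:R] f) w.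
Proof.
move=> Lf; have key z : fourier f z -> cvgL2 (fun n => fint `[- n%:R, n%:R] f) z.
  move=> Fz; rewrite /cvgL2 (_ : (fun n => _) = fun n => n2 (fun t => ccut (- n%:R) n%:R f t - f t)).
    exact: cvgL2_ccutT.
  apply/funext => n.
  exact: (fourier_n2 _ _ (fourierB _ _ _ _ (fourier_ccut (- n%:R) n%:R _ Lf) Fz)).
split=> [Ff|[Lw cw]]; first by split; [case: Ff|exact: key].
have [z Fz] := fourier_exists _ Lf; have [_ Lz _] := Fz.
apply: (fourier_ae _ _ _ _ Fz Lf Lw (aeW _ (fun=> erefl))).
have L n : cL2 (fint `[- n%:R, n%:R] f) by have [] := fourier_ccut (- n%:R) n%:R _ Lf.
have := cvgL2_unique _ _ _ L Lz Lw (key _ Fz) cw.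
move=> /(n2_eq0 _ (cL2B _ _ Lz Lw)).
by apply: ae_sub => t /eqP; rewrite subr_eq0 => /eqP.
Qed.
End FourierInversion.

(** * Test functions and weak derivatives *)

Section SmoothFunctions.
Context {R : realType}.
Implicit Types (f g : R -> R).

Definition smooth f := forall (n : nat) (t : R), derivable (derive1n n f) t 1.

Lemma smooth_derivable f : smooth f -> forall t : R, derivable f t 1.
Proof. by move=> sf t; exact: (sf 0%N t). Qed.

Lemma smooth_derive f : smooth f -> smooth (derive1 f).
Proof. by move=> sf n t; rewrite -derive1Sn; exact: sf. Qed.

Lemma smooth_is_derive f : smooth f -> forall t : R, is_derive t 1 f ((derive1 f) t).
Proof. by move=> sf t; rewrite derive1E; apply: derivableP; exact: smooth_derivable. Qed.

(** Coinduction: exhibiting a class of functions closed under differentiation replaces any formula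
    for the n-th derivative. *)
Lemma smooth_coind (K : (R -> R) -> Prop) :
  (forall f, K f -> exists2 f', K f' & forall t : R, is_derive t 1 f (f' t)) ->
  forall f, K f -> smooth f.
Proof.
move=> Kd f Kf n; elim: n f Kf => [|n IH] f /Kd[f' Kf' df] t.
  by rewrite derive1n0; exact: ex_derive.
rewrite derive1Sn (_ : (derive1 f) = f'); first exact: IH.
by apply/funext => x; rewrite derive1E derive_val.
Qed.

Inductive smooth_alg : (R -> R) -> Prop :=
| smooth_alg0 f : smooth f -> smooth_alg f
| smooth_algD f g : smooth_alg f -> smooth_alg g -> smooth_alg (fun t => f t + g t)
| smooth_algM f g : smooth_alg f -> smooth_alg g -> smooth_alg (fun t => f t * g t).

Lemma smoothM f g : smooth f -> smooth g -> smooth (fun t => f t * g t).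
Proof.
move=> sf sg; apply: (@smooth_coind smooth_alg); last by apply: smooth_algM; exact: smooth_alg0.
move=> h; elim=> {h} [h sh|h k ah [h' ah' dh] ak [k' ak' dk]|h k ah [h' ah' dh] ak [k' ak' dk]].
- by exists (derive1 h); [apply: smooth_alg0; exact: smooth_derive|exact: smooth_is_derive].
- by exists (fun t => h' t + k' t); [exact: smooth_algD|move=> t; exact: is_deriveD].
- exists (fun t => h t * k' t + k t * h' t).
    by apply: smooth_algD; exact: smooth_algM.
  by move=> t; exact: is_deriveM.
Qed.

Lemma smooth_affine (a b : R) f : smooth f -> smooth (fun t => f (a * t + b)).
Proof.
move=> sf.
apply: (@smooth_coind (fun h => exists c k, smooth k /\ h = fun t => c * k (a * t + b))); last first.
  by exists 1, f; split => //; apply/funext => t; rewrite mul1r.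
move=> _ [c [k [sk ->]]]; exists (fun t => (c * a) * (derive1 k) (a * t + b)).
  by exists (c * a), (derive1 k); split; [exact: smooth_derive|by []].
move=> t; have dk : is_derive (a * t + b) 1 k ((derive1 k) (a * t + b)) by exact: smooth_is_derive.
have da : is_derive t 1 (fun t => a * t + b) a.
  by apply: is_derive_eq; rewrite /GRing.scale/=; ring.
have dc : is_derive t 1 (fun t => k (a * t + b)) (derive1 k (a * t + b) * a).
  exact: (@is_derive1_comp R k (fun t => a * t + b) t _ _ dk da).
by apply: is_derive_eq; rewrite /GRing.scale/=; ring.
Qed.

(* The functions x^-k exp (-1/x), extended by 0 to x <= 0: their span is closed
   under differentiation. *)
Definition flat (k : nat) (x : R) : R := if 0 < x then x^-1 ^+ k * expR (- x^-1) else 0.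

(** With y = 1/x, this is the bound of exp y from below by y^(k+1) / (k+1)!. As flat k h / h = flat
    (k+1) h, it makes the difference quotient at 0 tend to 0. *)
Lemma flat_le (k : nat) (x : R) : `|flat k x| <= k.+1`!%:R * `|x|.
Proof.
rewrite /flat; case: ifPn => x0; last by rewrite normr0 mulr_ge0.
have y0 : 0 < x^-1 by rewrite invr_gt0.
rewrite (ger0_norm (ltW x0)) ger0_norm; last first.
  by rewrite mulr_ge0 ?expR_ge0 ?exprn_ge0 ?ltW.
rewrite expRN ler_pdivrMr ?expR_gt0//.
have f0 : 0 < k.+1`!%:R :> R by rewrite ltr0n fact_gt0.
have := expR_ge1Dxn k (ltW y0); move/(le_trans (ler_wpDl ler01 (lexx _))).
rewrite ler_pdivrMr// => H; rewrite -(ler_pM2l y0) -exprS (le_trans H)//.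
rewrite mulrA mulrCA mulVf ?gt_eqF// mulr1 mulrC//.
Qed.

Lemma is_derive_flat (k : nat) (x : R) :
  is_derive x 1 (flat k) (- k%:R * flat k.+1 x + flat k.+2 x).
Proof.
have [x0|x0|->] := ltgtP x 0.
- rewrite /flat ltNge (ltW x0)/= mulr0 addr0.
  apply: (@near_eq_is_derive _ _ _ (cst 0)).
  near=> y; rewrite /flat/= ltNge (_ : y <= 0)//; apply: ltW.
  by near: y; exact: lt_nbhsl.
- have E j : flat j x = x^-1 ^+ j * expR (- x^-1) by rewrite /flat x0.
  rewrite !E.
  apply: (@near_eq_is_derive _ _ _ (fun y : R => y^-1 ^+ k * expR (- y^-1))).
    near=> y; rewrite /flat (_ : 0 < y)//.
    by near: y; exact: lt_nbhsr.
  have xn0 : x != 0 by rewrite gt_eqF.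
  have dV : is_derive x 1 (fun y : R => y^-1) (- (x^-1 ^+ 2)).
    have := @is_deriveV R id x 1 1 xn0 (is_derive_id _ _).
    by rewrite /GRing.scale/= mulr1 exprVn.
  have dE : is_derive x 1 (fun y : R => expR (- y^-1)) (expR (- x^-1) * x^-1 ^+ 2).
    have dN : is_derive x 1 (fun y : R => - y^-1) (x^-1 ^+ 2).
      by have := is_deriveN dV; rewrite opprK.
    exact: (@is_derive1_comp R expR (fun y => - y^-1) x _ _ (is_derive_expR _) dN).
  case: k => [|k].
    under eq_fun do rewrite expr0 mul1r.
    by rewrite oppr0 mul0r add0r mulrC.
  have dX : is_derive x 1 (fun y : R => y^-1 ^+ k.+1) (- k.+1%:R * x^-1 ^+ k.+2).
    rewrite (_ : (fun y : R => _) = (fun y => y^-1) ^+ k.+1).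
      apply: (@is_derive_eq _ _ _ _ _ _ _ _ (@is_deriveX R R (fun y => y^-1) k.+1 x 1 _ dV)).
      by rewrite /GRing.scale/= !exprS; ring.
    by apply/funext => y; rewrite fctE.
  apply: (@is_derive_eq _ _ _ _ _ _ _ _ (is_deriveM dX dE)).
  by rewrite /GRing.scale/= !exprS; ring.
- have E j : flat j 0 = 0 by rewrite /flat ltxx.
  rewrite !E mulr0 addr0.
  have c0 : h^-1 *: ((flat k \o shift 0) (h *: 1) - flat k 0) @[h --> 0^'] --> (0 : R).
    rewrite E; apply/cvgrPdist_le => e e0.
    near=> h; rewrite sub0r normrN subr0 /= addr0 /GRing.scale/= mulr1.
    have h0 : h != 0 by near: h; exact: nbhs_dnbhs_neq.
    have -> : h^-1 * flat k h = flat k.+1 h.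
      by rewrite /flat; case: ifP => _; rewrite ?mulr0// exprS mulrA.
    apply: (le_trans (flat_le _ _)); rewrite -ler_pdivlMl ?ltr0n ?fact_gt0//.
    near: h; apply: dnbhs0_le.
    by rewrite mulr_gt0 ?invr_gt0 ?ltr0n ?fact_gt0.
  by apply: DeriveDef; [apply/cvg_ex; exists 0|exact: cvg_lim c0].
Unshelve. all: by end_near. Qed.

Inductive flat_span : (R -> R) -> Prop :=
| flat_span0 k : flat_span (flat k)
| flat_span_lin c f g : flat_span f -> flat_span g -> flat_span (fun t => c * f t + g t).

Lemma smooth_flat (k : nat) : smooth (flat k).
Proof.
apply: (@smooth_coind flat_span); last exact: flat_span0.
move=> f; elim=> {f} [j|c f g af [f' af' df] ag [g' ag' dg]].
  exists (fun x => - j%:R * flat j.+1 x + flat j.+2 x); last exact: is_derive_flat.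
  by apply: flat_span_lin; exact: flat_span0.
exists (fun t => c * f' t + g' t); first exact: flat_span_lin.
by move=> t; apply: is_derive_eq.
Qed.

Lemma flat0_cvg (x : R) : 0 < x -> flat 0 (n%:R * x) @[n --> \oo] --> (1 : R).
Proof.
move=> x0; have : expR (- (n%:R * x)^-1) @[n --> \oo] --> (1 : R).
  have c0 : - ((n%:R)^-1 * x^-1) @[n --> \oo] --> (0 : R).
    rewrite -oppr0; apply: cvgN; rewrite -(mul0r x^-1).
    apply: cvgM; last exact: cvg_cst.
    by rewrite -(cvg_shiftS (fun n => n%:R^-1 : R)); exact: cvg_harmonic.
  under eq_fun do rewrite invfM.
  have := continuous_cvg _ (@continuous_expR R 0) c0.
  by rewrite expR0 => H; exact: H.
move=> c1; rewrite -(cvg_shiftS (fun n => flat 0 (n%:R * x) : R)).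
rewrite -(cvg_shiftS (fun n => expR (- (n%:R * x)^-1) : R)) in c1.
apply: cvg_trans c1; apply: near_eq_cvg; apply: nearW => n.
by rewrite /= /flat mulr_gt0// expr0 mul1r.
Qed.

Lemma flat0_bound (x : R) : 0 <= flat 0 x <= 1.
Proof.
rewrite /flat; case: ifPn => [x0|_]; last by rewrite lexx ler01.
by rewrite expr0 mul1r expR_ge0 -[leRHS]expR0 ler_expR oppr_le0 invr_ge0 ltW.
Qed.

(** The two factors switch on to the right of [a] and to the left of [b], ever more steeply as [n]
    grows. *)
Definition bump (a b : R) (n : nat) : R -> R :=
  fun t => flat 0 (n%:R * (t - a)) * flat 0 (n%:R * (b - t)).

Lemma test_bump (a b : R) (n : nat) : test_function (bump a b n).
Proof.
split.
  rewrite (_ : bump a b n = fun t => flat 0 (n%:R * t + - (n%:R * a)) * flat 0 (- n%:R * t + n%:R * b)).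
    by apply: smoothM; apply: smooth_affine; exact: smooth_flat.
  by apply/funext => t; rewrite /bump; congr (flat _ _ * flat _ _); ring.
exists (`|a| + `|b|) => t tab; rewrite /bump /flat.
have [ta|ta] := lerP t a.
  rewrite (_ : (0 < n%:R * (t - a)) = false) ?mul0r//.
  by apply/negbTE; rewrite -leNgt mulr_ge0_le0// subr_le0.
have [tb|tb] := lerP b t.
  rewrite (_ : (0 < n%:R * (b - t)) = false) ?mulr0//.
  by apply/negbTE; rewrite -leNgt mulr_ge0_le0// subr_le0.
exfalso; move: tab; apply/negP; rewrite -leNgt ler_norml; apply/andP; split.
  rewrite lerNl; apply: (@le_trans _ _ `|a|); last by rewrite lerDl.
  by rewrite lerNl; apply: le_trans (ltW ta); rewrite lerNl -normrN ler_norm.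
by apply: (le_trans (ltW tb)); apply: (le_trans (ler_norm b)); rewrite lerDr.
Qed.

Lemma bump_cvg (a b t : R) : bump a b n t @[n --> \oo] --> (\1_`]a, b[ t : R).
Proof.
rewrite indicE mem_setE in_itv/= /bump; case: (lerP t a) => [ta|ta] /=.
  rewrite (_ : (fun n => _) = fun=> 0) ?mulr0n; first exact: cvg_cst.
  apply/funext => n; rewrite /flat (_ : (0 < n%:R * (t - a)) = false) ?mul0r//.
  by apply/negbTE; rewrite -leNgt mulr_ge0_le0// subr_le0.
case: (lerP b t) => [tb|tb].
  rewrite (_ : (fun n => _) = fun=> 0) ?mulr0n; first exact: cvg_cst.
  apply/funext => n; rewrite /flat (_ : (0 < n%:R * (b - t)) = false) ?mulr0//.
  by apply/negbTE; rewrite -leNgt mulr_ge0_le0// subr_le0.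
have ta0 : 0 < t - a by rewrite subr_gt0.
have tb0 : 0 < b - t by rewrite subr_gt0.
by have := cvgM (flat0_cvg _ ta0) (flat0_cvg _ tb0); rewrite mulr1 => H; exact: H.
Qed.

Lemma bump_bound (a b t : R) (n : nat) : `|bump a b n t| <= `|\1_`[a, b] t : R|.
Proof.
have [f1 f2] := andP (flat0_bound (n%:R * (t - a))).
have [g1 g2] := andP (flat0_bound (n%:R * (b - t))).
rewrite ger0_norm ?mulr_ge0// ger0_norm ?indicE// mem_setE in_itv/= /bump.
have [ta|ta] := lerP a t; last first.
  rewrite /flat (_ : (0 < n%:R * (t - a)) = false) ?mul0r//.
  by apply/negbTE; rewrite -leNgt mulr_ge0_le0// subr_le0 ltW.
have [tb|tb] := lerP t b; last first.
  rewrite /flat (_ : (0 < n%:R * (b - t)) = false) ?mulr0//.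
  by apply/negbTE; rewrite -leNgt mulr_ge0_le0// subr_le0 ltW.
by rewrite /= -[leRHS]mulr1 ler_pM.
Qed.

End SmoothFunctions.

(** * Test functions: transforms of derivatives and density *)

Section TestFunctions.
Context {R : realType}.
Local Notation C := R[i].
Local Notation mu := (@lebesgue_measure R).
Local Notation Re := (@complex.Re R).
Local Notation Im := (@complex.Im R).
Implicit Types (phi : R -> R).

Lemma test_smooth phi : test_function phi -> smooth phi.
Proof. by case. Qed.

Lemma test_is_derive phi : test_function phi ->
  forall t : R, is_derive t 1 phi (derive1 phi t).
Proof. by move=> /test_smooth; exact: smooth_is_derive. Qed.

Lemma test_continuous phi : test_function phi -> continuous phi.
Proof.
by move=> tp; apply: derivable_continuous => t; exact: smooth_derivable (test_smooth _ tp) t.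
Qed.

Lemma test_derive phi : test_function phi -> test_function (derive1 phi).
Proof.
move=> [sp [K pK]]; split; first exact: smooth_derive.
exists K => t Kt; have d0 : is_derive t 1 phi 0.
  apply: (@near_eq_is_derive _ _ _ (cst 0)).
  have : \forall y \near t, K < `|y|.
    have cn : `|y| @[y --> t] --> `|t| by apply: cvg_norm; exact: cvg_id.
    exact: (cvgr_gt _ cn).
  by apply: filterS => y /pK ->.
by rewrite derive1E derive_val.
Qed.

Lemma test_translate phi (t : R) : test_function phi -> test_function (fun s => phi (s - t)).
Proof.
move=> [sp [K pK]]; split.
  rewrite (_ : (fun s => _) = fun s => phi (1 * s + - t)); first exact: smooth_affine.
  by apply/funext => s; rewrite mul1r.
exists (K + `|t|) => s Ks; apply: pK; rewrite -(ltrD2r `|t|) (lt_le_trans Ks)//.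
by rewrite -[X in `|X| <= _](subrK t) ler_normD.
Qed.

Lemma test_bounded phi : test_function phi -> exists2 M : R, 0 <= M & forall t, `|phi t| <= M.
Proof.
move=> tp; have [_ [K pK]] := tp.
have L0 : - (`|K| + 1) <= `|K| + 1 by have := normr_ge0 K; lra.
have cphi : {within `[- (`|K| + 1), `|K| + 1], continuous (fun t => `|phi t|)}.
  apply: continuous_subspaceT => x; apply: cvg_norm; exact: test_continuous.
have [c cL Hc] := EVT_max L0 cphi.
exists `|phi c| => // t; have [tL|tL] := boolP (t \in `[- (`|K| + 1), `|K| + 1]).
  exact: Hc.
rewrite pK ?normr0//; apply: contraNT tL; rewrite -leNgt => tK.
rewrite in_itv/= -ler_norml (le_trans tK)// (le_trans (ler_norm K))//.
by rewrite lerDl.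
Qed.

Lemma test_Lfun2 phi : test_function phi -> phi \in Lfun mu 2%:E.
Proof.
move=> tp; have [M M0 pM] := test_bounded _ tp; have [_ [K pK]] := tp.
have mI : measurable (`[- K, K] : set (measurableTypeR R)) by exact: measurable_itv.
have := (Lfun_submod_closed mu (lee1n 2)).2 M _ _ (Lfun2_indic _ mI (itv_fin (- K) K)) (Lfun_submod_closed mu (lee1n 2)).1.
move=> L2h; apply: (Lfun2_dom _ _ _ L2h).
  by apply: continuous_measurable_fun; exact: test_continuous.
move=> t /=; rewrite addr0 /GRing.scale/= indicE mem_setE in_itv/= -ler_norml.
have [tK|tK] := lerP `|t| K; first by rewrite /GRing.scale/= mulr1 (ger0_norm M0).
by rewrite pK// normr0.
Qed.

Lemma test_cL2 phi : test_function phi -> cL2 (fun t => (phi t)%:C).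
Proof. by move=> /test_Lfun2; exact: cL2_real. Qed.

Lemma mul_imag (w x y : R) : (0 +i* w) * (x +i* y) = (- (w * y)) +i* (w * x).
Proof. by apply: ceqP; rewrite !cpartE/= mul0r ?sub0r ?add0r. Qed.

Lemma fint_test_derive phi (L w : R) : 0 <= L -> test_function phi ->
  phi (- L) = 0 -> phi L = 0 ->
  fint `[- L, L] (fun t => (derive1 phi t)%:C) w =
  (0 +i* w) * fint `[- L, L] (fun t => (phi t)%:C) w.
Proof.
move=> L0 tp pL pNL; have LL : - L <= L by rewrite (le_trans _ L0)// oppr_le0.
have cp := test_continuous _ tp; have cp' := test_continuous _ (test_derive _ tp).
have dp := test_is_derive _ tp.
have dc (t : R) : is_derive t 1 (fun t => cos (w * t)) (- (w * sin (w * t))).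
  have dl : is_derive t 1 (fun t => w * t) w.
    by apply: is_derive_eq; rewrite /GRing.scale/= ; ring.
  have := @is_derive1_comp R (@cos R) (fun t => w * t) t _ _ (is_derive_cos _) dl.
  by move=> H; apply: (@is_derive_eq _ _ _ _ _ _ _ _ H); ring.
have ds (t : R) : is_derive t 1 (fun t => sin (w * t)) (w * cos (w * t)).
  have dl : is_derive t 1 (fun t => w * t) w.
    by apply: is_derive_eq; rewrite /GRing.scale/= ; ring.
  have := @is_derive1_comp R (@sin R) (fun t => w * t) t _ _ (is_derive_sin _) dl.
  by move=> H; apply: (@is_derive_eq _ _ _ _ _ _ _ _ H); ring.
(* Integration by parts against the cosine and the sine; the boundary terms vanish with [phi] at
   [- L] and [L]. *)
have ibp (c c' : R -> R) : continuous c -> continuous c' ->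
    (forall t : R, is_derive t 1 c (c' t)) ->
    \int[mu]_(t in `[- L, L]) (c t * derive1 phi t) = - \int[mu]_(t in `[- L, L]) (c' t * phi t).
  move=> cc cc' dcc.
  have cM (f g : R -> R) : continuous f -> continuous g -> continuous (fun t => f t * g t).
    by move=> cf cg t; apply: cvgM; [exact: cf|exact: cg].
  have H : \int[mu]_(t in `[- L, L]) (c t * derive1 phi t + c' t * phi t) = 0.
    have dM (t : R) : is_derive t 1 (fun t => c t * phi t) (c t * derive1 phi t + c' t * phi t).
      apply: (@is_derive_eq _ _ _ _ _ _ _ _ (is_deriveM (dcc t) (dp t))).
      by rewrite /GRing.scale/=; ring.
    have cD : continuous (fun t => c t * derive1 phi t + c' t * phi t).
      by move=> t; apply: cvgD; apply: cM.
    by rewrite (RintegralFTC _ _ _ _ LL cD dM) pL pNL !mulr0 subr0.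
  have := H; rewrite RintegralD//; last 2 first.
  - by apply: continuous_itv_integrable; exact: cM.
  - by apply: continuous_itv_integrable; exact: cM.
  by move/eqP; rewrite addr_eq0 => /eqP.
have cC : continuous (fun t => cos (w * t)) by exact: continuous_cosM.
have cS : continuous (fun t => sin (w * t)) by exact: continuous_sinM.
have Ec := ibp _ _ cC _ dc; have Es := ibp _ _ cS _ ds.
have cSw : continuous (fun t => - (w * sin (w * t))).
  by move=> t; apply: cvgN; apply: cvgM; [exact: cvg_cst|exact: cS].
have cCw : continuous (fun t => w * cos (w * t)).
  by move=> t; apply: cvgM; [exact: cvg_cst|exact: cC].
move: (Ec cSw) (Es cCw) => {}Ec {}Es.
have iM (c g : R -> R) : continuous c -> continuous g ->
    mu.-integrable `[- L, L] (EFin \o (fun t => c t * g t)).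
  move=> cc cg; apply: continuous_itv_integrable => t.
  by apply: cvgM; [exact: cc|exact: cg].
have pull (c g : R -> R) : continuous c -> continuous g ->
    \int[mu]_(t in `[- L, L]) (w * c t * g t) = w * \int[mu]_(t in `[- L, L]) (c t * g t).
  move=> cc cg; rewrite -RintegralZl//; last exact: iM.
  by apply: eq_Rintegral => t _; rewrite mulrA.
have E (g : R -> R) : continuous g -> fint `[- L, L] (fun t => (g t)%:C) w =
    (fconst * \int[mu]_(t in `[- L, L]) (cos (w * t) * g t)) +i*
    (- (fconst * \int[mu]_(t in `[- L, L]) (sin (w * t) * g t))).
  move=> cg; rewrite /fint /cintegral; apply: ceqP; rewrite !cpartE/= mul0r ?subr0 ?addr0.
    by congr (_ * _); apply: eq_Rintegral => t _; rewrite cosN mulr0 subr0.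
  rewrite -mulrN; congr (_ * _); rewrite -mulN1r -RintegralZl//; last exact: iM.
  by apply: eq_Rintegral => t _; rewrite sinN mulr0 add0r mulN1r mulNr.
rewrite !E// Ec Es (pull _ _ cC cp).
have -> : \int[mu]_(t in `[- L, L]) (- (w * sin (w * t)) * phi t) =
    - (w * \int[mu]_(t in `[- L, L]) (sin (w * t) * phi t)).
  rewrite -(pull _ _ cS cp) -[RHS]mulN1r -RintegralZl//; last first.
    by apply: iM => //; move=> t; apply: cvgM; [exact: cvg_cst|exact: cS].
  by apply: eq_Rintegral => t _; rewrite mulN1r mulNr.
move: (\int[mu]_(t in _) _) (\int[mu]_(t in _) _) fconst => x y c.
rewrite mul_imag; congr (_ +i* _); ring.
Qed.

Lemma rip0_closed (f k : R -> C) : cL2 f -> cL2 k ->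
  (forall e : R, 0 < e -> exists g,
    [/\ cL2 g, rip g k = 0 & n2 (fun t => g t - f t) <= e]) -> rip f k = 0.
Proof.
move=> f2 k2 H; apply/eqP; rewrite -sqrf_eq0 eq_le sqr_ge0 andbT.
apply/ler_addgt0Pr => e e0; rewrite add0r.
(* By Cauchy-Schwarz the squared product is then at most [e]; the 1 covers [n2 k = 0]. *)
have d0 : 0 < e / (n2 k + 1) by rewrite divr_gt0// ltr_wpDl// n2_ge0.
have [g [g2 gk0 gf]] := H _ d0.
have -> : rip f k ^+ 2 = rip (fun t => g t - f t) k ^+ 2.
  by rewrite ripBl// gk0 sub0r sqrrN.
have X := rip_CS _ _ (cL2B _ _ g2 f2) k2; apply: (le_trans X).
apply: (le_trans (ler_wpM2r (n2_ge0 k) gf)).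
rewrite mulrAC ler_pdivrMr ?ltr_wpDl// ?n2_ge0//.
by rewrite ler_wpM2l ?(ltW e0)// lerDl.
Qed.

Lemma cip0_closed (f k : R -> C) : cL2 f -> cL2 k ->
  (forall e : R, 0 < e -> exists g,
    [/\ cL2 g, cip g k = 0 & n2 (fun t => g t - f t) <= e]) -> cip f k = 0.
Proof.
move=> f2 k2 H; apply: ceqP; rewrite ?Re_cip ?Im_cip /=.
  apply: rip0_closed => // e /H[g [g2 g0 gf]]; exists g; split => //.
  by rewrite -Re_cip g0.
apply: rip0_closed => //; first exact: cL2Z.
move=> e /H[g [g2 g0 gf]]; exists g; split => //.
by rewrite -Im_cip g0.
Qed.

(* The span of the functions [bump] is dense, as they approximate indicators of
   intervals. *)
Lemma ae0_of_test (k : R -> C) : cL2 k ->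
  (forall phi, test_function phi -> cip (fun t => (phi t)%:C) k = 0) ->
  {ae mu, forall t, k t = 0}.
Proof.
move=> k2 Hk; apply: (n2_eq0 _ k2).
suff H : forall f, cL2 f -> cip f k = 0.
  have := cip_n2 k; rewrite H// => /(congr1 Re).
  by rewrite cReC => <-.
move=> f0 f02; suff [] : cL2 f0 /\ cip f0 k = 0 by [].
apply: (cL2_ind (fun f => cL2 f /\ cip f k = 0)) f02.
- move=> a b; split; first exact: cL2_citv.
  have mI : measurable (`[a, b] : set (measurableTypeR R)) by exact: measurable_itv.
  have mb n : measurable_fun setT (bump a b n).
    by apply: continuous_measurable_fun; apply: test_continuous; exact: test_bump.
  have [Lo _ cv] := @Lfun2_dominated_cvg _ (\1_`]a, b[) (\1_`[a, b]) (bump a b)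
    (Lfun2_indic _ mI (itv_fin a b)) mb (fun n t => bump_bound a b t n) (bump_cvg a b).
  apply: cip0_closed => //; first exact: cL2_citv.
  move=> e e0; move/fine_cvgP: cv => [_ /cvgrPdist_le/(_ e e0)[n _ /(_ n (leqnn n)) ne]].
  have b2 := test_cL2 _ (test_bump a b n).
  exists (fun t => (bump a b n t)%:C); split => //; first by rewrite Hk//; exact: test_bump.
  apply: le_trans ne; rewrite sub0r normrN; apply: le_trans (ler_norm _).
  rewrite /= /n2 /Rintegral le_eqVlt; apply/orP; left; apply/eqP; congr fine.
  apply: ae_eq_integral => //.
  - by apply/measurable_EFinP; apply: measurable_nsq; apply: cmeasB; apply: cL2_meas => //; exact: cL2_citv.
  - apply/measurable_EFinP; apply: measurable_funX; apply: measurable_funB.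
      by move: Lo => /Lfun2P[].
    exact: mb.
  (* The bumps converge to the open interval, which differs from the closed one at the two endpoints
     only. *)
  - apply: ae_sub2 (ae_neq a) (ae_neq b) => t ta tb _.
    rewrite /citv !indicE !mem_setE !in_itv/= -rmorphB nsqC/= -[in RHS]sqrrN opprB.
    by rewrite !lt_neqAle (eq_sym a) ta tb.
- move=> c f g [f2 f0'] [g2 g0]; split.
    by apply: cL2D => //; exact: cL2Z.
  by rewrite cip_lin// f0' g0 mulr0 addr0.
- move=> f f2 H; split => //; apply: cip0_closed => // e /H[g [[_ g0] g2 gf]].
  by exists g.
Qed.

End TestFunctions.

(** * Weak derivatives on the frequency side *)

Section WeakDerivative.
Context {R : realType}.
Local Notation C := R[i].
Local Notation mu := (@lebesgue_measure R).
Local Notation Re := (@complex.Re R).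
Local Notation Im := (@complex.Im R).
Implicit Types (phi : R -> R) (u g w z : R -> C).

(** The function [g] is the distributional derivative of [u]; as test functions are real, the
    conjugation in [cip] has no effect. *)
Definition wderiv u g := forall phi, test_function phi ->
  cip u (fun t => (derive1 phi t)%:C) = - cip g (fun t => (phi t)%:C).

Lemma ae_eq_cip (f g f' g' : R -> C) : cmeas f -> cmeas g -> cmeas f' -> cmeas g' ->
  {ae mu, forall t, f t * (g t)^*%C = f' t * (g' t)^*%C} -> cip f g = cip f' g'.
Proof.
move=> mf mg mf' mg' E; have [m1 m2] := cmeasM _ _ mf (cmeasJ _ mg).
have [m1' m2'] := cmeasM _ _ mf' (cmeasJ _ mg').
rewrite /cip /cintegral; congr (_ +i* _); rewrite /Rintegral; congr fine.
  apply: ae_eq_integral => //; [exact/measurable_EFinP|exact/measurable_EFinP|].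
  by apply: ae_sub E => t -> _.
apply: ae_eq_integral => //; [exact/measurable_EFinP|exact/measurable_EFinP|].
by apply: ae_sub E => t -> _.
Qed.

Lemma test_support phi : test_function phi ->
  exists2 L : R, 0 <= L & forall t, L <= `|t| -> phi t = 0 /\ derive1 phi t = 0.
Proof.
move=> tp; have [_ [K pK]] := tp; have [_ [K' pK']] := test_derive _ tp.
exists (`|K| + `|K'| + 1) => [|t Lt]; first by rewrite !addr_ge0.
have := ler_norm K; have := ler_norm K'; have := normr_ge0 K; have := normr_ge0 K' => *.
by split; [apply: pK|apply: pK']; lra.
Qed.

Lemma fourier_test phi (L : R) : test_function phi -> (forall t, L <= `|t| -> phi t = 0) ->
  fourier (fun t => (phi t)%:C) (fint `[- L, L] (fun t => (phi t)%:C)).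
Proof.
move=> tp pL; have p2 := test_cL2 _ tp; have := fourier_ccut (- L) L _ p2.
congr fourier; apply/funext => t; rewrite /ccut /citv indicE mem_setE in_itv/= -ler_norml.
by have [tL|tL] := lerP `|t| L; rewrite ?mulr1// pL ?mul0r// ltW.
Qed.

Lemma cmeas_imag : cmeas (fun w : R => 0 +i* w : C).
Proof. by split; [exact: measurable_cst|exact: measurable_id]. Qed.

(** Plancherel moves both sides to the frequency domain, where differentiating [phi] multiplies by i
    om; taken out of the second argument this factor is conjugated, which gives the minus sign. *)
Lemma fourier_wderiv u g w z : fourier u w -> fourier g z ->
  {ae mu, forall om, z om = (0 +i* om) * w om} -> wderiv u g.
Proof.
move=> uw gz E phi tp; have [L L0 pL'] := test_support _ tp.
have pL t Lt : phi t = 0 := (pL' t Lt).1.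
have L0' : `|L| = L by rewrite ger0_norm.
have pL1 : phi L = 0 by rewrite pL// L0'.
have pL2 : phi (- L) = 0 by rewrite pL// normrN L0'.
have dphi t Lt : derive1 phi t = 0 := (pL' t Lt).2.
have Fp := fourier_test _ _ tp pL; have Fd := fourier_test _ _ (test_derive _ tp) dphi.
rewrite -(fourier_cip _ _ _ _ uw Fd) -(fourier_cip _ _ _ _ gz Fp).
have [_ w2 _] := uw; have [_ z2 _] := gz; have [_ p2 _] := Fp; have [_ d2 _] := Fd.
set F := fint _ _ in Fp p2 *; set D := fint _ _ in Fd d2 *.
have -> : - cip z F = cip (fun t => (-1) * z t) F by rewrite cipZl// mulN1r.
apply: ae_eq_cip; [exact: cL2_meas|exact: cL2_meas|by apply: cL2_meas; exact: cL2Z|exact: cL2_meas|].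
apply: ae_sub E => om ->.
rewrite /D fint_test_derive// -/F; move: (F om) (w om) => x y.
by apply: ceqP; rewrite !cpartE/=; ring.
Qed.

(** Cauchy-Schwarz: every translate of [phi] is bounded by [M] and supported in an interval of
    length [2 * L], so its norm is bounded uniformly in the shift. *)
Lemma Rintegral_translate_bounded (rho phi : R -> R) :
  rho \in Lfun mu 2%:E -> test_function phi ->
  exists M, forall t, `|\int[mu]_s (rho s * phi (s - t))| <= M.
Proof.
move=> r2 tp; have [M M0 pM] := test_bounded _ tp; have [L L0 pL] := test_support _ tp.
exists (Num.sqrt (n2 (fun t => (rho t)%:C)) * Num.sqrt (M ^+ 2 * (2 * L))) => t.
have p2 := test_cL2 _ (test_translate _ t tp).
have rc2 := cL2_real _ r2.
have -> : \int[mu]_s (rho s * phi (s - t)) = rip (fun t => (rho t)%:C) (fun s => (phi (s - t))%:C).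
  by apply: eq_Rintegral => s _; rewrite !cpartE mulr0 addr0.
apply: (le_trans (rip_le _ _ rc2 p2)); apply: ler_wpM2l; first exact: sqrtr_ge0.
apply: ler_wsqrtr.
have -> : M ^+ 2 * (2 * L) = n2 (fun s => M%:C * citv (t - L) (t + L) s).
  rewrite n2Z; last exact: cL2_citv.
  rewrite nsqC -rippE rip_citv minxx maxxx; congr (_ * _).
  rewrite max_r; first by ring.
  by rewrite -[leRHS]/(t + L - (t - L)); lra.
apply: le_Rintegral => //.
- exact: nsq_integrable.
- by apply: nsq_integrable; apply: cL2Z; exact: cL2_citv.
move=> s _; rewrite nsqM !nsqC /citv indicE mem_setE in_itv/=.
have [st|st] := boolP (t - L <= s <= t + L).
  by rewrite expr1n mulr1 -real_normK ?num_real// ler_pXn2r ?nnegrE.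
rewrite (proj1 (pL (s - t) _)) ?expr0n/= ?mulr0//.
apply: contraNT st; rewrite -ltNge ltr_norml => /andP[? ?]; apply/andP; split; lra.
Qed.

Lemma is_derive_translate (rho phi : R -> R) (t : R) :
  rho \in Lfun mu 2%:E -> test_function phi ->
  is_derive t 1 (fun t => \int[mu]_s (rho s * phi (s - t)))
    (- \int[mu]_s (rho s * derive1 phi (s - t))).
Proof.
move=> r2 tp; have [M M0 pM] := test_bounded _ (test_derive _ tp); have [L L0 pL] := test_support _ tp.
have d1 (x y : R) : is_derive x 1 (fun x => rho y * phi (y - x)) (- (rho y * derive1 phi (y - x))).
  have dl : is_derive x 1 (fun x => y - x) (-1).
    by have := is_deriveB (is_derive_cst y x 1) (is_derive_id x 1); rewrite sub0r.
  have dp := @is_derive1_comp R phi (fun x => y - x) x _ _ (test_is_derive _ tp _) dl.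
  by apply: is_derive_eq; rewrite /GRing.scale/=; ring.
have E (x : R) : partial1of2 (fun x y => rho y * phi (y - x)) x = fun y => - (rho y * derive1 phi (y - x)).
  by apply/funext => y; rewrite partial1of2E derive_val.
(* A bound common to all shifts [x] within 1 of [t]: the support of the shifted derivative stays
   within [L + 1] of [t]. *)
pose G y : R := `|rho y| * (M * \1_`[t - 1 - L, t + 1 + L] y).
have G0 y : 0 <= G y by rewrite /G !mulr_ge0.
have nr2 : (fun y => `|rho y|) \in Lfun mu 2%:E.
  apply: (Lfun2_dom _ _ _ r2) => [|y]; last by rewrite normr_id.
  by apply: measurableT_comp => //; move: r2 => /Lfun2P[].
have iG : mu.-integrable setT (EFin \o G).
  apply: (Lfun2_integrableM _ _ nr2).
  have mI : measurable (`[t - 1 - L, t + 1 + L] : set (measurableTypeR R)) by exact: measurable_itv.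
  have := (Lfun_submod_closed mu (lee1n 2)).2 M _ _ (Lfun2_indic _ mI (itv_fin _ _)) (Lfun_submod_closed mu (lee1n 2)).1.
  by rewrite addr0.
have It : `]t - 1, t + 1[%classic t by rewrite /= in_itv/=; lra.
have iF x : mu.-integrable setT (EFin \o (fun y => rho y * phi (y - x))).
  by apply: Lfun2_integrableM => //; apply: test_Lfun2; exact: test_translate.
have dG x y : `]t - 1, t + 1[%classic x ->
    `|partial1of2 (fun x y => rho y * phi (y - x)) x y| <= G y.
  rewrite E normrN normrM /= in_itv/= => /andP[tx xt]; apply: ler_wpM2l => //.
  rewrite indicE mem_setE in_itv/=.
  have [st|st] := boolP (t - 1 - L <= y <= t + 1 + L); first by rewrite mulr1.
  rewrite (proj2 (pL (y - x) _)) ?normr0 ?mulr0//.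
  apply: contraNT st; rewrite -ltNge ltr_norml => /andP[? ?]; apply/andP; split; lra.
have := @cvg_differentiation_under_integral R _ _ mu (fun x y => rho y * phi (y - x)) setT
  measurableT t (t - 1) (t + 1) It (fun x _ => iF x)
  (fun x y _ _ => @ex_derive _ _ _ _ _ _ _ (d1 x y)) G G0 iG (fun x y Ix _ => dG x y Ix).
have -> : \int[mu]_y partial1of2 (fun x y => rho y * phi (y - x)) t y =
    - \int[mu]_s (rho s * derive1 phi (s - t)).
  rewrite E -[RHS]mulN1r -RintegralZl//.
    by apply: eq_Rintegral => s _; rewrite mulN1r.
  apply: Lfun2_integrableM => //; apply: test_Lfun2.
  by apply: (test_translate (derive1 phi)); exact: test_derive.
move=> c0; have {}c0 : h^-1 *: (((fun t => \int[mu]_s (rho s * phi (s - t))) \o shift t) (h *: 1) -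
    \int[mu]_s (rho s * phi (s - t))) @[h --> 0^'] --> - \int[mu]_s (rho s * derive1 phi (s - t)).
  by under eq_fun do rewrite scaler1; exact: c0.
by apply: DeriveDef; [apply/cvg_ex; eexists; exact: c0|exact: cvg_lim c0].
Qed.

(** F t exp t is constant, so F (- x) = F 0 exp x. At x = M / |F 0| this exceeds [M] in modulus,
    since exp x >= 1 + x. *)
Lemma exp_decay_bounded0 (F : R -> R) (M : R) : (forall t : R, is_derive t 1 F (- F t)) ->
  (forall t, `|F t| <= M) -> F 0 = 0.
Proof.
move=> dF FM; have dE (t : R) : is_derive t 1 (fun t => F t * expR t) 0.
  apply: (@is_derive_eq _ _ _ _ _ _ _ _ (is_deriveM (dF t) (is_derive_expR t))).
  by rewrite /GRing.scale/=; ring.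
have cE t : F t * expR t = F 0.
  by have := is_derive_0_is_cst t 0 dE; rewrite expR0 mulr1.
apply/eqP; rewrite -normr_le0; apply/negP => /negP; rewrite -ltNge => F0.
have M0 : 0 <= M by exact: le_trans (FM 0).
have e1 : 1 + M / `|F 0| <= expR (M / `|F 0|) by exact: expR_ge1Dx.
have : `|F 0| * expR (M / `|F 0|) <= M.
  set x := M / `|F 0|; rewrite -(cE (- x)) normrM (ger0_norm (expR_ge0 _)) -mulrA.
  by rewrite -expRD addNr expR0 mulr1.
apply/negP; rewrite -ltNge; apply: (@lt_le_trans _ _ (`|F 0| * (1 + M / `|F 0|))).
  by rewrite mulrDr mulr1 mulrC divfK ?gt_eqF// ltrDr.
by rewrite ler_pM2l.
Qed.

(* F t, the integral of k s * phi (s - t) over s, is a bounded solution of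
   F' = - F. *)
Lemma wderiv_opp_eq0 (k : R -> C) : cL2 k -> wderiv k (fun t => - k t) ->
  {ae mu, forall t, k t = 0}.
Proof.
move=> k2 wk; apply: ae0_of_test => // phi tp.
have p2 := test_cL2 _ tp.
rewrite (cipC _ _ k2 p2).
have int0 (rho : R -> R) : rho \in Lfun mu 2%:E ->
    (forall psi, test_function psi -> \int[mu]_s (rho s * derive1 psi s) = \int[mu]_s (rho s * psi s)) ->
    \int[mu]_s (rho s * phi s) = 0.
  move=> r2 H; have [M FM] := Rintegral_translate_bounded _ _ r2 tp.
  have := exp_decay_bounded0 (fun t => \int[mu]_s (rho s * phi (s - t))) M.
  under eq_Rintegral do rewrite subr0.
  apply => // t.
  have dt s : derive1 (fun s => phi (s - t)) s = derive1 phi (s - t).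
    have dl : is_derive s 1 (fun s => s - t) 1.
      by have := is_deriveB (is_derive_id s 1) (is_derive_cst t s 1); rewrite subr0.
    have dp := @is_derive1_comp R phi (fun s => s - t) s _ _ (test_is_derive _ tp _) dl.
    by rewrite derive1E derive_val mulr1.
  have := H _ (test_translate _ t tp).
  under eq_Rintegral do rewrite dt.
  move=> <-.
  exact: (is_derive_translate _ _ t r2 tp).
have ReE psi : Re (cip k (fun t => (psi t)%:C)) = \int[mu]_s (Re (k s) * psi s).
  by rewrite Re_cip; apply: eq_Rintegral => s _; rewrite !cpartE mulr0 addr0.
have ImE psi : Im (cip k (fun t => (psi t)%:C)) = \int[mu]_s (Im (k s) * psi s).
  rewrite Im_cip; apply: eq_Rintegral => s _; rewrite !cpartE.
  by move: (Re _) (Im _) => x y; ring.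
have kk psi : test_function psi ->
    cip k (fun t => (derive1 psi t)%:C) = cip k (fun t => (psi t)%:C).
  move=> tpsi; rewrite wk//.
  have := cipZl (-1) _ _ k2 (test_cL2 _ tpsi); under eq_fun do rewrite mulN1r.
  by move=> ->; rewrite mulN1r opprK.
apply: ceqP; rewrite cpartE ?ReE ?ImE.
  apply: int0; first exact: cL2_Re.
  by move=> psi tpsi; rewrite -!ReE kk.
rewrite int0 ?oppr0//; first exact: cL2_Im.
by move=> psi tpsi; rewrite -!ImE kk.
Qed.

Lemma wderiv_fourier u g w z : fourier u w -> fourier g z -> wderiv u g ->
  {ae mu, forall om, z om = (0 +i* om) * w om}.
Proof.
move=> uw gz ug; have [u2 w2 _] := uw; have [g2 z2 _] := gz.
(* The quotient [m] by [q] is dominated by the sum of the two transforms, hence in L2, and is the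
   transform of some [y]. *)
pose q om : C := 1 + (0 +i* om).
have q1 om : 1 <= nsq (q om).
  by rewrite /nsq !cpartE/= addr0 add0r expr1n lerDl sqr_ge0.
have q0 om : q om != 0.
  by apply: contraTneq (q1 om) => ->; rewrite nsq0 -ltNge ltr01.
have mq : cmeas q by apply: cmeasD; [exact: cmeas_cst|exact: cmeas_imag].
pose m om := (q om)^-1 * (w om + z om).
have m2 : cL2 m.
  apply: (cL2_dom _ _ 1 (cL2D _ _ w2 z2)).
    by apply: cmeasM; [exact: cmeasV|apply: cL2_meas; exact: cL2D].
  move=> om; rewrite nsqM; apply: ler_wpM2r; first exact: nsq_ge0.
  have : nsq (q om)^-1 * nsq (q om) = 1 by rewrite -nsqM mulVf// nsqC expr1n.
  have := q1 om; have := nsq_ge0 (q om)^-1; nra.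
have [y ym] := fourier_surj _ m2; have [y2 _ _] := ym.
(* In the time domain y + y' = u + g. Together with u' = g this gives (u - y)' = - (u - y), so [u]
   and [y] agree almost everywhere. *)
have yd : wderiv y (fun t => (u t + g t) - y t).
  apply: (fourier_wderiv _ _ _ _ ym (fourierB _ _ _ _ (fourierD _ _ _ _ uw gz) ym)).
  apply: aeW => om; rewrite -[w om + z om](mulVKf (q0 om)) -/(m om) /q.
  by move: (m om) => x; ring.
have k2 : cL2 (fun t => u t - y t) by exact: cL2B.
have kd : wderiv (fun t => u t - y t) (fun t => - (u t - y t)).
  move=> phi tp; have p2 := test_cL2 _ tp; have d2 := test_cL2 _ (test_derive _ tp).
  have B (a b h : R -> C) : cL2 a -> cL2 b -> cL2 h ->
      cip (fun t => a t - b t) h = cip a h - cip b h.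
    move=> a2 b2 h2; have := cip_lin (-1) _ _ _ b2 a2 h2.
    rewrite mulN1r addrC => <-; apply: (congr1 (fun x => cip x h)); apply/funext => t.
    by rewrite mulN1r addrC.
  have N (a h : R -> C) : cL2 a -> cL2 h -> cip (fun t => - a t) h = - cip a h.
    move=> a2 h2; have := cipZl (-1) _ _ a2 h2; rewrite mulN1r => <-.
    by apply: (congr1 (fun x => cip x h)); apply/funext => t; rewrite mulN1r.
  rewrite N// !B// ug// yd// B//; last exact: cL2D.
  rewrite cipDl//; ring.
have k0 := wderiv_opp_eq0 _ k2 kd.
have um : fourier u m.
  apply: (fourier_ae _ _ _ _ ym u2 m2); last by apply: aeW.
  by apply: ae_sub k0 => t /eqP; rewrite subr_eq0 => /eqP.
apply: ae_sub (fourier_unique _ _ _ uw um) => om wm.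
have : q om * w om = w om + z om by rewrite {1}wm /m mulVKf.
rewrite /q mulrDl mul1r => /addrI; exact: esym.
Qed.

End WeakDerivative.

(** * Matrices and contraction factors *)

Section MatrixNorms.
Local Open Scope sesquilinear_scope.
Context {R : realType}.
Local Notation C := R[i].
Local Notation Re := (@complex.Re R).

Lemma adjE m n (A : 'M[C]_(m, n)) i j : (A^t*) i j = ((A j i)^*)%C.
Proof. by rewrite !mxE. Qed.

Lemma adjM m n p (A : 'M[C]_(m, n)) (B : 'M[C]_(n, p)) : (A *m B)^t* = B^t* *m A^t*.
Proof. by rewrite trmx_mul map_mxM. Qed.

Lemma adjD m n (A B : 'M[C]_(m, n)) : (A + B)^t* = A^t* + B^t*.
Proof. by rewrite linearD map_mxD. Qed.

Lemma adjN m n (A : 'M[C]_(m, n)) : (- A)^t* = - A^t*.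
Proof. by rewrite linearN map_mxN. Qed.

Lemma adjZ m n (c : C) (A : 'M[C]_(m, n)) : (c *: A)^t* = (c^*)%C *: A^t*.
Proof. by rewrite linearZ map_mxZ. Qed.

Lemma adj_real_scalar n (a : R) : ((a%:C)%:M : 'M[C]_n)^t* = (a%:C)%:M.
Proof. by apply/matrixP => i j; rewrite adjE !mxE eq_sym; apply: ceqP; case: eqP; rewrite /= ?oppr0. Qed.

Definition vnsq {n} (x : 'cV[C]_n) : R := \sum_i nsq (x i 0).

Lemma vnsq_ge0 n (x : 'cV[C]_n) : 0 <= vnsq x.
Proof. by apply: sumr_ge0 => i _; exact: nsq_ge0. Qed.

Lemma vnsq_eq0 n (x : 'cV[C]_n) : vnsq x = 0 -> x = 0.
Proof.
move=> x0; apply/matrixP => i j; rewrite (ord1 j) mxE; apply: nsq_eq0.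
move/eqP: x0; rewrite psumr_eq0 => [/allP/(_ i)|k _]; last exact: nsq_ge0.
by rewrite mem_index_enum => /(_ isT)/eqP.
Qed.

Lemma nsq_le_vnsq n (x : 'cV[C]_n) i : nsq (x i 0) <= vnsq x.
Proof. by rewrite /vnsq (bigD1 i)//= lerDl sumr_ge0// => j _; exact: nsq_ge0. Qed.

Lemma vnsqE n (x : 'cV[C]_n) : (x^t* *m x) 0 0 = (vnsq x)%:C.
Proof.
rewrite mxE /vnsq rmorph_sum; apply: eq_bigr => i _.
by rewrite adjE mulrC mulJ_nsq.
Qed.

Lemma vnsq_mul m n (A : 'M[C]_(m, n)) (x : 'cV[C]_n) :
  (x^t* *m (A^t* *m A) *m x) 0 0 = (vnsq (A *m x))%:C.
Proof. by rewrite -vnsqE adjM !mulmxA. Qed.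

Lemma eq_vnsq m p n (A : 'M[C]_(m, n)) (B : 'M[C]_(p, n)) (x : 'cV[C]_n) :
  A^t* *m A = B^t* *m B -> vnsq (A *m x) = vnsq (B *m x).
Proof. by move=> AB; apply: (@complexI R); rewrite -!vnsq_mul AB. Qed.

Section SkewShift.
Context {n : nat} (a : R) (K : 'M[C]_n).
Hypothesis Ks : K^t* = - K.

(** For skew-Hermitian [K] the Gram matrix of a + K is a^2 plus that of [K], the cross terms
    cancelling. This bounds a + K from below by [a]. *)
Lemma vnsq_skew_shift (x : 'cV[C]_n) :
  vnsq ((a%:C%:M + K) *m x) = a ^+ 2 * vnsq x + vnsq (K *m x).
Proof.
apply: (@complexI R); rewrite rmorphD rmorphM/= -vnsq_mul -vnsqE -(vnsq_mul _ _ K).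
rewrite adjD adj_real_scalar Ks !(mulmxDr, mulmxDl) !mul_scalar_mx !mul_mx_scalar.
rewrite !(mulNmx, mulmxN) -?scalemxAl -?scalemxAr mul_mx_scalar !(mulNmx, mulmxN) -!scalemxAl scalerA.
rewrite mulNmx scalerN addrA addrNK mxE; congr (_ + _).
by rewrite mxE -rmorphM -expr2.
Qed.

(** Both Gram matrices equal a^2 - K^2; in other words the Cayley transform of [K] is unitary. *)
Lemma vnsq_skew_shift_sub (x : 'cV[C]_n) :
  vnsq ((a%:C%:M - K) *m x) = vnsq ((a%:C%:M + K) *m x).
Proof.
apply: eq_vnsq; rewrite !adjD adjN !adj_real_scalar Ks opprK.
rewrite !(mulmxDr, mulmxDl) !mul_scalar_mx !mul_mx_scalar !(mulNmx, mulmxN).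
by rewrite scalerN !addrA; congr (_ - _); rewrite addrK subrK.
Qed.

Lemma vnsq_skew_shift_ge (x : 'cV[C]_n) : a ^+ 2 * vnsq x <= vnsq ((a%:C%:M + K) *m x).
Proof. by rewrite vnsq_skew_shift lerDl vnsq_ge0. Qed.

Lemma skew_shift_unit : 0 < a -> a%:C%:M + K \in unitmx.
Proof.
move=> a0; rewrite -unitmx_tr -row_free_unit; apply: inj_row_free => v.
move=> /(congr1 trmx); rewrite trmx_mul trmxK trmx0 => v0.
have := vnsq_skew_shift_ge v^T; rewrite v0 /vnsq [leRHS]big1; last first.
  by move=> i _; rewrite mxE nsq0.
rewrite -/(vnsq v^T) pmulr_rle0 ?exprn_gt0// => v1.
have : vnsq v^T = 0 by apply/eqP; rewrite eq_le v1 vnsq_ge0.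
by move/vnsq_eq0/(congr1 trmx); rewrite trmxK trmx0.
Qed.

Lemma vnsq_skew_shift_inv (y : 'cV[C]_n) : 0 < a ->
  vnsq (invmx (a%:C%:M + K) *m y) <= a ^- 2 * vnsq y.
Proof.
move=> a0; have := vnsq_skew_shift_ge (invmx (a%:C%:M + K) *m y).
by rewrite mulKVmx ?skew_shift_unit// -ler_pdivlMl ?exprn_gt0// => ->.
Qed.

End SkewShift.

Lemma cmeas_det n (F : R -> 'M[C]_n) : (forall i j, cmeas (fun t => F t i j)) ->
  cmeas (fun t => \det (F t)).
Proof.
move=> mF; apply: (cmeas_sum _ (index_enum _)) => s; apply: cmeasM; first exact: cmeas_cst.
by apply: (cmeas_prod _ (index_enum _)) => i; exact: mF.
Qed.

(** The adjugate formula makes the entries of the inverse rational in those of [F]; it is needed to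
    invert the symbol frequency by frequency. *)
Lemma cmeas_invmx n (F : R -> 'M[C]_n) : (forall t, F t \in unitmx) ->
  (forall i j, cmeas (fun t => F t i j)) -> forall i j, cmeas (fun t => invmx (F t) i j).
Proof.
move=> uF mF i j.
rewrite (_ : (fun t => _) = fun t => (\det (F t))^-1 * ((-1) ^+ (j + i) * \det (row' j (col' i (F t))))).
  apply: cmeasM; first by apply: cmeasV; exact: cmeas_det.
  apply: cmeasM; first exact: cmeas_cst.
  apply: cmeas_det => k l; under eq_fun do rewrite !mxE; exact: mF.
by apply/funext => t; rewrite /invmx uF !mxE.
Qed.

Lemma cmeas_mulmx m n (F : R -> 'M[C]_(m, n)) (x : R -> 'cV[C]_n) :
  (forall i j, cmeas (fun t => F t i j)) -> (forall i, cmeas (fun t => x t i 0)) ->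
  forall i, cmeas (fun t => (F t *m x t) i 0).
Proof.
move=> mF mx i; under eq_fun do rewrite mxE.
by apply: (cmeas_sum _ (index_enum _)) => k; apply: cmeasM.
Qed.

Lemma unitary_vnsq n (P : 'M[C]_n) (x : 'cV[C]_n) : P^t* *m P = 1%:M ->
  vnsq (P *m x) = vnsq x.
Proof.
by move=> PP; rewrite -[RHS](congr1 vnsq (mul1mx x)); apply: eq_vnsq; rewrite PP adj_real_scalar mulmx1.
Qed.

(** * Spectral theorem for positive definite matrices *)

Section Spectral.
Context {r : nat} (H : 'M[C]_r).
Hypothesis pH : hermitian_posdef H.

Lemma posdef_spectral : exists (P : 'M[C]_r) (d : 'I_r -> R),
  [/\ P^t* *m P = 1%:M, P *m P^t* = 1%:M,
      H = P^t* *m diag_mx (\row_i (d i)%:C) *m P & forall i, 0 < d i].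
Proof.
have [hH pos] := pH.
have := orthomx_spectralP (hermitian_normalmx hH).
rewrite invmx_unitary ?spectral_unitarymx//.
set P := spectralmx H; set D := spectral_diag H => HE.
have PP : P *m P^t* = 1%:M by apply/unitarymxP; exact: spectral_unitarymx.
have PP' : P^t* *m P = 1%:M by apply: mulmx1C.
pose d i := Re (D 0 i).
have dE i : 0 < d i /\ D 0 i = (d i)%:C.
  (* The i-th eigenvector, at which the quadratic form takes the value [D 0 i]. Positivity in [R[i]]
     entails that this value is real. *)
  pose x : 'cV[C]_r := P^t* *m delta_mx i 0.
  have Px : P *m x = delta_mx i 0 by rewrite mulmxA PP mul1mx.
  have x0 : x != 0.
    apply: contraPneq Px => ->; rewrite mulmx0 => /matrixP/(_ i 0).
    by rewrite !mxE !eqxx => /eqP; rewrite eq_sym oner_eq0.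
  have := pos x x0; rewrite {1}HE -!mulmxA Px (mulmxA (x^t*)) -adjM Px.
  rewrite mul_diag_mx mxE (bigD1 i)//= big1 => [|k ki]; last first.
    by rewrite adjE !mxE (negbTE ki) mulr0 mulr0.
  rewrite addr0 adjE !mxE !eqxx/= mulr1.
  move=> D0; have : 0 < D 0 i by move: D0; rewrite /= oppr0 mul1r.
  rewrite ltcE /= => /andP[/eqP I0 R0]; split => //.
  by apply: ceqP => //; rewrite I0.
exists P, d; split => [//|//||i]; last by have [] := dE i.
have -> : \row_i (d i)%:C = D by apply/rowP => i; rewrite mxE; have [] := dE i.
exact: HE.
Qed.

Variables (P : 'M[C]_r) (d : 'I_r -> R).
Hypotheses (PP : P^t* *m P = 1%:M) (PP' : P *m P^t* = 1%:M)
  (HE : H = P^t* *m diag_mx (\row_i (d i)%:C) *m P) (d0 : forall i, 0 < d i).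

(** [eigenvalue] refers to row vectors: multiplied on the right by the adjoint of [P], such an
    eigenvector becomes one of the diagonal matrix, and conversely the rows of [P] are
    eigenvectors. *)
Lemma spectral_spectrum l : spectrum H l <-> exists i, l = (d i)%:C.
Proof.
split => [/eigenvalueP[v vH v0]|[i ->]].
  have PPu : P \is unitarymx by apply/unitarymxP.
  have qE : (v *m P^t*) *m diag_mx (\row_i (d i)%:C) = l *: (v *m P^t*).
    by rewrite scalemxAl -vH HE !mulmxA mulmxtVK.
  have q0 : v *m P^t* != 0.
    apply: contra_neq v0 => q0; by rewrite -[v]mulmx1 -PP mulmxA q0 mul0mx.
  have [i qi] : exists i, (v *m P^t*) 0 i != 0.
    apply/existsP; apply: contraNT q0; rewrite negb_exists => /forallP q0.
    by apply/eqP/rowP => i; rewrite [RHS]mxE; apply/eqP; have := q0 i; rewrite negbK.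
  exists i; move/rowP/(_ i): qE; rewrite mul_mx_diag !mxE mulrC => /(mulIf _) -> //.
  by move: qi; rewrite mxE.
apply/eigenvalueP; exists (row i P).
  by rewrite HE !mulmxA -row_mul PP' -row_mul mul1mx row_diag_mx mxE -scalemxAl rowE.
apply/eqP => /(congr1 (fun v => v *m P^t*)); rewrite -row_mul PP' mul0mx.
by move/rowP/(_ i); rewrite !mxE eqxx => /eqP; rewrite oner_eq0.
Qed.

Lemma vnsq_diagonalized (M : 'M[C]_r) (e : 'I_r -> R) (x : 'cV[C]_r) :
  M = P^t* *m diag_mx (\row_i (e i)%:C) *m P ->
  vnsq (M *m x) = \sum_i e i ^+ 2 * nsq ((P *m x) i 0).
Proof.
move=> ->; rewrite -!mulmxA unitary_vnsq ?trmxCK ?PP'//.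
by apply: eq_bigr => i _; rewrite mul_diag_mx mxE nsqM mxE nsqC.
Qed.

Lemma diagonalized_shift (a b : R) :
  a%:C%:M + b%:C *: H = P^t* *m diag_mx (\row_i (a + b * d i)%:C) *m P.
Proof.
rewrite {1}HE -[a%:C%:M]mulmx1 -PP mulmxA -scalar_mxC scalemxAl scalemxAr -mulmxDl.
congr (_ *m _); rewrite -mulmxDr; congr (_ *m _); apply/matrixP => i j; rewrite !mxE.
by rewrite rmorphD rmorphM mulrnDl mulrnAr.
Qed.

Lemma vnsq_shift_contraction (a s : R) (x : 'cV[C]_r) :
  (forall i, (a - d i) ^+ 2 <= s ^+ 2 * (a + d i) ^+ 2) ->
  vnsq ((a%:C%:M - H) *m x) <= s ^+ 2 * vnsq ((a%:C%:M + H) *m x).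
Proof.
move=> sd; have HN := diagonalized_shift a (-1); have HP := diagonalized_shift a 1.
rewrite rmorphN1 scaleN1r in HN; rewrite scale1r in HP.
rewrite (vnsq_diagonalized _ _ _ HN) (vnsq_diagonalized _ _ _ HP) mulr_sumr.
apply: ler_sum => i _; rewrite mulN1r mul1r mulrA; apply: ler_wpM2r; first exact: nsq_ge0.
exact: sd.
Qed.

Lemma posdef_shift_unit (a : R) : 0 < a -> a%:C%:M + H \in unitmx.
Proof.
move=> a0; rewrite -unitmx_tr -row_free_unit; apply: inj_row_free => v.
move=> /(congr1 trmx); rewrite trmx_mul trmxK trmx0 => v0.
have HP := diagonalized_shift a 1; rewrite scale1r in HP.
have := vnsq_diagonalized _ _ v^T HP; rewrite v0 {1}/vnsq big1; last first.
  by move=> i _; rewrite mxE nsq0.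
move/esym/eqP; rewrite psumr_eq0 => [/allP q0|i _]; last first.
  by rewrite mulr_ge0 ?sqr_ge0 ?nsq_ge0.
suff : P *m v^T = 0.
  by move/(congr1 (fun q => (P^t* *m q)^T)); rewrite mulmxA PP mul1mx mulmx0 trmxK trmx0.
apply/matrixP => i j; rewrite (ord1 j) [RHS]mxE; apply: nsq_eq0; apply/eqP.
have := q0 i; rewrite mem_index_enum mul1r => /(_ isT); rewrite mulf_eq0 sqrf_eq0.
by rewrite gt_eqF//= addr_gt0.
Qed.

Lemma vnormE (x : 'cV[C]_r) : vnorm x = Num.sqrt (vnsq x).
Proof. by rewrite /vnorm vnsqE. Qed.

(** In the coordinates given by [P] the squared norm is a weighted mean of the squares of the [e i];
    the j-th eigenvector attains the bound. *)
Lemma spectral_norm_diagonalized (M : 'M[C]_r) (e : 'I_r -> R) j :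
  M = P^t* *m diag_mx (\row_i (e i)%:C) *m P ->
  (forall i, 0 <= e i <= e j) -> spectral_norm M = e j.
Proof.
move=> ME ej; have e0 : 0 <= e j by case/andP: (ej j).
pose x : 'cV[C]_r := P^t* *m delta_mx j 0.
have Px : P *m x = delta_mx j 0 by rewrite mulmxA PP' mul1mx.
have q i : nsq ((P *m x) i 0) = (i == j)%:R.
  by rewrite Px mxE eqxx andbT -(rmorph_nat (real_complex R)) nsqC; case: eqP => _; rewrite ?expr1n ?expr0n.
have x1 : vnorm x = 1.
  rewrite vnormE -(unitary_vnsq _ P)// /vnsq (bigD1 j)//= big1 ?q ?eqxx ?addr0 ?sqrtr1// => i ij.
  by rewrite q (negbTE ij).
have ub : ubound [set vnorm (M *m v) | v in [set v | vnorm v = 1]] (e j).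
  move=> _ [v /= v1 <-]; rewrite vnormE -(ger0_norm e0) -sqrtr_sqr ler_wsqrtr//.
  rewrite (vnsq_diagonalized _ _ _ ME) -[leRHS]mulr1.
  have -> : 1 = vnsq (P *m v).
    by move: v1; rewrite unitary_vnsq// vnormE => /(congr1 (fun x => x ^+ 2)); rewrite sqr_sqrtr ?vnsq_ge0// expr1n.
  rewrite mulr_sumr; apply: ler_sum => i _; apply: ler_wpM2r; first exact: nsq_ge0.
  by have /andP[? ?] := ej i; rewrite ler_pXn2r ?nnegrE.
have Mx : vnorm (M *m x) = e j.
  rewrite vnormE (vnsq_diagonalized _ _ _ ME) (bigD1 j)//= big1 => [|i ij].
    by rewrite q eqxx mulr1 addr0 sqrtr_sqr ger0_norm.
  by rewrite q (negbTE ij) mulr0.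
apply/eqP; rewrite eq_le; apply/andP; split.
  by apply: ge_sup => //; exists (vnorm (M *m x)), x.
by rewrite -Mx; apply: ub_le_sup; [exists (e j)|exists x].
Qed.

(** The inverse has the same eigenvectors and the reciprocal eigenvalues, the largest of which
    belongs to the smallest one, [d i]. *)
Lemma spectral_cond_posdef i j : (forall k, d i <= d k <= d j) ->
  spectral_cond H = d j / d i.
Proof.
move=> dk; rewrite /spectral_cond; congr (_ * _).
  apply: spectral_norm_diagonalized HE _ => k.
  by rewrite (ltW (d0 k)); case/andP: (dk k).
apply: (spectral_norm_diagonalized _ (fun k => (d k)^-1) i) => [|k]; last first.
  by rewrite invr_ge0 (ltW (d0 k)) lef_pV2 ?posrE//; case/andP: (dk k).
have HV : P^t* *m diag_mx (\row_k ((d k)^-1)%:C) *m P *m H = 1%:M.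
  rewrite {1}HE !mulmxA mulmxtVK; last exact/unitarymxP.
  rewrite -(mulmxA (P^t*)) (_ : diag_mx _ *m diag_mx _ = 1%:M) ?mulmx1//.
  apply/matrixP => k l; rewrite mul_diag_mx !mxE mulrnAr -rmorphM mulVf//.
  by rewrite gt_eqF.
have [_ Hu] := mulmx1_unit HV.
by rewrite -[LHS]mul1mx -HV mulmxK.
Qed.

End Spectral.

(** * The contraction factor and its optimal parameter *)

Section ContractionFactor.
Implicit Types a l m M s : R.

Lemma set_max_eq (E : set R) m : E m -> ubound E m -> set_max E = m.
Proof.
move=> Em Um; have /(@xgetPex _ 0)[Ex Ux] : exists x, E x /\ ubound E x by exists m.
by apply/eqP; rewrite eq_le (Um _ Ex) (Ux _ Em).
Qed.

Definition rate l a : R := `|(a - l) / (a + l)|.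

(** Monotonicity in the eigenvalue forces the absolute value to be largest at an endpoint of any
    interval of eigenvalues. *)
Lemma rate_decr a l m : 0 < a -> 0 < l -> l <= m -> (a - m) / (a + m) <= (a - l) / (a + l).
Proof.
move=> a0 l0 lm; have m0 := lt_le_trans l0 lm.
by rewrite ler_pdivrMr ?addr_gt0// mulrAC ler_pdivlMr ?addr_gt0//; nra.
Qed.

Lemma rate_le_max a l m M : 0 < a -> 0 < m -> m <= l <= M ->
  rate l a <= Num.max (rate m a) (rate M a).
Proof.
move=> a0 m0 /andP[ml lM]; have l0 := lt_le_trans m0 ml.
have := rate_decr _ _ _ a0 m0 ml; have := rate_decr _ _ _ a0 l0 lM; rewrite /rate.
move: (_ / (a + l)) (_ / (a + m)) (_ / (a + M)) => x y z zx xy.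
rewrite le_max; have [x0|x0] := lerP 0 x.
  by rewrite (ger0_norm x0) (le_trans xy (ler_norm y)).
by rewrite (ltr0_norm x0) (ltr0_norm (le_lt_trans zx x0)) lerN2 zx orbT.
Qed.

Lemma rate_lt1 a l : 0 < a -> 0 < l -> rate l a < 1.
Proof.
move=> a0 l0; rewrite /rate normrM normfV [`|a + l|]ger0_norm ?addr_ge0 ?ltW//.
rewrite ltr_pdivrMr ?addr_gt0// mul1r ltr_norml; apply/andP; split; lra.
Qed.

Lemma worst_rateE m M a : 0 < m -> m <= M -> 0 < a ->
  worst_rate m M a = Num.max (rate m a) (rate M a).
Proof.
move=> m0 mM a0; apply: set_max_eq => /=.
  rewrite /Num.max; case: ifP => _; [exists M|exists m] => //=; rewrite in_itv/= ?lexx ?mM//.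
by move=> x [l /=]; rewrite in_itv/= => mlM <-; exact: rate_le_max.
Qed.

Lemma normc_real (x : R) : ComplexField.Normc.normc x%:C = `|x|.
Proof. by rewrite /ComplexField.Normc.normc/= expr0n addr0 sqrtr_sqr. Qed.

(** Only the extreme eigenvalues count, so the maximum over the finite spectrum agrees with
    [worst_rate] over the whole interval. *)
Lemma sigmaE r (H : 'M[C]_r) m M a : 0 < m -> 0 < a ->
  spectrum H m%:C -> spectrum H M%:C ->
  (forall z, spectrum H z -> exists2 x, z = x%:C & m <= x <= M) ->
  sigma H a = Num.max (rate m a) (rate M a).
Proof.
have E l : ComplexField.Normc.normc ((a%:C - l%:C) / (a%:C + l%:C)) = rate l a.
  by rewrite -rmorphB -rmorphD -fmorph_div normc_real.
move=> m0 a0 Hm HM Hl; apply: set_max_eq => /=.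
  by rewrite /Num.max; case: ifP => _; [exists M%:C|exists m%:C].
by move=> _ [l /Hl[x -> xmM] <-]; rewrite E; exact: rate_le_max.
Qed.

Section OptimalParameter.
Variables m M : R.
Hypotheses (m0 : 0 < m) (mM : m <= M).
Let s := Num.sqrt (m * M).

(** At [s] the two endpoint rates balance: (s - m) / (s + m) = (M - s) / (M + s) amounts to s^2 = m
    M. *)
Lemma rate_sqrt : 
  Num.max (rate m s) (rate M s) = (Num.sqrt M - Num.sqrt m) / (Num.sqrt M + Num.sqrt m).
Proof.
have M0 := lt_le_trans m0 mM.
have E : s = Num.sqrt m * Num.sqrt M by rewrite /s sqrtrM ?(ltW m0).
have u0 : 0 < Num.sqrt m by rewrite sqrtr_gt0.
have uv : Num.sqrt m <= Num.sqrt M by rewrite ler_wsqrtr.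
have um : m = Num.sqrt m ^+ 2 by rewrite sqr_sqrtr// ltW.
have vM : M = Num.sqrt M ^+ 2 by rewrite sqr_sqrtr// ltW.
rewrite /rate E [X in (_ - X) / _]um [X in (_ / (_ + X))]um.
rewrite [X in Num.max _ `|(_ - X) / _|]vM [X in Num.max _ `|_ / (_ + X)|]vM.
move: (Num.sqrt m) (Num.sqrt M) u0 uv => u v u0 uv; have v0 := lt_le_trans u0 uv.
have -> : (u * v - u ^+ 2) / (u * v + u ^+ 2) = (v - u) / (v + u).
  by field; rewrite !gt_eqF// addr_gt0// ?mulr_gt0 ?exprn_gt0.
have -> : (u * v - v ^+ 2) / (u * v + v ^+ 2) = - ((v - u) / (v + u)).
  by field; rewrite !gt_eqF// addr_gt0// ?mulr_gt0 ?exprn_gt0.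
by rewrite normrN maxxx ger0_norm// divr_ge0 ?subr_ge0// addr_ge0// ltW.
Qed.

(** To the right of [s] the rate at [m] exceeds the balanced value, to the left the rate at [M]
    does. Strictness makes the minimiser unique. *)
Lemma rate_sqrt_lt a : 0 < a -> a != s ->
  Num.max (rate m s) (rate M s) < Num.max (rate m a) (rate M a).
Proof.
move=> a0 as_; have M0 := lt_le_trans m0 mM.
have s0 : 0 < s by rewrite sqrtr_gt0 mulr_gt0.
have ss : s ^+ 2 = m * M by rewrite sqr_sqrtr// mulr_ge0// ltW.
have ms : m <= s by rewrite -(@ler_pXn2r _ 2%N) ?nnegrE ?(ltW m0) ?(ltW s0)// ss expr2 ler_pM2l.
have sM : s <= M by rewrite -(@ler_pXn2r _ 2%N) ?nnegrE ?(ltW M0) ?(ltW s0)// ss expr2 ler_pM2r.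
have Em : rate m s = (s - m) / (s + m) by rewrite /rate ger0_norm// divr_ge0 ?subr_ge0// addr_ge0// ltW.
have EM : rate M s = (s - m) / (s + m).
  rewrite /rate ler0_norm; last by rewrite mulr_le0_ge0 ?subr_le0// invr_ge0 addr_ge0// ltW.
  have sM0 : s + M != 0 by rewrite gt_eqF// addr_gt0.
  have sm0 : s + m != 0 by rewrite gt_eqF// addr_gt0.
  apply/eqP; rewrite -mulNr opprB eqr_div//; apply/eqP; rewrite expr2 in ss; nra.
rewrite Em EM maxxx lt_max.
have [sa|sa] := ltrP s a.
  apply/orP; left; rewrite /rate; apply: lt_le_trans (ler_norm _).
  rewrite ltr_pdivrMr ?addr_gt0// mulrAC ltr_pdivlMr ?addr_gt0// -subr_gt0.
  by rewrite (_ : _ - _ = 2 * (m * (a - s))); [rewrite !mulr_gt0// subr_gt0|ring].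
have {}sa : a < s by rewrite lt_neqAle as_.
apply/orP; right; rewrite -EM /rate ler0_norm; last first.
  by rewrite mulr_le0_ge0 ?subr_le0// invr_ge0 addr_ge0// ltW.
rewrite -normrN; apply: lt_le_trans (ler_norm _).
rewrite -!mulNr !opprB ltr_pdivrMr ?addr_gt0// mulrAC ltr_pdivlMr ?addr_gt0// -subr_gt0.
by rewrite (_ : _ - _ = 2 * (M * (s - a))); [rewrite !mulr_gt0// subr_gt0|ring].
Qed.

Lemma argmin_worst_rate : argmin_pos (worst_rate m M) = [set s].
Proof.
have M0 := lt_le_trans m0 mM.
have s0 : 0 < s by rewrite sqrtr_gt0 mulr_gt0.
apply/seteqP; split => a /=.
  move=> [a0 /(_ s s0)]; rewrite !worst_rateE// => H.
  by apply/eqP; apply: contraTT H => as_; rewrite -ltNge rate_sqrt_lt.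
move=> ->; split => // b b0; rewrite !worst_rateE//.
by have [->//|bs] := eqVneq b s; rewrite ltW// rate_sqrt_lt.
Qed.

Lemma sqrt_cond : (Num.sqrt M - Num.sqrt m) / (Num.sqrt M + Num.sqrt m) =
  (Num.sqrt (M / m) - 1) / (Num.sqrt (M / m) + 1).
Proof.
have M0 := lt_le_trans m0 mM.
have u0 : 0 < Num.sqrt m by rewrite sqrtr_gt0.
have v0 : 0 < Num.sqrt M by rewrite sqrtr_gt0.
rewrite sqrtrM ?(ltW M0)// sqrtrV ?(ltW m0)//.
by field; rewrite !gt_eqF// ?addr_gt0.
Qed.

End OptimalParameter.
End ContractionFactor.
End MatrixNorms.

(** * The operator B d/dt + M *)

Section VectorL2.
Local Open Scope sesquilinear_scope.
Context {R : realType} {r : nat}.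
Local Notation C := R[i].
Local Notation mu := (@lebesgue_measure R).
Local Notation Re := (@complex.Re R).
Local Notation Im := (@complex.Im R).
Local Notation fn := (R -> 'cV[C]_r).
Implicit Types (u v w g h : fn) (M : 'M[C]_r).

Lemma L2P v : L2 v <-> forall i, cL2 (fun t => v t i 0).
Proof. by split=> H i; have [] := H i. Qed.

Lemma L2_lin (c : C) u v : L2 u -> L2 v -> L2 (c *: u + v).
Proof.
move=> u2 v2; apply/L2P => i.
rewrite (_ : (fun t => _) = fun t => c * u t i 0 + v t i 0).
  by apply: cL2D; [apply: cL2Z; exact: (L2P u).1|exact: (L2P v).1].
by apply/funext => t; rewrite !mxE.
Qed.

Lemma L2_0 : L2 (0 : fn).
Proof.
by apply/L2P => i; rewrite (_ : (fun t => _) = fun=> 0); [exact: cL2_0|apply/funext => t; rewrite mxE].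
Qed.

Lemma L2D u v : L2 u -> L2 v -> L2 (u + v).
Proof. by move=> u2 v2; have := L2_lin 1 _ _ u2 v2; rewrite scale1r. Qed.

Lemma L2B u v : L2 u -> L2 v -> L2 (u - v).
Proof. by move=> u2 v2; rewrite addrC -scaleN1r; exact: L2_lin. Qed.

Definition mulf M v : fn := fun t => M *m v t.

Lemma L2_mulf M v : L2 v -> L2 (mulf M v).
Proof.
move=> v2; apply/L2P => i; under eq_fun do rewrite mxE.
by apply: (cL2_sum _ (index_enum _)) => j; apply: cL2Z; exact: (L2P v).1.
Qed.

Definition vn2 v : R := \sum_i n2 (fun t => v t i 0).

Lemma vn2_ge0 v : 0 <= vn2 v.
Proof. by apply: sumr_ge0 => i _; exact: n2_ge0. Qed.

Lemma vn2_EFin v : L2 v -> (vn2 v)%:E = (\int[mu]_t (vnsq (v t))%:E)%E.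
Proof.
move=> v2; rewrite /vnsq /vn2; under eq_integral do rewrite -sumEFin.
rewrite (integral_sum measurableT (fun i => nsq_integrable _ ((L2P v).1 v2 i))).
by rewrite -sumEFin; apply: eq_bigr => i _; rewrite n2_EFin//; exact: (L2P v).1.
Qed.

Lemma vn2E v : L2 v -> vn2 v = \int[mu]_t vnsq (v t).
Proof. by move/vn2_EFin/(congr1 fine). Qed.

Lemma normLE v : L2 v -> normL v = (Num.sqrt (vn2 v))%:E.
Proof.
move=> v2; rewrite /normL asboolT// vn2E//; congr (Num.sqrt _)%:E.
by rewrite /innerL /cintegral/=; apply: eq_Rintegral => t _; rewrite vnsqE.
Qed.

Lemma normL_fin v : (normL v < +oo)%E -> L2 v.
Proof. by rewrite /normL; case: asboolP. Qed.

Lemma vnsq_integrable v : L2 v -> mu.-integrable setT (fun t => (vnsq (v t))%:E).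
Proof.
move=> v2; rewrite (_ : (fun t => _) = fun t => (\sum_i (nsq (v t i 0))%:E)%E); last first.
  by apply/funext => t; rewrite sumEFin.
by apply: integrable_sum => // i _; apply: nsq_integrable; exact: (L2P v).1.
Qed.

Lemma measurable_vnsq v : (forall i, cmeas (fun t => v t i 0)) ->
  measurable_fun setT (fun t => vnsq (v t)).
Proof. by move=> mv; apply: measurable_sum => i; exact: measurable_nsq. Qed.

Lemma L2_meas v : L2 v -> forall i, cmeas (fun t => v t i 0).
Proof. by move=> /L2P v2 i; exact: cL2_meas. Qed.

Lemma vn2_le (c : R) u v : 0 <= c -> L2 u -> L2 v ->
  {ae mu, forall t, vnsq (u t) <= c * vnsq (v t)} -> vn2 u <= c * vn2 v.
Proof.
move=> c0 u2 v2 uv; rewrite -lee_fin EFinM !vn2_EFin//.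
have mu' := measurable_vnsq _ (L2_meas _ u2); have mv := measurable_vnsq _ (L2_meas _ v2).
have mcv : measurable_fun setT (fun t => c * vnsq (v t)) by apply: measurable_funM.
rewrite -ge0_integralZl_EFin//; last 2 first.
- by move=> t _; rewrite lee_fin vnsq_ge0.
- exact/measurable_EFinP.
apply: ae_ge0_le_integral => //.
- by move=> t _; rewrite lee_fin vnsq_ge0.
- exact/measurable_EFinP.
- by move=> t _; rewrite -EFinM lee_fin mulr_ge0// vnsq_ge0.
- by under eq_fun do rewrite -EFinM; exact/measurable_EFinP.
by apply: ae_sub uv => t uv _; rewrite -EFinM lee_fin.
Qed.

Lemma L2_dom (c : R) u v : L2 v -> (forall i, cmeas (fun t => u t i 0)) ->
  (forall t, vnsq (u t) <= c * vnsq (v t)) -> L2 u.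
Proof.
move=> v2 mu' uv; apply/L2P => i; apply/cL2P; split => //.
have mv := measurable_vnsq _ (L2_meas _ v2).
apply: (@le_lt_trans _ _ (\int[mu]_t (c * vnsq (v t))%:E)%E).
  apply: ge0_le_integral => //.
  - by move=> t _; rewrite lee_fin nsq_ge0.
  - by apply/measurable_EFinP; exact: measurable_nsq.
  - by apply/measurable_EFinP; apply: measurable_funM.
  by move=> t _; rewrite lee_fin (le_trans _ (uv t))// nsq_le_vnsq.
have /integrableP[_] := integrableZl measurableT c (vnsq_integrable _ v2).
apply: le_lt_trans; apply: ge0_le_integral => //.
- by move=> t _; rewrite lee_fin (le_trans _ (uv t))// vnsq_ge0.
- by apply/measurable_EFinP; apply: measurable_funM.
- by apply: measurableT_comp => //; under eq_fun do rewrite -EFinM; apply/measurable_EFinP; apply: measurable_funM.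
by move=> t _; rewrite -EFinM lee_fin ler_norm.
Qed.

(** Measurability of [u] is a separate hypothesis: agreement almost everywhere with a Borel
    measurable function does not imply it. *)
Lemma L2_ae u v : L2 v -> (forall i, cmeas (fun t => u t i 0)) ->
  {ae mu, forall t, u t = v t} -> L2 u.
Proof.
move=> v2 mu' uv; apply/L2P => i; apply/cL2P; split => //.
have /cL2P[mv] := (L2P v).1 v2 i.
apply: le_lt_trans; rewrite le_eqVlt; apply/orP; left; apply/eqP.
apply: ae_eq_integral => //.
- by apply/measurable_EFinP; exact: measurable_nsq.
- by apply/measurable_EFinP; exact: measurable_nsq.
by apply: ae_sub uv => t -> _.
Qed.

Lemma cvg_sumr (I : Type) (s : seq I) (F : I -> nat -> R) (l : I -> R) :
  (forall i, F i n @[n --> \oo] --> l i) ->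
  \sum_(i <- s) F i n @[n --> \oo] --> \sum_(i <- s) l i.
Proof.
move=> Fl; elim: s => [|i s IH].
  by under eq_fun do rewrite big_nil; rewrite big_nil; exact: cvg_cst.
by under eq_fun do rewrite big_cons; rewrite big_cons; apply: cvgD.
Qed.

Definition vcvg (u : nat -> fn) v := forall i, cvgL2 (fun n t => u n t i 0) (fun t => v t i 0).

Lemma normL_cvgP (u : nat -> fn) v : (forall n, L2 (u n)) -> L2 v ->
  normL (u n - v) @[n --> \oo] --> 0%E <-> vcvg u v.
Proof.
move=> u2 v2; have E n : normL (u n - v) = (Num.sqrt (vn2 (u n - v)))%:E by rewrite normLE//; exact: L2B.
have Ei n i : n2 (fun t => (u n - v) t i 0) = n2 (fun t => u n t i 0 - v t i 0).
  by congr n2; apply/funext => t; rewrite !mxE.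
under eq_fun do rewrite E.
split=> [/fine_cvgP[_ c0] i|c0].
  have {}c0 : Num.sqrt (vn2 (u n - v)) @[n --> \oo] --> (0 : R) := c0.
  have {}c0 : vn2 (u n - v) @[n --> \oo] --> (0 : R).
    have c1 := cvgM c0 c0; rewrite mulr0 in c1.
    rewrite (_ : (fun n => _) = fun n => Num.sqrt (vn2 (u n - v)) * Num.sqrt (vn2 (u n - v))).
      exact: c1.
    by apply/funext => n; rewrite -expr2 sqr_sqrtr// vn2_ge0.
  apply: (squeeze_cvgr _ (cvg_cst (0 : R)) c0); apply: nearW => n.
  by rewrite n2_ge0 -Ei /vn2 (bigD1 i)//= lerDl sumr_ge0// => j _; exact: n2_ge0.
have {}c0 : vn2 (u n - v) @[n --> \oo] --> (0 : R).
  have -> : (0 : R) = \sum_(i < r) 0 by rewrite big1.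
  apply: cvg_sumr => i; under eq_fun do rewrite Ei; exact: c0.
have c1 := continuous_cvg _ (@sqrt_continuous R 0) c0; rewrite sqrtr0 in c1.
by apply/fine_cvgP; split; [exact: nearW|exact: c1].
Qed.

Definition vfourier v w := forall i, fourier (fun t => v t i 0) (fun t => w t i 0).

Lemma vfourier_L2 v w : vfourier v w -> L2 v /\ L2 w.
Proof. by move=> vw; split; apply/L2P => i; have [] := vw i. Qed.

Lemma truncated_fourierE n v om i :
  truncated_fourier n v om i 0 = fint `[- n%:R, n%:R] (fun t => v t i 0) om.
Proof.
rewrite /truncated_fourier /fint !mxE; congr (_ * cintegral _ _).
by apply/funext => t; rewrite mxE.
Qed.

Lemma is_fourierP v w : L2 v -> is_fourier v w <-> vfourier v w.
Proof.
move=> v2; have t2 n : L2 (truncated_fourier n v).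
  apply/L2P => i; under eq_fun do rewrite truncated_fourierE.
  by have [] := fourier_ccut (- n%:R) n%:R _ ((L2P v).1 v2 i).
have E : vfourier v w <-> L2 w /\ vcvg (fun n => truncated_fourier n v) w.
  rewrite /vcvg; under eq_forall do under eq_fun do under eq_fun do rewrite truncated_fourierE.
  split=> [vw|[w2 c] i].
    split; first exact: (vfourier_L2 _ _ vw).2.
    by move=> i; exact: ((fourierP _ _ ((L2P v).1 v2 i)).1 (vw i)).2.
  by apply/(fourierP _ _ ((L2P v).1 v2 i)); split; [exact: (L2P w).1|exact: c].
rewrite E /is_fourier; split=> -[w2 c]; split=> //; exact/(normL_cvgP _ _ t2 w2).
Qed.

Lemma vfourier_exists v : L2 v -> exists w, vfourier v w.
Proof.
move=> v2; have /choice[F HF] i : exists y, fourier (fun t => v t i 0) y.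
  exact: fourier_exists ((L2P v).1 v2 i).
exists (fun t => \col_i F i t) => i.
by have := HF i; congr fourier; apply/funext => t; rewrite mxE.
Qed.

Lemma vfourier_surj w : L2 w -> exists v, vfourier v w.
Proof.
move=> w2; have /choice[F HF] i : exists y, fourier y (fun t => w t i 0).
  exact: fourier_surj ((L2P w).1 w2 i).
exists (fun t => \col_i F i t) => i.
by have := HF i; congr fourier; apply/funext => t; rewrite mxE.
Qed.

Lemma vfourier_lin (c : C) u w v z : vfourier u w -> vfourier v z ->
  vfourier (c *: u + v) (c *: w + z).
Proof.
move=> uw vz i; have := fourier_lin c _ _ _ _ (uw i) (vz i).
by congr fourier; apply/funext => t; rewrite !mxE.
Qed.

Lemma vfourier_vn2 v w : vfourier v w -> vn2 w = vn2 v.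
Proof. by move=> vw; apply: eq_bigr => i _; exact: fourier_n2. Qed.

Lemma fourier_sum (s : seq 'I_r) (F G : 'I_r -> R -> C) : (forall i, fourier (F i) (G i)) ->
  fourier (fun t => \sum_(i <- s) F i t) (fun t => \sum_(i <- s) G i t).
Proof.
move=> FG; elim: s => [|i s IH].
  (* The empty sum: the zero function is 0 times any known pair. *)
  have := fourierZ 0 _ _ (FT_fourier _ _ (@FT_itv R 0 0)).
  by congr fourier; apply/funext => t; rewrite mul0r big_nil.
have := fourierD _ _ _ _ (FG i) IH.
by congr fourier; apply/funext => t; rewrite big_cons.
Qed.

Lemma vfourier_mulf M v w : vfourier v w -> vfourier (mulf M v) (mulf M w).
Proof.
move=> vw i; have := fourier_sum (index_enum _) _ _ (fun j => fourierZ (M i j) _ _ (vw j)).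
by congr fourier; apply/funext => t; rewrite mxE.
Qed.

Lemma vcomplete (u : nat -> fn) : (forall n, L2 (u n)) ->
  (forall e : R, 0 < e -> exists N, forall m n, (N <= m)%N -> (N <= n)%N -> vn2 (u m - u n) <= e) ->
  exists2 w, L2 w & vcvg u w.
Proof.
move=> u2 cu.
have /choice[F HF] i : exists y, cL2 y /\ cvgL2 (fun n t => u n t i 0) y.
  have [|y y2 cy] := cL2_complete (fun n t => u n t i 0) (fun n => (L2P _).1 (u2 n) i).
    move=> e /cu[N HN]; exists N => m n Nm Nn; apply: le_trans (HN _ _ Nm Nn).
    rewrite (_ : (fun t => _) = fun t => (u m - u n) t i 0); last first.
      by apply/funext => t; rewrite !mxE.
    by rewrite /vn2 (bigD1 i)//= lerDl sumr_ge0// => j _; exact: n2_ge0.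
  by exists y.
have E i : (fun t => (\col_i F i t : 'cV[C]_r) i 0) = F i by apply/funext => t; rewrite mxE.
exists (fun t => \col_i F i t); first by apply/L2P => i; rewrite E; case: (HF i).
by move=> i; rewrite E; case: (HF i).
Qed.

Implicit Types phi : R -> R.

Lemma distr_ofE v phi i : distr_of v phi i 0 = cip (fun t => v t i 0) (fun t => (phi t)%:C).
Proof.
rewrite /distr_of /vintegral mxE; congr cintegral; apply/funext => t.
by rewrite mxE mulrC; congr (_ * _); apply: ceqP; rewrite !cpartE ?oppr0.
Qed.

Lemma distr_of_lin (c : C) u v phi : L2 u -> L2 v -> test_function phi ->
  distr_of (c *: u + v) phi = c *: distr_of u phi + distr_of v phi.
Proof.
move=> u2 v2 tp; apply/matrixP => i j; rewrite (ord1 j) distr_ofE [RHS]mxE [X in _ = X + _]mxE !distr_ofE -cip_lin.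
- by apply: (congr1 (fun x => cip x _)); apply/funext => t; rewrite !mxE.
- exact: (L2P u).1.
- exact: (L2P v).1.
- exact: test_cL2.
Qed.

Lemma distr_of_mulf M v phi : L2 v -> test_function phi ->
  distr_of (mulf M v) phi = M *m distr_of v phi.
Proof.
move=> v2 tp; apply/matrixP => i j; rewrite (ord1 j) distr_ofE [RHS]mxE.
under [RHS] eq_bigr do rewrite distr_ofE.
have tp2 := test_cL2 _ tp.
rewrite (_ : (fun t => _) = fun t => \sum_j M i j * v t j 0); last first.
  by apply/funext => t; rewrite mxE.
elim: (index_enum _) => [|k s IH].
  rewrite big_nil; under eq_fun do rewrite big_nil.
  have := cipZl 0 _ _ cL2_0 tp2; under eq_fun do rewrite mul0r.
  by rewrite mul0r.
under eq_fun do rewrite big_cons; rewrite big_cons -IH -cip_lin//.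
  exact: (L2P v).1.
by apply: (cL2_sum _ s) => l; apply: cL2Z; exact: (L2P v).1.
Qed.

Lemma distr_of_eq0 g : L2 g -> (forall phi, test_function phi -> distr_of g phi = 0) ->
  vn2 g = 0.
Proof.
move=> g2 H; apply: big1 => i _; have gi := (L2P g).1 g2 i.
have : {ae mu, forall t, g t i 0 = 0}.
  apply: ae0_of_test => // phi tp; have := H _ tp.
  move=> /matrixP/(_ i 0); rewrite distr_ofE [X in _ = X]mxE => H0.
  by rewrite cipC ?H0 ?conjc0//; exact: test_cL2.
move=> g0; rewrite (eq_n2 _ _ gi cL2_0 g0) /n2 nsq0.
by rewrite /Rintegral integral0.
Qed.

End VectorL2.

(** * First-order operators, their symbols and graph closures *)

Section FirstOrderOperator.
Local Open Scope sesquilinear_scope.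
Context {R : realType} {r : nat}.
Local Notation C := R[i].
Local Notation mu := (@lebesgue_measure R).
Local Notation fn := (R -> 'cV[C]_r).
Implicit Types (u v w z g h : fn) (M N B : 'M[C]_r).

Lemma cvgL2_0 : cvgL2 (fun (_ : nat) (_ : R) => 0 : C) (fun=> 0).
Proof. by rewrite /cvgL2 /n2 subrr nsq0 /Rintegral integral0; exact: cvg_cst. Qed.

Lemma eq_cvgL2 (u u' : nat -> R -> C) (f f' : R -> C) : (forall n t, u n t = u' n t) ->
  (forall t, f t = f' t) -> cvgL2 u f -> cvgL2 u' f'.
Proof.
move=> uu ff; have -> : u = u' by apply/funext => n; apply/funext => t.
by have -> : f = f' by apply/funext => t.
Qed.

Lemma vcvg_lin (c : C) (u v : nat -> fn) (f g : fn) :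
  (forall n, L2 (u n)) -> (forall n, L2 (v n)) -> L2 f -> L2 g ->
  vcvg u f -> vcvg v g -> vcvg (fun n => c *: u n + v n) (c *: f + g).
Proof.
move=> u2 v2 f2 g2 uf vg i.
have H := cvgL2_lin c _ _ _ _ (fun n => (L2P _).1 (u2 n) i) (fun n => (L2P _).1 (v2 n) i)
  ((L2P _).1 f2 i) ((L2P _).1 g2 i) (uf i) (vg i).
by apply: eq_cvgL2 H => [n t|t]; rewrite !mxE.
Qed.

Lemma vcvg_mulf M (u : nat -> fn) f : (forall n, L2 (u n)) -> L2 f ->
  vcvg u f -> vcvg (fun n => mulf M (u n)) (mulf M f).
Proof.
move=> u2 f2 uf i.
suff H s : cvgL2 (fun n t => \sum_(j <- s) M i j * u n t j 0) (fun t => \sum_(j <- s) M i j * f t j 0).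
  by apply: eq_cvgL2 (H (index_enum _)) => [n t|t]; rewrite /mulf mxE.
elim: s => [|k s IH].
  by apply: eq_cvgL2 cvgL2_0 => [n t|t]; rewrite big_nil.
have s2 (x : fn) : L2 x -> cL2 (fun t => \sum_(j <- s) M i j * x t j 0).
  by move=> x2; apply: (cL2_sum _ s) => l; apply: cL2Z; exact: (L2P x).1.
have H := cvgL2_lin (M i k) _ _ _ _ (fun n => (L2P _).1 (u2 n) k) (fun n => s2 _ (u2 n))
  ((L2P _).1 f2 k) (s2 _ f2) (uf k) IH.
by apply: eq_cvgL2 H => [n t|t]; rewrite big_cons.
Qed.

(** The weak form of B v' + M v = g, the derivative having passed to the test function. *)
Definition dop B M v g := forall phi, test_function phi ->
  - (B *m distr_of v (derive1 phi)) + M *m distr_of v phi = distr_of g phi.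

(** [B] is constant, so it can be moved inside the derivative; what is differentiated is [B v],
    which makes sense for singular [B] too. *)
Lemma dopP B M v g : L2 v -> L2 g -> dop B M v g <->
  forall i, wderiv (fun t => mulf B v t i 0) (fun t => (g - mulf M v) t i 0).
Proof.
move=> v2 g2.
have E phi : test_function phi ->
    distr_of (g - mulf M v) phi = distr_of g phi - M *m distr_of v phi.
  move=> tp; rewrite addrC -scaleN1r distr_of_lin//; last exact: L2_mulf.
  by rewrite distr_of_mulf// scaleN1r addrC.
split=> [H i phi tp|H phi tp].
  rewrite -!distr_ofE distr_of_mulf//; last exact: test_derive.
  by rewrite E// -H// addrK [X in _ = - X]mxE opprK.
have -> : B *m distr_of v (derive1 phi) = - distr_of (g - mulf M v) phi.
  apply/matrixP => i j; rewrite (ord1 j) [RHS]mxE -distr_of_mulf//; last exact: test_derive.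
  by have := H i phi tp; rewrite -!distr_ofE.
by rewrite E// opprK subrK.
Qed.

Lemma dop_lin B M (c : C) u v g h : L2 u -> L2 v -> L2 g -> L2 h ->
  dop B M u g -> dop B M v h -> dop B M (c *: u + v) (c *: g + h).
Proof.
move=> u2 v2 g2 h2 ug vh phi tp; have td := test_derive _ tp.
rewrite !distr_of_lin// -ug// -vh// !mulmxDr -!scalemxAr scalerDr scalerN.
by rewrite opprD addrACA.
Qed.

Lemma dop_shift B M N v g : L2 v -> L2 g -> dop B M v g -> dop B (M + N) v (g + mulf N v).
Proof.
move=> v2 g2 vg phi tp; rewrite (addrC g) -[mulf N v]scale1r.
rewrite distr_of_lin//; last exact: L2_mulf.
by rewrite scale1r distr_of_mulf// -vg// mulmxDl addrA addrC.
Qed.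

Lemma cipNr (f y : R -> C) : cL2 f -> cL2 y -> cip f (fun t => -1 * y t) = - cip f y.
Proof.
move=> f2 y2; rewrite (cipC _ _ (cL2Z _ _ y2) f2) cipZl// mulN1r rmorphN.
by rewrite (cipC _ _ y2 f2).
Qed.

Lemma cvgL2_cst (y : R -> C) : cvgL2 (fun=> y) y.
Proof.
have E : n2 (fun t => y t - y t) = 0.
  by rewrite /n2; under eq_Rintegral do rewrite subrr nsq0; rewrite /Rintegral integral0.
by rewrite /cvgL2 E; exact: cvg_cst.
Qed.

(** The operator is closed: for a fixed test function both sides of the weak equation are inner
    products, continuous in L2. The sign is put into the second factor to fit the equality required
    by [cip_cvg]. *)
Lemma dop_cvg B M (u g : nat -> fn) v h : (forall n, L2 (u n)) -> (forall n, L2 (g n)) ->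
  L2 v -> L2 h -> vcvg u v -> vcvg g h -> (forall n, dop B M (u n) (g n)) -> dop B M v h.
Proof.
move=> u2 g2 v2 h2 uv gh H; apply/dopP => // i phi tp.
have M2 n := L2_mulf M _ (u2 n); have Mv2 := L2_mulf M _ v2.
have B2 n := (L2P _).1 (L2_mulf B _ (u2 n)) i; have Bv2 := (L2P _).1 (L2_mulf B _ v2) i.
have k2 n := (L2P _).1 (L2_lin (-1) _ _ (M2 n) (g2 n)) i.
have l2 := (L2P _).1 (L2_lin (-1) _ _ Mv2 h2) i.
have cB := vcvg_mulf B _ _ u2 v2 uv i.
have cN := vcvg_lin (-1) _ _ _ _ M2 g2 Mv2 h2 (vcvg_mulf M _ _ u2 v2 uv) gh i.
have p2 := test_cL2 _ tp; have d2 := test_cL2 _ (test_derive _ tp).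
have q2 := cL2Z (-1) _ p2.
have E : h - mulf M v = (-1) *: mulf M v + h by rewrite scaleN1r addrC.
rewrite E -(cipNr _ _ l2 p2).
apply: (cip_cvg _ _ _ _ B2 (fun=> d2) Bv2 d2 cB (cvgL2_cst _) _ _ _ _ k2 (fun=> q2) l2 q2 cN (cvgL2_cst _)) => n.
have := (dopP _ _ _ _ (u2 n) (g2 n)).1 (H n) i phi tp; rewrite (cipNr _ _ (k2 n) p2) => ->.
by rewrite scaleN1r [- _ + _]addrC.
Qed.

Lemma dop_fourier B M v g w z : vfourier v w -> vfourier g z ->
  dop B M v g <-> {ae mu, forall om, z om = ((0 +i* om) *: B + M) *m w om}.
Proof.
move=> vw gz; have [v2 w2] := vfourier_L2 _ _ vw; have [g2 z2] := vfourier_L2 _ _ gz.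
have fB := vfourier_mulf B _ _ vw; have fM := vfourier_mulf M _ _ vw.
have fh := vfourier_lin (-1) _ _ _ _ fM gz.
have E x y : y - mulf M x = (-1) *: mulf M x + y by rewrite scaleN1r addrC.
have Ez om i : ((-1 *: mulf M w + z) om i 0 = (0 +i* om) * mulf B w om i 0) <->
    z om i 0 = (((0 +i* om) *: B + M) *m w om) i 0.
  rewrite mulmxDl -scalemxAl !mxE mulN1r.
  by split=> [<-|->]; [rewrite addrAC addNr add0r|rewrite addrC addrK].
rewrite dopP// E; split=> [H|H i].
  have {}H : {ae mu, forall om, forall i, (-1 *: mulf M w + z) om i 0 = (0 +i* om) * mulf B w om i 0}.
    by apply: ae_forall => i; exact: (wderiv_fourier _ _ _ _ (fB i) (fh i) (H i)).
  by apply: ae_sub H => om H; apply/matrixP => i j; rewrite (ord1 j); apply/Ez.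
apply: (fourier_wderiv _ _ _ _ (fB i) (fh i)).
by apply: ae_sub H => om H; apply/Ez; rewrite H.
Qed.

Lemma vn2_sub_eq0 u v : L2 u -> L2 v -> vn2 (u - v) = 0 -> vn2 u = vn2 v.
Proof.
move=> u2 v2 /eqP; rewrite psumr_eq0 => [/allP H|i _]; last exact: n2_ge0.
apply: eq_bigr => i _; have ui := (L2P u).1 u2 i; have vi := (L2P v).1 v2 i.
apply: eq_n2 => //; have := H i; rewrite mem_index_enum => /(_ isT)/eqP ni.
have E : (fun t => (u - v) t i 0) = fun t => u t i 0 - v t i 0.
  by apply/funext => t; rewrite !mxE.
apply: ae_sub (n2_eq0 _ _ ni) => [t|].
  by rewrite !mxE => /eqP; rewrite subr_eq0 => /eqP.
by rewrite E; exact: cL2B.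
Qed.

(** Two L2 functions that define the same distribution agree almost everywhere, so the infimum in
    [normD] is taken over a single value. *)
Lemma normD_distr_of (T : @distr R r) g : L2 g -> eq_distr T (distr_of g) -> normD T = normL g.
Proof.
move=> g2 Tg; rewrite /normD (_ : [set _ | _ in _] = [set normL g]) ?ereal_inf1//.
apply/seteqP; split=> [_ [h [h2 Th] <-]|_ ->]; last by exists g.
rewrite /= !normLE//; congr (Num.sqrt _)%:E; apply: vn2_sub_eq0 => //.
apply: distr_of_eq0 => [|phi tp]; first exact: L2B.
rewrite addrC -scaleN1r distr_of_lin//.
by rewrite scaleN1r -(Tg _ tp) -(Th _ tp) addNr.
Qed.

Lemma normD_fin (T : @distr R r) : (normD T < +oo)%E ->
  exists2 g, L2 g & eq_distr T (distr_of g).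
Proof.
move=> Tf; apply: contrapT => H; move: Tf; rewrite /normD (_ : [set _ | _ in _] = set0).
  by rewrite ereal_inf0 ltxx.
by rewrite -subset0 => x [g [g2 Tg] _]; apply: H; exists g.
Qed.

Lemma normL0 : normL (0 : fn) = 0%E.
Proof.
rewrite (normLE _ L2_0) /vn2 big1 ?sqrtr0// => i _.
rewrite /n2; under eq_Rintegral do rewrite mxE nsq0; by rewrite /Rintegral integral0.
Qed.

(* [rel v g] stands for "T v = g" with T an unbounded closed operator: the
   completion of the domain of T for the graph norm is the domain itself. *)
Lemma completion_domain (N : fn -> \bar R) (rel : fn -> fn -> Prop) :
  rel 0 0 ->
  (forall c u v g h, rel u g -> rel v h -> rel (c *: u + v) (c *: g + h)) ->
  (forall v g, rel v g -> [/\ L2 v, L2 g & N v = normL g]) ->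
  (forall v, L2 v -> (N v < +oo)%E -> exists g, rel v g) ->
  (forall (u g : nat -> fn) v h, (forall n, rel (u n) (g n)) -> L2 v -> L2 h ->
     vcvg u v -> vcvg g h -> exists h', rel v h') ->
  forall v, completion N v <-> exists g, rel v g.
Proof.
move=> rel0 rel_lin relN Nfin relc v; split; last first.
  move=> [g vg]; have [v2 g2 Nv] := relN _ _ vg; split=> //; exists (fun=> v); split.
  - move=> n; exists 1%N, (fun=> 1), (fun=> v); split.
      by move=> _; split=> //; rewrite Nv normLE// ltry.
    by rewrite big_ord1 scale1r.
  - move=> e e0; exists 0%N => m n _ _; rewrite subrr.
    by have [_ _ ->] := relN _ _ rel0; rewrite normL0 lte_fin.
  - by rewrite subrr normL0; exact: cvg_cst.
move=> [v2 [u [us uc uv]]].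
have /choice[g ug] n : exists g, rel (u n) g.
  have [k [c [y [yP ->]]]] := us n.
  apply: (big_rec (fun x => exists g, rel x g)); first by exists 0.
  move=> i x _ [h xh]; have [yi2 yif] := yP i; have [l yl] := Nfin _ yi2 yif.
  by exists (c i *: l + h); exact: rel_lin.
have u2 n : L2 (u n) by have [] := relN _ _ (ug n).
have g2 n : L2 (g n) by have [] := relN _ _ (ug n).
have [|h h2 gh] := vcomplete g g2.
  (* For pairs in the graph, [N] of a difference is the L2 norm of the difference of the images. The
     root appears because [vn2] is the square of that norm. *)
  move=> e e0; have [|n0 Hn0] := uc (Num.sqrt e); first by rewrite sqrtr_gt0.
  exists n0 => m n mn nn; have := Hn0 _ _ mn nn.
  have umn : rel (u m - u n) (g m - g n).
    by have := rel_lin (-1) _ _ _ _ (ug n) (ug m); rewrite !scaleN1r ![- _ + _]addrC.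
  have [_ _ ->] := relN _ _ umn; rewrite normLE; last exact: L2B.
  by rewrite lte_fin ltr_sqrt// => /ltW.
apply: (relc u g v h) => //; exact/normL_cvgP.
Qed.

End FirstOrderOperator.

(** * The WR-HSS iteration *)

Section Method.
Local Open Scope sesquilinear_scope.
Context {R : realType} {r : nat}.
Local Notation C := R[i].
Local Notation mu := (@lebesgue_measure R).
Local Notation fn := (R -> 'cV[C]_r).
Implicit Types (u v w z g h f x : fn) (a : R).

Lemma sigma_contraction (H : 'M[C]_r) a : (0 < r)%N -> hermitian_posdef H -> 0 < a ->
  [/\ 0 <= sigma H a, sigma H a < 1 &
      forall x : 'cV[C]_r, vnsq ((a%:C%:M - H) *m x) <= sigma H a ^+ 2 * vnsq ((a%:C%:M + H) *m x)].
Proof.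
move=> r0 pH a0; have [P [d [PP PP' HE d0]]] := posdef_spectral _ pH.
(* A positive dimension provides an eigenvalue, so that the maximum defining [sigma] is attained and
   is not the default value. *)
pose i0 := Ordinal r0.
have [i _ di] := Order.TotalTheory.arg_minP (P := predT) d (isT : predT i0).
have [j _ dj] := Order.TotalTheory.arg_maxP (P := predT) d (isT : predT i0).
have {}di k : d i <= d k := di k isT.
have {}dj k : d k <= d j := dj k isT.
have sp := spectral_spectrum _ _ _ PP PP' HE.
have sE : sigma H a = Num.max (rate (d i) a) (rate (d j) a).
  apply: (sigmaE _ _ _ _ _ (d0 i) a0) => [||l /sp[k ->]]; [by apply/sp; exists i|by apply/sp; exists j|].
  by exists (d k) => //; rewrite di dj.
have s0 : 0 <= sigma H a by rewrite sE le_max normr_ge0.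
split=> // [|x].
  by rewrite sE gt_max !rate_lt1.
apply: (vnsq_shift_contraction _ _ _ PP PP' HE) => k.
have ad : 0 < a + d k by rewrite addr_gt0.
have : rate (d k) a <= sigma H a.
  by rewrite sE; apply: rate_le_max => //; rewrite di dj.
rewrite /rate normrM normfV (gtr0_norm ad) ler_pdivrMr// => H1.
by rewrite -exprMn -[leLHS]real_normK ?num_real// ler_pXn2r ?nnegrE// mulr_ge0// ltW.
Qed.

Variables (B A : 'M[C]_r).
Hypothesis hB : B \is hermsymmx.

Lemma hpartDspart : hpart A + spart A = A.
Proof.
rewrite /hpart /spart -scalerDr addrACA subrr addr0 -[A in _ *: (A + A)]scale1r -scalerDl scalerA.
by rewrite -[1 + 1]/(2%:R) mulVf ?scale1r// pnatr_eq0.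
Qed.

Lemma spart_skew : (spart A)^t* = - spart A.
Proof.
rewrite /spart adjZ adjD adjN trmxCK -scalerN opprB; congr (_ *: _).
have -> : (2^-1 : C) = (2^-1 : R)%:C by rewrite fmorphV rmorph_nat.
by apply: ceqP; rewrite /= ?oppr0.
Qed.

Lemma Shw_skew om : (Shw B A om)^t* = - Shw B A om.
Proof.
rewrite /Shw adjD spart_skew adjZ opprD; congr (_ + _).
have /is_hermitianmxP := hB; rewrite expr0 scale1r => hBE.
have -> : B^t* = B by rewrite [RHS]hBE.
by rewrite -scaleNr; congr (_ *: _); apply: ceqP; rewrite /= ?oppr0.
Qed.

(** The graph of a + S_h on L2; [relw] is the graph of its symbol. *)
Definition relt a v g := [/\ L2 v, L2 g & dop B (a%:C%:M + spart A) v g].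

Lemma eq_distr_dop a v g :
  eq_distr (alphaI a v + Sh B A v) (distr_of g) <-> dop B (a%:C%:M + spart A) v g.
Proof.
have E phi : (alphaI a v + Sh B A v) phi =
    - (B *m distr_of v (derive1 phi)) + (a%:C%:M + spart A) *m distr_of v phi.
  by rewrite mulmxDl addrCA -mulmxN.
by split=> H phi tp; have := H phi tp; rewrite E.
Qed.

Lemma relt_normt a v g : relt a v g -> normt B A a v = normL g.
Proof. by move=> [v2 g2 /eq_distr_dop vg]; exact: normD_distr_of. Qed.

Lemma relt_lin a (c : C) u v g h : relt a u g -> relt a v h ->
  relt a (c *: u + v) (c *: g + h).
Proof.
by move=> [u2 g2 ug] [v2 h2 vh]; split; [exact: L2_lin|exact: L2_lin|exact: dop_lin].
Qed.

Lemma distr_of0 phi : test_function phi -> distr_of (0 : fn) phi = 0.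
Proof.
move=> tp; have := distr_of_lin (-1) (0 : fn) 0 phi L2_0 L2_0 tp.
by rewrite scaler0 addr0 scaleN1r addNr.
Qed.

Lemma relt0 a : relt a 0 0.
Proof.
split; [exact: L2_0|exact: L2_0|] => phi tp.
by rewrite !distr_of0//; [rewrite !mulmx0 oppr0 addr0|exact: test_derive].
Qed.

Lemma VtP a v : Vt B A a v <-> exists g, relt a v g.
Proof.
apply: completion_domain.
- exact: relt0.
- exact: relt_lin.
- by move=> y g yg; have [y2 g2 _] := yg; split=> //; exact: relt_normt.
- by move=> y y2 /normD_fin[g g2 /eq_distr_dop yg]; exists g.
move=> u g y h ug y2 h2 uy gh; exists h; split=> //.
by apply: (dop_cvg _ _ u g) => // n; have [] := ug n.
Qed.

Definition Mw a w : fn := fun om => (a%:C%:M + Shw B A om) *m w om.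

Definition relw a w z := [/\ L2 w, L2 z & {ae mu, forall om, z om = Mw a w om}].

Lemma cmeas_shift a i j : cmeas (fun om => (a%:C%:M + Shw B A om) i j).
Proof.
rewrite (_ : (fun om => _) = fun om => (a%:C%:M : 'M[C]_r) i j + ((0 +i* om) * B i j + spart A i j)).
  apply: cmeasD; first exact: cmeas_cst.
  apply: cmeasD; last exact: cmeas_cst.
  by apply: cmeasM; [exact: cmeas_imag|exact: cmeas_cst].
by apply/funext => om; rewrite mxE [X in _ + X]mxE [X in _ + (X + _)]mxE.
Qed.

Lemma cmeas_Mw a w : L2 w -> forall i, cmeas (fun om => Mw a w om i 0).
Proof.
by move=> w2; apply: cmeas_mulmx; [exact: cmeas_shift|exact: L2_meas].
Qed.

Lemma relw_L2 a w z : relw a w z -> L2 (Mw a w).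
Proof.
move=> [w2 z2 zw]; apply: (L2_ae _ _ z2); first exact: cmeas_Mw.
by apply: ae_sub zw => om ->.
Qed.

Lemma ae_vn2 u v : L2 u -> L2 v -> {ae mu, forall t, u t = v t} -> vn2 u = vn2 v.
Proof.
move=> u2 v2 uv; apply: eq_bigr => i _; apply: eq_n2; [exact: (L2P u).1|exact: (L2P v).1|].
by apply: ae_sub uv => t ->.
Qed.

Lemma relw_normw a w z : relw a w z -> normw B A a w = normL z.
Proof.
move=> wz; have M2 := relw_L2 _ _ _ wz; have [w2 z2 zw] := wz.
rewrite /normw -/(Mw a w) !normLE//; congr (Num.sqrt _)%:E.
by apply: ae_vn2 => //; apply: ae_sub zw => om ->.
Qed.

Lemma rel_fourier a v w g z : vfourier v w -> vfourier g z -> relt a v g <-> relw a w z.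
Proof.
move=> vw gz; have [v2 w2] := vfourier_L2 _ _ vw; have [g2 z2] := vfourier_L2 _ _ gz.
have E om : (0 +i* om) *: B + (a%:C%:M + spart A) = a%:C%:M + Shw B A om by rewrite addrCA.
split=> [[_ _ /(dop_fourier _ _ _ _ _ _ vw gz) H]|[_ _ H]]; split=> //.
  by apply: ae_sub H => om ->; rewrite E.
by apply/(dop_fourier _ _ _ _ _ _ vw gz); apply: ae_sub H => om ->; rewrite /Mw E.
Qed.

Lemma vcvg_fourier (y u : nat -> fn) v w : (forall n, vfourier (y n) (u n)) -> vfourier v w ->
  vcvg u w -> vcvg y v.
Proof.
move=> yu vw uw i; rewrite /cvgL2; under eq_fun do rewrite -(fourier_n2 _ _ (fourierB _ _ _ _ (yu _ i) (vw i))).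
exact: uw.
Qed.

Lemma relw_lin a (c : C) u v g h : relw a u g -> relw a v h ->
  relw a (c *: u + v) (c *: g + h).
Proof.
move=> [u2 g2 ug] [v2 h2 vh]; split; [exact: L2_lin|exact: L2_lin|].
by apply: ae_sub2 ug vh => om ug vh; rewrite /Mw mulmxDr -scalemxAr -/(Mw a u om) -ug -/(Mw a v om) -vh.
Qed.

(** Closedness of the multiplication operator is inherited from the time domain: the sequence and
    its images are pulled back by the inverse transform, which preserves convergence, and [dop_cvg]
    applies there. *)
Lemma VwP a w : Vw B A a w <-> exists z, relw a w z.
Proof.
apply: completion_domain.
- by split; [exact: L2_0|exact: L2_0|apply: aeW => om; rewrite /Mw mulmx0].
- exact: relw_lin.
- by move=> y g yg; have [y2 g2 _] := yg; split=> //; exact: relw_normw.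
- by move=> y y2 /normL_fin yf; exists (Mw a y); split=> //; apply: aeW.
move=> u g y h ug y2 h2 uy gh.
have /choice[u' u'u] n : exists u', vfourier u' (u n).
  by apply: vfourier_surj; have [] := ug n.
have /choice[g' g'g] n : exists g', vfourier g' (g n).
  by apply: vfourier_surj; have [] := ug n.
have [y' y'y] := vfourier_surj _ y2; have [h' h'h] := vfourier_surj _ h2.
exists h; apply/(rel_fourier _ _ _ _ _ y'y h'h).
have [y'2 _] := vfourier_L2 _ _ y'y; have [h'2 _] := vfourier_L2 _ _ h'h.
have ug' n : relt a (u' n) (g' n) by apply/(rel_fourier _ _ _ _ _ (u'u n) (g'g n)).
split=> //; apply: (dop_cvg _ _ u' g') => //; try by move=> n; have [] := ug' n.
- exact: (vcvg_fourier _ _ _ _ u'u y'y).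
- exact: (vcvg_fourier _ _ _ _ g'g h'h).
Qed.

(** The symbol is inverted at each frequency; the bound 1 / a on the inverses does not depend on the
    frequency, so the solution stays in L2. *)
Lemma relw_solve a h : 0 < a -> L2 h -> exists w, relw a w h.
Proof.
move=> a0 h2; have uM om := skew_shift_unit a _ (Shw_skew om) a0.
exists (fun om => invmx (a%:C%:M + Shw B A om) *m h om); split=> //.
  apply: (L2_dom (a ^- 2) _ _ h2).
    by apply: cmeas_mulmx; [exact: (cmeas_invmx _ _ uM (cmeas_shift a))|exact: L2_meas].
  by move=> om; exact: (vnsq_skew_shift_inv _ _ (Shw_skew om)).
by apply: aeW => om; rewrite /Mw mulKVmx.
Qed.

Lemma relt_solve a h : 0 < a -> L2 h -> exists v, relt a v h.
Proof.
move=> a0 h2; have [z hz] := vfourier_exists _ h2; have [_ z2] := vfourier_L2 _ _ hz.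
have [w wz] := relw_solve _ _ a0 z2; have [w2 _ _] := wz.
by have [v vw] := vfourier_surj _ w2; exists v; apply/(rel_fourier _ _ _ _ _ vw hz).
Qed.

Local Notation H := (hpart A).
Let shiftD a : 'M[C]_r := a%:C%:M + H.
Let shiftB a : 'M[C]_r := a%:C%:M - H.

(* The two half steps say that S_h x = ... and S_h x' = ..., up to a shift by a. *)
Definition rhs1 a f x xh : fn := (2 * a)%:C *: x + ((-1) *: mulf (shiftD a) xh + f).
Definition rhs2 a f xh : fn := mulf (shiftB a) xh + f.

Lemma rhs1E a f x xh t :
  rhs1 a f x xh t = (2 * a)%:C *: x t - shiftD a *m xh t + f t.
Proof. by rewrite -addrA -[- (_ *m _)]scaleN1r. Qed.

Lemma L2_rhs1 a f x xh : L2 f -> L2 x -> L2 xh -> L2 (rhs1 a f x xh).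
Proof. by move=> f2 x2 xh2; apply: L2_lin => //; apply: L2_lin => //; exact: L2_mulf. Qed.

Lemma L2_rhs2 a f xh : L2 f -> L2 xh -> L2 (rhs2 a f xh).
Proof. by move=> f2 xh2; apply: L2D => //; exact: L2_mulf. Qed.

Lemma double_scalar a (y : 'cV[C]_r) : (2 * a)%:C *: y = a%:C%:M *m y + a%:C%:M *m y.
Proof. by rewrite mul_scalar_mx -scalerDl -rmorphD mulr2n mulrDl !mul1r. Qed.

(** With p = a x, s = S_h x, h = (a + H) xh and q = f, the left side is the first half step and the
    right side gives (a + S_h) x. *)
Lemma half_step_eq (p s q h : 'cV[C]_r) : h = p - s + q <-> p + p - h + q = p + s.
Proof.
split=> [->|E]; first by apply/matrixP => i j; rewrite !mxE; ring.
have -> : h = p + p + q - (p + s) by rewrite -E; apply/matrixP => i j; rewrite !mxE; ring.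
by apply/matrixP => i j; rewrite !mxE; ring.
Qed.

Lemma wrhss_stepP a f x xh x' : L2 f -> L2 x ->
  wrhss_step B A a f x xh x' <->
  [/\ L2 xh, relt a x (rhs1 a f x xh) & relt a x' (rhs2 a f xh)].
Proof.
move=> f2 x2.
have E1 phi : L2 xh -> test_function phi -> distr_of (rhs1 a f x xh) phi =
    a%:C%:M *m distr_of x phi + a%:C%:M *m distr_of x phi
    - (alphaI a xh + Hh A xh) phi + distr_of f phi.
  move=> xh2 tp; rewrite /rhs1 !distr_of_lin//; last 2 first.
  - exact: L2_mulf.
  - by apply: L2_lin => //; exact: L2_mulf.
  rewrite distr_of_mulf// double_scalar scaleN1r addrA; congr (_ - _ + _).
  by rewrite mulmxDl.
have E2 phi : L2 xh -> test_function phi ->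
    distr_of (rhs2 a f xh) phi = (alphaI a xh - Hh A xh + distr_of f) phi.
  move=> xh2 tp; rewrite /rhs2 -[mulf _ _]scale1r distr_of_lin//; last exact: L2_mulf.
  by rewrite scale1r distr_of_mulf// mulmxBl.
split=> [[xh2 x'2 S1 S2]|[xh2 [_ _ /eq_distr_dop S1] [x'2 _ /eq_distr_dop S2]]].
  split; first exact: xh2.
    split; [exact: x2|exact: L2_rhs1|apply/eq_distr_dop => phi tp].
    by rewrite E1//; apply/esym/half_step_eq; exact: S1.
  split; [exact: x'2|exact: L2_rhs2|apply/eq_distr_dop => phi tp].
  by rewrite E2// (S2 _ tp).
split=> // phi tp; last by rewrite S2// E2.
by apply/half_step_eq; rewrite -E1//; exact: esym (S1 _ tp).
Qed.

Lemma wrhss_freq_stepP a f x xh x' : L2 f -> L2 x ->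
  wrhss_freq_step B A a f x xh x' <->
  [/\ L2 xh, relw a x (rhs1 a f x xh) & relw a x' (rhs2 a f xh)].
Proof.
move=> f2 x2.
have E1 om : (shiftD a *m xh om = (a%:C%:M - Shw B A om) *m x om + f om) <->
    rhs1 a f x xh om = Mw a x om.
  by rewrite rhs1E /Mw double_scalar (mulmxBl _ (Shw B A om)) (mulmxDl _ (Shw B A om)); exact: half_step_eq.
have E2 om : rhs2 a f xh om = shiftB a *m xh om + f om by [].
split=> [[xh2 x'2 S1 S2]|[xh2 [_ _ S1] [x'2 _ S2]]].
  split; first exact: xh2.
    by split; [exact: x2|exact: L2_rhs1|apply: ae_sub S1 => om /E1].
  by split; [exact: x'2|exact: L2_rhs2|apply: ae_sub S2 => om S2; rewrite E2 -S2].
split; [exact: xh2|exact: x'2| |].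
  by apply: ae_sub S1 => om /E1.
by apply: ae_sub S2 => om S2; rewrite -E2 S2.
Qed.

(** [rel] stands for the graph of a + S_h or of its symbol. If it relates [x] to [g], inverting a +
    H in (a + H) xh = 2 a x - g + f solves the first half step; the second is solved since a + S_h
    is onto. Any [x'] so obtained lies in the domain by the second half step alone. *)
Lemma closed_step (step : fn -> fn -> fn -> Prop) (rel : fn -> fn -> Prop) (V : set fn) a f :
  0 < a -> hermitian_posdef H -> L2 f ->
  (forall v, V v <-> exists g, rel v g) ->
  (forall v g, rel v g -> L2 v /\ L2 g) ->
  (forall h, L2 h -> exists v, rel v h) ->
  (forall x xh x', L2 x -> step x xh x' <->
     [/\ L2 xh, rel x (rhs1 a f x xh) & rel x' (rhs2 a f xh)]) ->
  closed_under step (V `&` L2).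
Proof.
move=> a0 pH f2 VP rel2 solve stepP x [/VP[g xg] x2]; have [_ g2] := rel2 _ _ xg.
split=> [|xh x' /(stepP _ _ _ x2)[_ _ x'r]]; last first.
  by split; [apply/VP; eexists; exact: x'r|have [] := rel2 _ _ x'r].
have [P [d [PP PP' HE d0]]] := posdef_spectral _ pH.
have uD : shiftD a \in unitmx := posdef_shift_unit _ _ _ PP PP' HE d0 _ a0.
pose xh := mulf (invmx (shiftD a)) ((2 * a)%:C *: x + ((-1) *: g + f)).
have xh2 : L2 xh by apply: L2_mulf; apply: L2_lin => //; exact: L2_lin.
have [x' x'r] := solve _ (L2_rhs2 a _ _ f2 xh2).
exists xh, x'; apply/stepP => //; split=> //.
suff -> : rhs1 a f x xh = g by [].
apply/funext => t; rewrite rhs1E.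
have -> : shiftD a *m xh t = (2 * a)%:C *: x t + (- g t + f t).
  by rewrite -scaleN1r; exact: (mulKVmx uD).
by move: (_ *: _) (g t) (f t) => p q s; apply/matrixP => i j; rewrite !mxE; ring.
Qed.

Lemma contraction a f x xh x' xs : 0 < a -> (0 < r)%N -> hermitian_posdef H ->
  L2 f -> L2 xh -> relt a x (rhs1 a f x xh) -> relt a x' (rhs2 a f xh) ->
  relt a xs (rhs2 a f xs) ->
  exists g h : fn, [/\ relt a (x - xs) g, relt a (x' - xs) h &
    (normL h <= (sigma H a)%:E * normL g)%E].
Proof.
move=> a0 r0 pH f2 xh2 xr x'r xsr.
have [s0 _ sH] := sigma_contraction _ _ r0 pH a0.
have B1 u v g h : relt a u g -> relt a v h -> relt a (u - v) (g - h).
  by move=> ug vh; have := relt_lin _ (-1) _ _ _ _ vh ug; rewrite !scaleN1r ![- _ + _]addrC.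
have er := B1 _ _ _ _ xr xsr; have er' := B1 _ _ _ _ x'r xsr.
move: (erefl (rhs1 a f x xh - rhs2 a f xs)) (erefl (rhs2 a f xh - rhs2 a f xs)) er er'.
move: {2 3}(rhs1 a f x xh - _) {2 3}(rhs2 a f xh - _) => g h gE hE er er'.
exists g, h; split; [exact: er|exact: er'|]; have [e2 g2 _] := er; have [e'2 h2 _] := er'; have [xs2 _ _] := xsr.
rewrite (normLE _ h2) (normLE _ g2) -EFinM lee_fin -{1}(ger0_norm s0) -sqrtr_sqr -sqrtrM ?sqr_ge0//.
apply: ler_wsqrtr.
(* With e = xh - xs one has y = (a + H) e and h = (a - H) e, so the matrix contraction bounds [h] by
   [y]; then y = (a - S_h) (x - xs) is compared with [g]. *)
pose y := mulf (shiftD a) (xh - xs); have y2 : L2 y by apply: L2_mulf; exact: L2B.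
apply: (@le_trans _ _ (sigma H a ^+ 2 * vn2 y)).
  apply: vn2_le => //; first exact: sqr_ge0.
  apply: aeW => t; rewrite (_ : h t = shiftB a *m (xh - xs) t); first exact: sH.
  rewrite -hE -[LHS]/(shiftB a *m xh t + f t - (shiftB a *m xs t + f t)).
  by rewrite opprD addrACA subrr addr0 -mulmxBr.
apply: ler_wpM2l; first exact: sqr_ge0.
(* On the frequency side 2 a - (a + S_h) = a - S_h has the same norm as
   a + S_h. *)
have yE : y = (-1) *: g + mulf (2 * a)%:C%:M (x - xs).
  apply/funext => t; rewrite -gE -[RHS]/((-1) *: (rhs1 a f x xh t - (shiftB a *m xs t + f t)) +
    (2 * a)%:C%:M *m (x t - xs t)).
  rewrite rhs1E -[y t]/(shiftD a *m (xh t - xs t)) mulmxBr scaleN1r mul_scalar_mx scalerBr.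
  rewrite [(2 * a)%:C *: xs t]double_scalar /shiftB mulmxBl /shiftD !(mulmxDl _ H).
  move: ((2 * a)%:C *: _) (a%:C%:M *m xh t) (H *m xh t) (a%:C%:M *m xs t) (H *m xs t) (f t) => X p q p' q' F.
  by apply/matrixP => i j; rewrite !mxE; ring.
have [w ew] := vfourier_exists _ e2; have [z gz] := vfourier_exists _ g2.
have [w2 z2 zw] := (rel_fourier _ _ _ _ _ ew gz).1 er.
have yz : vfourier y ((-1) *: z + mulf (2 * a)%:C%:M w).
  by rewrite yE; exact: (vfourier_lin (-1) _ _ _ _ gz (vfourier_mulf _ _ _ ew)).
rewrite -(vfourier_vn2 _ _ yz) -(vfourier_vn2 _ _ gz) -[leRHS]mul1r.
apply: vn2_le => //; first by have [] := vfourier_L2 _ _ yz.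
apply: ae_sub zw => om zw; rewrite mul1r zw /Mw -(vnsq_skew_shift_sub _ _ (Shw_skew om)).
rewrite (_ : (_ + _) om = (a%:C%:M - Shw B A om) *m w om)//.
rewrite -[LHS]/((-1) *: z om + (2 * a)%:C%:M *m w om) zw /Mw mul_scalar_mx double_scalar.
rewrite (mulmxBl _ (Shw B A om)) (mulmxDl _ (Shw B A om)) scaleN1r.
move: (a%:C%:M *m w om) (_ *m w om) => p q.
by apply/matrixP => i j; rewrite !mxE; ring.
Qed.

(** Adding (a - H) xs to both sides of the equation turns A into a + S; hence the solution is also a
    fixed point of the second half step. *)
Lemma relt_solution a f xs : L2 f -> L2 xs -> eq_distr (Lh B A xs) (distr_of f) ->
  relt a xs (rhs2 a f xs).
Proof.
move=> f2 xs2 S; have S' : dop B A xs f.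
  by move=> phi tp; rewrite -(S _ tp) -[RHS]/(B *m - distr_of xs (derive1 phi) + A *m distr_of xs phi) mulmxN.
have E : A + shiftB a = a%:C%:M + spart A.
  apply: (@etrans _ _ ((hpart A + spart A) + shiftB a)); first by rewrite hpartDspart.
  by rewrite /shiftB; move: (hpart A) (spart A) (a%:C%:M) => X Y Z; rewrite addrC -addrA addKr.
have D := dop_shift _ _ (shiftB a) _ _ xs2 f2 S'; rewrite E (addrC f) in D.
by split; [exact: xs2|exact: L2_rhs2|exact: D].
Qed.

End Method.

Lemma optimal_parameter (R : realType) (r : nat) (H : 'M[R[i]]_r) (gmin gmax : R) :
  hermitian_posdef H -> spectrum H gmin%:C -> spectrum H gmax%:C ->
  (forall l, spectrum H l -> gmin%:C <= l <= gmax%:C) ->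
  [/\ argmin_pos (worst_rate gmin gmax) = [set Num.sqrt (gmin * gmax)],
      sigma H (Num.sqrt (gmin * gmax)) =
        (Num.sqrt gmax - Num.sqrt gmin) / (Num.sqrt gmax + Num.sqrt gmin) &
      (Num.sqrt gmax - Num.sqrt gmin) / (Num.sqrt gmax + Num.sqrt gmin) =
        (Num.sqrt (spectral_cond H) - 1) / (Num.sqrt (spectral_cond H) + 1)].
Proof.
move=> pH Hmin Hmax Hl; have [P [d [PP PP' HE d0]]] := posdef_spectral _ pH.
have sp := spectral_spectrum _ _ _ PP PP' HE.
have [i /complexI Ei] := (sp _).1 Hmin; have [j /complexI Ej] := (sp _).1 Hmax.
have dk k : gmin <= d k <= gmax.
  by rewrite -!lecR; apply: Hl; apply/sp; exists k.
have g0 : 0 < gmin by rewrite Ei.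
have gg : gmin <= gmax by have /andP[] := dk j; rewrite -Ej.
split; first exact: argmin_worst_rate.
  have s0 : 0 < Num.sqrt (gmin * gmax) by rewrite sqrtr_gt0 mulr_gt0// (lt_le_trans g0).
  rewrite (sigmaE _ _ gmin gmax _ g0 s0 Hmin Hmax) ?rate_sqrt// => l /sp[k ->].
  by exists (d k).
rewrite (spectral_cond_posdef _ _ _ PP PP' HE d0 i j) -?Ei -?Ej ?sqrt_cond//.
Qed.

Lemma geometric_decay_cvg0 (R : realType) (q : R) (s : nat -> R) : 0 <= q -> q < 1 ->
  (forall k, 0 <= s k) -> (forall k, s k.+1 <= q * s k) -> s k @[k --> \oo] --> (0 : R).
Proof.
move=> q0 q1 s0 sq; have sk k : s k <= s 0%N * q ^+ k.
  elim: k => [|k IH]; first by rewrite expr0 mulr1.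
  by rewrite (le_trans (sq k))// exprS mulrCA ler_wpM2l.
have c0 : s 0%N * q ^+ k @[k --> \oo] --> (0 : R).
  rewrite -(mulr0 (s 0%N)); apply: cvgM; first exact: cvg_cst.
  by apply: cvg_expr; rewrite ger0_norm.
apply: (squeeze_cvgr _ (cvg_cst (0 : R)) c0); apply: nearW => k.
by rewrite s0 sk.
Qed.

Theorem theorem3p2 (R : realType) (r : nat) (hr : (0 < r)%N)
    (B A : 'M[R[i]]_r) (hB : B \is hermsymmx)
    (hA : hermitian_posdef (hpart A))
    (f xs : R -> 'cV[R[i]]_r) (hf : L2 f) (hxs : L2 xs)
    (hsol : eq_distr (Lh B A xs) (distr_of f)) :
  [/\ forall a : R, 0 < a -> Vt B A a xs,
      forall a : R, 0 < a ->
        [/\ closed_under (wrhss_step B A a f) (Vt B A a `&` L2),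
            forall ft, is_fourier f ft ->
              closed_under (wrhss_freq_step B A a ft) (Vw B A a `&` L2),
            sigma (hpart A) a < 1 &
            forall x xh : nat -> R -> 'cV[R[i]]_r,
              (Vt B A a `&` L2) (x 0%N) ->
              (forall k, wrhss_step B A a f (x k) (xh k) (x k.+1)) ->
              [/\ forall k, (Vt B A a `&` L2) (x k),
                  forall k, (exists xt, is_fourier (x k) xt) /\
                    forall xt, is_fourier (x k) xt -> (Vw B A a `&` L2) xt,
                  forall k, (normt B A a (x k.+1 - xs)%R <=
                    (sigma (hpart A) a)%:E * normt B A a (x k - xs)%R)%E &
                  normt B A a (x k - xs)%R @[k --> \oo] --> 0%E]] &
      forall gmin gmax : R,
        spectrum (hpart A) gmin%:C -> spectrum (hpart A) gmax%:C ->
        (forall l, spectrum (hpart A) l -> gmin%:C <= l <= gmax%:C) ->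
        [/\ argmin_pos (worst_rate gmin gmax) = [set Num.sqrt (gmin * gmax)],
            sigma (hpart A) (Num.sqrt (gmin * gmax)) =
              (Num.sqrt gmax - Num.sqrt gmin) / (Num.sqrt gmax + Num.sqrt gmin) &
            (Num.sqrt gmax - Num.sqrt gmin) / (Num.sqrt gmax + Num.sqrt gmin) =
              (Num.sqrt (spectral_cond (hpart A)) - 1) /
              (Num.sqrt (spectral_cond (hpart A)) + 1)]].
Proof.
have xsr a := relt_solution B A a f xs hf hxs hsol.
split=> [a a0|a a0|gmin gmax]; last exact: optimal_parameter.
  by apply/VtP; eexists; exact: xsr.
have ct : closed_under (wrhss_step B A a f) (Vt B A a `&` L2).
  apply: (closed_step A _ (relt B A a) _ a f a0 hA hf).
  - exact: VtP.
  - by move=> v g [].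
  - by move=> h; exact: relt_solve.
  - by move=> x xh x' x2; exact: wrhss_stepP.
have [s0 s1 _] := sigma_contraction _ a hr hA a0.
split.
- exact: ct.
- move=> ft [ft2 _]; apply: (closed_step A _ (relw B A a) _ a ft a0 hA ft2).
  + exact: VwP.
  + by move=> v g [].
  + by move=> h; exact: relw_solve.
  + by move=> x xh x' x2; exact: wrhss_freq_stepP.
- exact: s1.
move=> x xh x0 xS.
have xV k : (Vt B A a `&` L2) (x k).
  by elim: k => [|k IH]; [exact: x0|exact: (ct _ IH).2 (xS k)].
have xk k : L2 (x k) := (xV k).2.
(* All errors have finite norm, being in the domain, so the extended-real inequality becomes one
   between real numbers and can be iterated. *)
have step k : exists s t : R, [/\ 0 <= s, normt B A a (x k - xs) = s%:E,
    normt B A a (x k.+1 - xs) = t%:E & t <= sigma (hpart A) a * s].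
  have [xh2 xr x'r] := (wrhss_stepP B A a f (x k) (xh k) (x k.+1) hf (xk k)).1 (xS k).
  have [g [h [eg eh gh]]] := contraction B A hB a f _ _ _ xs a0 hr hA hf xh2 xr x'r (xsr a).
  have [_ g2 _] := eg; have [_ h2 _] := eh.
  exists (Num.sqrt (vn2 g)), (Num.sqrt (vn2 h)).
  rewrite (relt_normt _ _ _ _ _ eg) (relt_normt _ _ _ _ _ eh) !normLE//.
  by split=> //; move: gh; rewrite (normLE _ g2) (normLE _ h2) -EFinM lee_fin.
split.
- exact: xV.
- move=> k; have k2 := xk k; have [w xw] := vfourier_exists _ k2.
  split; first by exists w; apply/is_fourierP.
  (* The graph relation of [x k] is transported to the frequency side, for whichever function [xt]
     represents the transform. *)
  move=> xt /(is_fourierP _ _ k2) xxt; have [_ xt2] := vfourier_L2 _ _ xxt.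
  split=> //; apply/VwP; have [/VtP[g xg] _] := xV k; have [_ g2 _] := xg.
  have [z gz] := vfourier_exists _ g2; exists z.
  exact: (rel_fourier _ _ _ _ _ _ _ xxt gz).1 xg.
- by move=> k; have [s [t [_ -> -> ts]]] := step k; rewrite -EFinM lee_fin.
have sE k : normt B A a (x k - xs) = (fine (normt B A a (x k - xs)))%:E.
  by have [s [t [_ -> _ _]]] := step k.
apply/fine_cvgP; split.
  by apply: nearW => k; rewrite sE.
apply: (geometric_decay_cvg0 _ (sigma (hpart A) a)) => // k.
  by have [s [t [? -> _ _]]] := step k.
by have [s [t [_ -> -> ?]]] := step k.
Qed.
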